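(* Let $R(q)$ denote the Rogers--Ramanujan continued fraction. Then $$ R^{5}\left( e^{-\pi \sqrt{26/5}} \right) = \sqrt{a^2+1}-a, $$ where $$ a = 208818-93240 \sqrt{5}-57825 \sqrt{13}+25900 \sqrt{65}. $$
   Context: For $|q|<1$, the Rogers--Ramanujan continued fraction is $$ R(q) = \cfrac{q^{1/5}}{1 + \cfrac{q}{1 + \cfrac{q^2}{1 + \cfrac{q^3}{1+\cdots}}}} = q^{1/5}\prod_{n=1}^{\infty}\frac{(1-q^{5n-1})(1-q^{5n-4})}{(1-q^{5n-2})(1-q^{5n-3})}. $$ Here $q^{1/5}$ is the positive real fifth root for $0<q<1$, and $R^5(q)$ denotes $(R(q))^5$. *)

(* Defs.v *)
From Stdlib Require Import Reals Lra Lia.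
From Coquelicot Require Import Coquelicot.
Open Scope R_scope.

(** [rr_tail q k n] is the finite continued fraction
    [1 + q^k/(1 + q^(k+1)/(1 + ... + q^(k+n-1)/1))], with [n] numerators. *)
Fixpoint rr_tail (q : R) (k n : nat) : R :=
  match n with
  | O => 1
  | S m => 1 + q ^ k / rr_tail q (S k) m
  end.

Definition rr_convergent (q : R) (n : nat) : R :=
  Rpower q (1 / 5) / rr_tail q 1 n.

(** The Rogers-Ramanujan continued fraction at a real [q] with [0 < q < 1], as
    the limit of its convergents; the limit exists and is finite by
    [rr_convergent_lim] below.  [Rpower q (1 / 5)] is the positive fifth root
    of [q] only for [0 < q]; other values of [q] carry no meaning here. *)
Definition rogers_ramanujan (q : R) : R := real (Lim_seq (rr_convergent q)).

Lemma rr_tail_ge1 (q : R) (k n : nat) : 0 < q -> 1 <= rr_tail q k n.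
Proof.
intros Hq; revert k; induction n as [|n IH]; intros k; simpl; [lra|].
assert (H := IH (S k)).
assert (0 < q ^ k) by now apply pow_lt.
assert (0 < q ^ k / rr_tail q (S k) n) by (apply Rdiv_lt_0_compat; lra).
lra.
Qed.

Lemma rr_tail_step (q : R) (k n : nat) :
  0 < q < 1 -> (1 <= k)%nat ->
  Rabs (rr_tail q k (S n) - rr_tail q k n) <= q ^ n.
Proof.
intros Hq; revert k; induction n as [|n IH]; intros k Hk.
- assert (0 < q ^ k) by (apply pow_lt; lra).
  assert (q ^ k <= 1) by (rewrite <- (pow1 k); apply pow_incr; lra).
  simpl; replace (1 + q ^ k / 1 - 1) with (q ^ k) by field.
  rewrite Rabs_pos_eq; lra.
- change (Rabs ((1 + q ^ k / rr_tail q (S k) (S n)) -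
                (1 + q ^ k / rr_tail q (S k) n)) <= q * q ^ n).
  assert (H := IH (S k) ltac:(lia)).
  assert (Hx := rr_tail_ge1 q (S k) (S n) (proj1 Hq)).
  assert (Hy := rr_tail_ge1 q (S k) n (proj1 Hq)).
  revert H Hx Hy.
  generalize (rr_tail q (S k) (S n)) (rr_tail q (S k) n); intros x y H Hx Hy.
  replace (1 + q ^ k / x - (1 + q ^ k / y))
    with (- (q ^ k * / (x * y)) * (x - y)) by (field; lra).
  assert (0 <= q ^ k) by (apply pow_le; lra).
  assert (q ^ k <= q).
  { destruct k as [|k]; [lia|]; simpl.
    assert (q ^ k <= 1) by (rewrite <- (pow1 k); apply pow_incr; lra).
    nra. }
  assert (0 < / (x * y) <= 1).
  { split; [apply Rinv_0_lt_compat; nra|].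
    rewrite <- Rinv_1; apply Rinv_le_contravar; nra. }
  rewrite Rabs_mult, Rabs_Ropp, (Rabs_pos_eq (_ * _)) by nra.
  apply Rmult_le_compat; [nra|apply Rabs_pos|nra|exact H].
Qed.

Lemma rr_tail_lim (q : R) :
  0 < q < 1 -> exists l : R, 1 <= l /\ is_lim_seq (rr_tail q 1) l.
Proof.
intros Hq.
assert (He : ex_series (fun n => rr_tail q 1 (S n) - rr_tail q 1 n)).
{ apply (ex_series_le (V := R_CompleteNormedModule) _ (pow q)).
  - intros n; apply (rr_tail_step q 1 n Hq); lia.
  - apply ex_series_geom; rewrite Rabs_pos_eq; lra. }
destruct He as [s Hs].
assert (Hl : is_lim_seq (rr_tail q 1) (s + 1)).
{ apply is_lim_seq_incr_1.
  apply is_lim_seq_ext with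
    (fun n => sum_n (fun m => rr_tail q 1 (S m) - rr_tail q 1 m) n + 1).
  - intros n; induction n as [|n IH].
    + rewrite sum_O; simpl; lra.
    + rewrite sum_Sn; unfold plus; simpl (AbelianMonoid.plus _ _) in *.
      change (sum_n (fun m => rr_tail q 1 (S m) - rr_tail q 1 m) n +
        (rr_tail q 1 (S (S n)) - rr_tail q 1 (S n)) + 1 =
        rr_tail q 1 (S (S n))).
      lra.
  - apply is_lim_seq_plus'; [exact Hs | apply is_lim_seq_const]. }
exists (s + 1); split; [|exact Hl].
apply (is_lim_seq_le (fun _ => 1) (rr_tail q 1) 1 (s + 1)).
- intros n; apply rr_tail_ge1; lra.
- apply is_lim_seq_const.
- exact Hl.
Qed.

Lemma rr_convergent_lim (q : R) :
  0 < q < 1 -> is_lim_seq (rr_convergent q) (rogers_ramanujan q).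
Proof.
intros Hq; destruct (rr_tail_lim q Hq) as [l [Hl1 Hl]].
assert (H : is_lim_seq (rr_convergent q) (Rpower q (1 / 5) / l)).
{ apply is_lim_seq_div'; [apply is_lim_seq_const | exact Hl | lra]. }
unfold rogers_ramanujan; rewrite (is_lim_seq_unique _ _ H); exact H.
Qed.

(* Main.v *)
Require Import Defs.
From Stdlib Require Import Reals Lra Lia List ZArith.
From Coquelicot Require Import Coquelicot.
Open Scope R_scope.

(** With [tau = i y0], [y0 = sqrt (26/5) / 2], Ramanujan's identity
    [1/R^5 - 11 - R^5 = (eta(tau)/eta(5 tau))^6] reduces the evaluation to an eta
    quotient.  Its proof reads [R] as a quotient of two theta constants
    (Hardy-Wright's proof of the continued fraction, Jacobi's triple product) and
    shows that Klein's icosahedral form in them, divided by [eta^12], is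
    invariant under [tau -> tau + 1] and [tau -> -1/tau], hence constant.

    The values of eta at [tau, 2 tau, 5 tau, 10 tau] satisfy two modular relations
    of level 10.  As [10 y0^2 = 13], the points [tau', 2 tau', 13 tau', 26 tau']
    with [tau' = -1/(2 tau)] are [-1/(2 tau), -1/tau, 5 tau, 10 tau], and a relation
    of level 26 at [tau'] becomes, by [eta(-1/tau) = sqrt(-i tau) eta(tau)], a third
    one between the same four values.  The three equations are solved by radicals.

    Holomorphic functions are handled as uniform limits of polynomials.  A
    modular relation [F = 0] is proved without Riemann surfaces: [|F|] divided by a
    nonvanishing eta product is invariant under enough substitutions to bring
    every point of the half-plane into a disc [|q| <= rho < 1], and it has a zero at
    [q = 0], so Schwarz's lemma bounds its supremum by a proper fraction of itself. *)

(** * Polynomials and the maximum principle *)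

(** The inversion laws are proved for real arguments only, where they follow from Polya's derivation
    of Poisson summation from binomial coefficients, and they are carried to the half-plane by an
    identity theorem for uniform limits of polynomials. Klein's form is the right one because
    [tau -> -1/tau] acts on the two theta constants, up to a scalar, as a symmetry of the
    icosahedron; its degree 12 matches the weight of [eta^12]. The transformation laws are stated
    for [eta^2], which has weight 1: the automorphy factor is then rational and the multipliers are
    12th roots of unity, so that no branch of a square root occurs. Vanishing is checked at a single
    cusp: the Fricke and Atkin-Lehner involutions permute the cusps of levels 10 and 26
    transitively, and a comparison of moduli ignores multipliers. The final algebraic system has
    conjugate solutions, among which crude bounds on eta products decide. *)

Lemma Cmod_sub_triangle (x y z : C) :
  Cmod (x - z) <= Cmod (x - y) + Cmod (y - z).
Proof.
replace (x - z)%C with ((x - y) + (y - z))%C by ring; apply Cmod_triangle.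
Qed.

Lemma Cmod_triangle_sub (x y : C) : Cmod x <= Cmod y + Cmod (x - y).
Proof.
replace x with (y + (x - y))%C at 1 by ring; apply Cmod_triangle.
Qed.

Lemma Cmod_sub_sym (x y : C) : Cmod (x - y) = Cmod (y - x).
Proof. rewrite <- Cmod_opp; f_equal; ring. Qed.

Lemma Cmod_0_ge (x : C) : Cmod x <= 0 -> x = 0%C.
Proof. intros H; apply Cmod_eq_0; generalize (Cmod_ge_0 x); lra. Qed.

Lemma le_of_forall_le_mult_eps (x y K : R) :
  0 <= K -> (forall e, 0 < e -> x <= y + K * e) -> x <= y.
Proof.
intros HK H; destruct (Rle_lt_dec x y) as [|Hl]; auto.
assert (He : 0 < (x - y) / (2 * (K + 1))) by (apply Rdiv_lt_0_compat; lra).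
specialize (H _ He).
assert (K * ((x - y) / (2 * (K + 1))) <= (x - y) / 2).
{ apply Rmult_le_reg_r with (2 * (K + 1)); [lra|]; field_simplify; nra. }
lra.
Qed.

(** * Finite complex sums and roots of unity *)

Fixpoint csum (f : nat -> C) (n : nat) : C :=
  match n with O => 0%C | S m => (csum f m + f m)%C end.

Lemma csum_ext (f g : nat -> C) (n : nat) :
  (forall k, (k < n)%nat -> f k = g k) -> csum f n = csum g n.
Proof.
induction n as [|n IH]; intros H; simpl; auto.
rewrite IH, H; auto with arith.
Qed.

Lemma csum_plus (f g : nat -> C) (n : nat) :
  csum (fun k => f k + g k)%C n = (csum f n + csum g n)%C.
Proof. induction n as [|n IH]; simpl; [ring|rewrite IH; ring]. Qed.

Lemma csum_scal (c : C) (f : nat -> C) (n : nat) :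
  csum (fun k => c * f k)%C n = (c * csum f n)%C.
Proof. induction n as [|n IH]; simpl; [ring|rewrite IH; ring]. Qed.

Lemma csum_zero (n : nat) : csum (fun _ => 0%C) n = 0%C.
Proof. induction n as [|n IH]; simpl; [ring|rewrite IH; ring]. Qed.

Lemma csum_swap (f : nat -> nat -> C) (n m : nat) :
  csum (fun i => csum (f i) m) n = csum (fun j => csum (fun i => f i j) n) m.
Proof.
induction n as [|n IH]; simpl.
- now rewrite csum_zero.
- now rewrite IH, csum_plus.
Qed.

Lemma csum_bound (f : nat -> C) (B : R) (n : nat) :
  (forall k, (k < n)%nat -> Cmod (f k) <= B) -> Cmod (csum f n) <= INR n * B.
Proof.
induction n as [|n IH]; intros H; cbn [csum].
- rewrite Cmod_0; simpl; lra.
- eapply Rle_trans; [apply Cmod_triangle|].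
  rewrite S_INR.
  assert (Cmod (csum f n) <= INR n * B) by (apply IH; auto with arith).
  assert (Cmod (f n) <= B) by (apply H; auto).
  lra.
Qed.

Lemma csum_single (f : nat -> C) (m n : nat) :
  (m < n)%nat -> (forall k, (k < n)%nat -> k <> m -> f k = 0%C) ->
  csum f n = f m.
Proof.
intros Hm H; induction n as [|n IH]; [lia|]; simpl.
destruct (Nat.eq_dec m n) as [->|Hne].
- rewrite (csum_ext f (fun _ => 0%C)), csum_zero; [ring|].
  intros k Hk; apply H; lia.
- rewrite IH; [rewrite (H n); [ring|lia|lia]|lia|].
  intros k Hk; apply H; lia.
Qed.

Definition cis (x : R) : C := (cos x, sin x).

Lemma cis_plus (x y : R) : cis (x + y) = (cis x * cis y)%C.
Proof.
unfold cis, Cmult; simpl; rewrite cos_plus, sin_plus; f_equal; ring.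
Qed.

Lemma cis_pow (x : R) (n : nat) : (cis x ^ n)%C = cis (INR n * x).
Proof.
induction n as [|n IH].
- simpl; unfold cis; rewrite Rmult_0_l, cos_0, sin_0; reflexivity.
- rewrite Cpow_S, IH, <- cis_plus; f_equal; rewrite S_INR; ring.
Qed.

Lemma Cmod_cis (x : R) : Cmod (cis x) = 1.
Proof.
unfold Cmod, cis; simpl fst; simpl snd.
replace (cos x ^ 2 + sin x ^ 2) with 1; [apply sqrt_1|].
rewrite <- (sin2_cos2 x); unfold Rsqr; ring.
Qed.

Lemma cis_2kPI (k : nat) : cis (2 * INR k * PI) = 1%C.
Proof.
unfold cis; rewrite <- (Rplus_0_l (2 * INR k * PI)), cos_period, sin_period.
now rewrite cos_0, sin_0.
Qed.

Lemma csum_pow_geom (w : C) (n : nat) :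
  ((w - 1) * csum (fun j => w ^ j) n = w ^ n - 1)%C.
Proof.
induction n as [|n IH]; cbn [csum].
- simpl; ring.
- rewrite Cmult_plus_distr_l, IH, Cpow_S; ring.
Qed.

(** A geometric sum whose ratio is an [N]-th root of unity other than 1. The range of [e] is that of
    the exponents [N - k + m] with [k, m < N] in the interpolation formula, where [e = N] is the
    diagonal case [k = m]. *)
Lemma csum_root_unity (N e : nat) :
  (0 < e < 2 * N)%nat -> e <> N ->
  csum (fun j => cis (2 * PI / INR N) ^ (e * j))%C N = 0%C.
Proof.
intros He HeN.
assert (HN : 0 < INR N) by (apply lt_0_INR; lia).
set (w := (cis (2 * PI / INR N) ^ e)%C).
rewrite (csum_ext _ (fun j => w ^ j)%C)
  by (intros k _; unfold w; now rewrite Cpow_mult_r).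
assert (Hw : w = cis (2 * (INR e * PI / INR N))).
{ unfold w; rewrite cis_pow; f_equal; field; lra. }
assert (HwN : (w ^ N)%C = 1%C).
{ rewrite Hw, cis_pow, <- (cis_2kPI e); f_equal; field; lra. }
assert (Hne : (w - 1)%C <> 0%C).
{ intros H0; rewrite Hw in H0.
  (* The real part of [w = 1] gives [sin y = 0] for the half angle [y], which lies strictly between
     0 and [2 * PI]; so [y = PI], that is [e = N]. *)
  apply (f_equal fst) in H0; unfold cis in H0; simpl in H0.
  rewrite cos_2a_sin in H0.
  set (y := INR e * PI / INR N) in *.
  assert (Hs : sin y = 0) by nra.
  assert (Hpi := PI_RGT_0).
  assert (Hy0 : 0 < y).
  { apply Rdiv_lt_0_compat; [|lra]; apply Rmult_lt_0_compat; [|lra].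
    apply lt_0_INR; lia. }
  assert (Hy2 : y < 2 * PI).
  { unfold y; apply Rmult_lt_reg_r with (INR N); [lra|].
    assert (INR e < 2 * INR N).
    { replace 2 with (INR 2) by (simpl; ring); rewrite <- mult_INR.
      apply lt_INR; lia. }
    field_simplify; [nra|lra]. }
  destruct (Rtotal_order y PI) as [Hlt|[Heq|Hgt]].
  - generalize (sin_gt_0 y Hy0 Hlt); lra.
  - apply HeN, INR_eq.
    assert (INR e * PI = INR N * PI) by
      (rewrite <- Heq at 2; unfold y; field; lra).
    nra.
  - generalize (sin_lt_0 y Hgt Hy2); lra. }
assert (Hg := csum_pow_geom w N).
rewrite HwN in Hg; unfold Cminus in Hg at 2; rewrite Cplus_opp_r in Hg.
destruct (Ceq_dec (csum (fun j => w ^ j)%C N) 0) as [|Hn]; auto.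
exfalso; exact (Cmult_neq_0 _ _ Hne Hn Hg).
Qed.

(** * Polynomials as coefficient lists *)

Fixpoint peval (l : list C) (z : C) : C :=
  match l with nil => 0%C | c :: l => (c + z * peval l z)%C end.

Fixpoint padd (l m : list C) : list C :=
  match l, m with
  | nil, _ => m
  | _, nil => l
  | a :: l, b :: m => (a + b)%C :: padd l m
  end.

Definition pscal (c : C) (l : list C) : list C := map (Cmult c) l.

Fixpoint pmul (l m : list C) : list C :=
  match l with nil => nil | a :: l => padd (pscal a m) (RtoC 0 :: pmul l m) end.

Lemma peval_add (l m : list C) (z : C) :
  peval (padd l m) z = (peval l z + peval m z)%C.
Proof.
revert m; induction l as [|a l IH]; intros [|b m]; simpl; try ring.
rewrite IH; ring.
Qed.

Lemma peval_scal (c : C) (l : list C) (z : C) :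
  peval (pscal c l) z = (c * peval l z)%C.
Proof.
unfold pscal; induction l as [|a l IH]; simpl; [ring|].
rewrite IH; ring.
Qed.

Lemma peval_mul (l m : list C) (z : C) :
  peval (pmul l m) z = (peval l z * peval m z)%C.
Proof.
induction l as [|a l IH]; simpl; [ring|].
rewrite peval_add, peval_scal; simpl; rewrite IH; ring.
Qed.

Lemma length_padd (l m : list C) :
  (length (padd l m) <= Nat.max (length l) (length m))%nat.
Proof.
revert m; induction l as [|a l IH]; intros [|b m]; simpl; try lia.
specialize (IH m); lia.
Qed.

Lemma length_pmul (l m : list C) :
  (length (pmul l m) <= length l + length m)%nat.
Proof.
induction l as [|a l IH]; simpl; [lia|].
eapply Nat.le_trans; [apply length_padd|].
unfold pscal; rewrite length_map; simpl; lia.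
Qed.

Fixpoint ppow (l : list C) (n : nat) : list C :=
  match n with O => RtoC 1 :: nil | S n => pmul l (ppow l n) end.

Lemma peval_pow (l : list C) (n : nat) (z : C) :
  peval (ppow l n) z = (peval l z ^ n)%C.
Proof.
induction n as [|n IH]; [simpl; ring|].
cbn [ppow]; rewrite peval_mul, IH, Cpow_S; ring.
Qed.

Lemma length_ppow (l : list C) (n : nat) :
  (length (ppow l n) <= n * length l + 1)%nat.
Proof.
induction n as [|n IH]; [simpl; lia|].
cbn [ppow]; generalize (length_pmul l (ppow l n)); lia.
Qed.

Lemma peval_div (l : list C) (a : C) :
  exists s, forall z, peval l z = (peval l a + (z - a) * peval s z)%C.
Proof.
induction l as [|c l [s Hs]].
- exists nil; intros z; simpl; ring.
- exists (padd l (pscal a s)); intros z.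
  simpl; rewrite peval_add, peval_scal, (Hs z); ring.
Qed.

(* Lagrange interpolation at the [N] points [R w^j] on the circle reproduces
   polynomials of degree below [N]; each weight is at most [1] on the disc. *)
Lemma peval_le_length (l : list C) (N : nat) (r M : R) (z0 : C) :
  (length l <= N)%nat -> (0 < N)%nat -> 0 < r ->
  (forall z, Cmod z = r -> Cmod (peval l z) <= M) -> Cmod z0 <= r ->
  Cmod (peval l z0) <= INR N * M.
Proof.
intros Hl HN Hr HM Hz0.
set (w := cis (2 * PI / INR N)).
assert (HN0 : 0 < INR N) by (apply lt_0_INR; lia).
assert (Hr0 : RtoC r <> 0%C) by (intros H; injection H; lra).
assert (HwN : (w ^ N)%C = 1%C).
{ unfold w; rewrite cis_pow, <- (cis_2kPI 1); f_equal; simpl; field; lra. }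
set (zt := fun j => (r * w ^ j)%C).
assert (Hzt : forall j, Cmod (zt j) = r).
{ intros j; unfold zt, w; rewrite Cmod_mult, Cmod_pow, Cmod_cis, pow1, Cmod_R.
  rewrite Rabs_pos_eq; lra. }
(* As [zt j ^ N = r ^ N], this is the sum of the [(z0 / zt j) ^ k], which is [N] times the Lagrange
   basis polynomial of the node [zt j], written without negative powers of [zt j]. *)
set (kap := fun j => csum (fun k => z0 ^ k * zt j ^ (N - k) / r ^ N)%C N).
assert (Hmono : forall m, (m < N)%nat ->
  csum (fun j => kap j * zt j ^ m)%C N = (RtoC (INR N) * z0 ^ m)%C).
{ intros m Hm; unfold kap.
  rewrite (csum_ext _ (fun j =>
    csum (fun k => z0 ^ k * zt j ^ (N - k + m) / r ^ N) N)%C).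
  2:{ intros j _; rewrite Cmult_comm, <- csum_scal; apply csum_ext; intros k Hk.
      rewrite Cpow_add_r; field; now apply Cpow_nz. }
  rewrite csum_swap, (csum_single _ m).
  - rewrite (csum_ext _ (fun j => z0 ^ m * 1)%C).
    + rewrite csum_scal.
      replace (csum (fun _ => 1%C) N) with (RtoC (INR N)); [ring|].
      clear; induction N as [|N IH]; cbn [csum]; [reflexivity|].
      rewrite <- IH, S_INR, RtoC_plus; reflexivity.
    + intros j _; replace (N - m + m)%nat with N by lia.
      unfold zt; rewrite Cpow_mult_l, <- Cpow_mult_r, Nat.mul_comm, Cpow_mult_r.
      rewrite HwN, Cpow_1_l; field; now apply Cpow_nz.
  - exact Hm.
  - intros k Hk Hne.
    rewrite (csum_ext _ (fun j => (z0 ^ k * r ^ (N - k + m) / r ^ N) *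
      w ^ ((N - k + m) * j))%C).
    + rewrite csum_scal; unfold w; rewrite csum_root_unity; [ring|lia|lia].
    + intros j _; unfold zt; rewrite Cpow_mult_l, <- (Cpow_mult_r w).
      rewrite (Nat.mul_comm j); field; now apply Cpow_nz. }
assert (Hall : forall m, (m + length l <= N)%nat ->
  csum (fun j => kap j * (zt j ^ m * peval l (zt j)))%C N =
  (RtoC (INR N) * (z0 ^ m * peval l z0))%C).
{ clear HM Hl; induction l as [|c l IH]; intros m Hm.
  - simpl; rewrite (csum_ext _ (fun _ => 0%C)), csum_zero; [ring|].
    intros k _; ring.
  - simpl in Hm |- *.
    rewrite (csum_ext _ (fun j => c * (kap j * zt j ^ m) +
      kap j * (zt j ^ (S m) * peval l (zt j)))%C)
      by (intros j _; rewrite Cpow_S; ring).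
    rewrite csum_plus, csum_scal, Hmono, IH by lia.
    rewrite Cpow_S; ring. }
specialize (Hall O ltac:(lia)).
assert (Hk : forall j, Cmod (kap j) <= INR N * 1).
{ intros j; apply csum_bound; intros k Hk.
  rewrite Cmod_div by now apply Cpow_nz.
  rewrite Cmod_mult, !Cmod_pow, Hzt, Cmod_R, (Rabs_pos_eq r) by lra.
  apply Rmult_le_reg_r with (r ^ N); [now apply pow_lt|].
  unfold Rdiv; rewrite Rmult_assoc, Rinv_l, Rmult_1_r, Rmult_1_l
    by (apply pow_nonzero; lra).
  replace N with (k + (N - k))%nat at 2 by lia; rewrite pow_add.
  apply Rmult_le_compat_r; [apply pow_le; lra|].
  apply pow_incr; split; [apply Cmod_ge_0|lra]. }
assert (Hb : Cmod (csum (fun j => kap j * (zt j ^ 0 * peval l (zt j)))%C N) <=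
  INR N * (INR N * M)).
{ apply csum_bound; intros j _.
  rewrite Cmod_mult; replace (zt j ^ 0 * peval l (zt j))%C with (peval l (zt j))
    by (simpl; ring).
  specialize (Hk j); specialize (HM _ (Hzt j)).
  assert (0 <= Cmod (kap j)) by apply Cmod_ge_0.
  assert (0 <= Cmod (peval l (zt j))) by apply Cmod_ge_0.
  apply Rmult_le_compat; lra. }
rewrite Hall, !Cmod_mult, Cmod_R, Rabs_pos_eq in Hb by lra.
simpl (z0 ^ 0)%C in Hb; rewrite Cmod_1, Rmult_1_l in Hb.
apply Rmult_le_reg_l with (INR N); lra.
Qed.

Lemma pow_le_linear_le1 (x L : R) :
  0 <= x -> 0 <= L -> (forall n : nat, x ^ n <= INR n * L + 1) -> x <= 1.
Proof.
intros Hx HL H; destruct (Rle_lt_dec x 1) as [|Hl]; auto; exfalso.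
set (d := x - 1).
assert (Hd : 0 < d) by (unfold d; lra).
destruct (INR_unbounded (2 * L / (d * d) + 1)) as [n Hn].
assert (Hn0 : 0 < INR n).
{ assert (0 <= 2 * L / (d * d)) by (apply Rdiv_le_0_compat; nra); lra. }
assert (H1 : 1 + INR n * d <= x ^ n).
{ replace x with (1 + d) by (unfold d; ring); clear -Hd.
  induction n as [|n IH]; [simpl; lra|].
  rewrite S_INR; simpl; assert (0 <= INR n) by apply pos_INR; nra. }
(* The exponent [n + n] squares Bernoulli's linear bound, which then outgrows the linear right-hand
   side. *)
specialize (H (n + n)%nat); rewrite pow_add, plus_INR in H.
assert (H2 : 2 * L < INR n * (d * d)).
{ assert (2 * L / (d * d) < INR n) by lra.
  apply Rmult_lt_reg_r with (/ (d * d)); [apply Rinv_0_lt_compat; nra|].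
  replace (INR n * (d * d) * / (d * d)) with (INR n) by (field; lra); lra. }
assert ((1 + INR n * d) * (1 + INR n * d) <= x ^ n * x ^ n)
  by (apply Rmult_le_compat; nra).
nra.
Qed.

(* Applying the crude bound to [p^n] and taking [n]-th roots removes the factor
   coming from the degree. *)
Lemma peval_max_modulus (l : list C) (r M : R) (z0 : C) :
  0 < r -> (forall z, Cmod z = r -> Cmod (peval l z) <= M) -> Cmod z0 <= r ->
  Cmod (peval l z0) <= M.
Proof.
intros Hr HM Hz0.
assert (HM0 : 0 <= M).
{ eapply Rle_trans; [apply Cmod_ge_0|apply (HM (RtoC r))].
  rewrite Cmod_R; apply Rabs_pos_eq; lra. }
assert (Hn : forall n, Cmod (peval l z0) ^ n <=
  (INR n * INR (length l) + 1) * M ^ n).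
{ intros n; rewrite <- Cmod_pow, <- peval_pow.
  replace (INR n * INR (length l) + 1) with (INR (n * length l + 1))
    by (rewrite plus_INR, mult_INR; simpl; ring).
  apply (peval_le_length _ _ r); auto; try lia.
  - apply length_ppow.
  - intros z Hz; rewrite peval_pow, Cmod_pow.
    apply pow_incr; split; [apply Cmod_ge_0|auto]. }
destruct (Req_dec M 0) as [HM1|HM1].
- specialize (Hn 1%nat); rewrite HM1 in *; simpl in Hn; lra.
- assert (HMp : 0 < M) by lra.
  assert (Cmod (peval l z0) / M <= 1).
  { apply pow_le_linear_le1 with (INR (length l)).
    - apply Rdiv_le_0_compat; [apply Cmod_ge_0|lra].
    - apply pos_INR.
    - intros n; unfold Rdiv; rewrite Rpow_mult_distr, pow_inv.
      apply Rmult_le_reg_r with (M ^ n); [now apply pow_lt|].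
      rewrite Rmult_assoc, Rinv_l, Rmult_1_r by (apply pow_nonzero; lra).
      apply Hn. }
  apply Rmult_le_reg_r with (/ M); [now apply Rinv_0_lt_compat|].
  rewrite Rinv_r by lra; assumption.
Qed.

(** * Uniform limits of polynomials *)

(* Holomorphy on the closed disc of radius [r] around [c], replaced by uniform
   approximability by polynomials. *)
Definition approx (c : C) (r : R) (f : C -> C) : Prop :=
  forall eps, 0 < eps -> exists l, forall z, Cmod (z - c) <= r ->
  Cmod (f z - peval l (z - c)) <= eps.

Lemma peval_bounded (l : list C) (r : R) :
  0 <= r -> exists B, 0 <= B /\ forall z, Cmod z <= r -> Cmod (peval l z) <= B.
Proof.
intros Hr; induction l as [|a l [B [HB IH]]].
- exists 0; split; [lra|]; intros z _; simpl; rewrite Cmod_0; lra.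
- exists (Cmod a + r * B); split.
  + assert (H := Cmod_ge_0 a); nra.
  + intros z Hz; simpl; eapply Rle_trans; [apply Cmod_triangle|].
    apply Rplus_le_compat_l; rewrite Cmod_mult.
    apply Rmult_le_compat; auto using Cmod_ge_0.
Qed.

Lemma approx_bounded (c : C) (r : R) (f : C -> C) :
  0 <= r -> approx c r f ->
  exists B, 0 <= B /\ forall z, Cmod (z - c) <= r -> Cmod (f z) <= B.
Proof.
intros Hr Hf; destruct (Hf 1 Rlt_0_1) as [l Hl].
destruct (peval_bounded l r Hr) as [B [HB HBl]].
exists (B + 1); split; [lra|]; intros z Hz.
eapply Rle_trans; [apply (Cmod_triangle_sub _ (peval l (z - c)))|].
apply Rplus_le_compat; auto.
Qed.

Lemma approx_ext (c : C) (r : R) (f g : C -> C) :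
  (forall z, Cmod (z - c) <= r -> f z = g z) -> approx c r f -> approx c r g.
Proof.
intros H Hf eps He; destruct (Hf eps He) as [l Hl]; exists l.
intros z Hz; rewrite <- H by exact Hz; now apply Hl.
Qed.

Lemma approx_peval (c : C) (r : R) (l : list C) :
  approx c r (fun z => peval l (z - c)%C).
Proof.
intros eps He; exists l; intros z _.
unfold Cminus at 1; rewrite Cplus_opp_r, Cmod_0; lra.
Qed.

Lemma approx_const (c : C) (r : R) (a : C) : approx c r (fun _ => a).
Proof.
apply approx_ext with (fun z => peval (a :: nil) (z - c)%C).
- intros z _; simpl; ring.
- apply approx_peval.
Qed.

Lemma approx_id (c : C) (r : R) : approx c r (fun z => z).
Proof.
apply approx_ext with (fun z => peval (c :: RtoC 1 :: nil) (z - c)%C).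
- intros z _; simpl; ring.
- apply approx_peval.
Qed.

Lemma approx_plus (c : C) (r : R) (f g : C -> C) :
  approx c r f -> approx c r g -> approx c r (fun z => f z + g z)%C.
Proof.
intros Hf Hg eps He.
destruct (Hf (eps / 2)) as [l Hl]; [lra|].
destruct (Hg (eps / 2)) as [m Hm]; [lra|].
exists (padd l m); intros z Hz; rewrite peval_add.
replace (f z + g z - (peval l (z - c) + peval m (z - c)))%C with
  ((f z - peval l (z - c)) + (g z - peval m (z - c)))%C by ring.
eapply Rle_trans; [apply Cmod_triangle|].
specialize (Hl z Hz); specialize (Hm z Hz); lra.
Qed.

Lemma approx_mult (c : C) (r : R) (f g : C -> C) :
  0 <= r -> approx c r f -> approx c r g -> approx c r (fun z => f z * g z)%C.
Proof.
intros Hr Hf Hg eps He.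
destruct (approx_bounded _ _ _ Hr Hg) as [B [HB HBg]].
destruct (Hf (eps / (2 * (B + 1)))) as [l Hl].
{ apply Rdiv_lt_0_compat; lra. }
destruct (peval_bounded l r Hr) as [A [HA HAl]].
destruct (Hg (eps / (2 * (A + 1)))) as [m Hm].
{ apply Rdiv_lt_0_compat; lra. }
exists (pmul l m); intros z Hz; rewrite peval_mul.
replace (f z * g z - peval l (z - c) * peval m (z - c))%C with
  ((f z - peval l (z - c)) * g z + peval l (z - c) * (g z - peval m (z - c)))%C
  by ring.
eapply Rle_trans; [apply Cmod_triangle|]; rewrite !Cmod_mult.
assert (H1 : Cmod (f z - peval l (z - c)) * Cmod (g z) <=
  eps / (2 * (B + 1)) * (B + 1)).
{ apply Rmult_le_compat; auto using Cmod_ge_0.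
  specialize (HBg z Hz); lra. }
assert (H2 : Cmod (peval l (z - c)) * Cmod (g z - peval m (z - c)) <=
  (A + 1) * (eps / (2 * (A + 1)))).
{ apply Rmult_le_compat; auto using Cmod_ge_0.
  specialize (HAl _ Hz); lra. }
replace (eps / (2 * (B + 1)) * (B + 1)) with (eps / 2) in H1 by (field; lra).
replace ((A + 1) * (eps / (2 * (A + 1)))) with (eps / 2) in H2 by (field; lra).
lra.
Qed.

Lemma approx_opp (c : C) (r : R) (f : C -> C) :
  0 <= r -> approx c r f -> approx c r (fun z => - f z)%C.
Proof.
intros Hr Hf; apply approx_ext with (fun z => (- (1)) * f z)%C.
- intros z _; ring.
- apply approx_mult; auto using approx_const.
Qed.

Lemma approx_minus (c : C) (r : R) (f g : C -> C) :
  0 <= r -> approx c r f -> approx c r g -> approx c r (fun z => f z - g z)%C.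
Proof.
intros Hr Hf Hg; unfold Cminus; apply approx_plus; auto.
now apply approx_opp.
Qed.

Lemma approx_pow (c : C) (r : R) (f : C -> C) (n : nat) :
  0 <= r -> approx c r f -> approx c r (fun z => f z ^ n)%C.
Proof.
intros Hr Hf; induction n as [|n IH].
- apply (approx_const c r 1).
- apply approx_ext with (fun z => f z * f z ^ n)%C.
  + intros z _; now rewrite Cpow_S.
  + now apply approx_mult.
Qed.

Lemma approx_lim (c : C) (r : R) (f : C -> C) :
  (forall eps, 0 < eps -> exists g, approx c r g /\
    forall z, Cmod (z - c) <= r -> Cmod (f z - g z) <= eps) -> approx c r f.
Proof.
intros H eps He; destruct (H (eps / 2)) as [g [Hg Hfg]]; [lra|].
destruct (Hg (eps / 2)) as [l Hl]; [lra|].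
exists l; intros z Hz.
eapply Rle_trans; [apply (Cmod_sub_triangle _ (g z))|].
specialize (Hfg z Hz); specialize (Hl z Hz); lra.
Qed.

(** Only the outer function is replaced by a polynomial; its value at [g z] is then built from sums
    and products of approximable functions, so no series has to be rearranged. *)
Lemma approx_comp (c c' : C) (r r' : R) (f g : C -> C) :
  0 <= r -> approx c' r' f -> approx c r g ->
  (forall z, Cmod (z - c) <= r -> Cmod (g z - c') <= r') ->
  approx c r (fun z => f (g z)).
Proof.
intros Hr Hf Hg Hin; apply approx_lim; intros eps He.
destruct (Hf eps He) as [l Hl].
exists (fun z => peval l (g z - c')%C); split.
- clear Hl; induction l as [|a l IH]; simpl; [apply approx_const|].
  apply approx_plus; [apply approx_const|].
  apply approx_mult; auto.
  apply approx_minus; auto using approx_const.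
- intros z Hz; apply Hl; auto.
Qed.

(** The quotient by [z] is taken on an approximating polynomial [l], where [(l - l 0) / z] is again
    a polynomial [s] and obeys the maximum principle on the circle of radius [r]; the errors are
    linear in [e] and vanish in the limit. *)
Lemma approx_schwarz (r M : R) (f : C -> C) (z0 : C) :
  0 < r -> approx 0 r f -> f 0%C = 0%C ->
  (forall z, Cmod z <= r -> Cmod (f z) <= M) -> Cmod z0 <= r ->
  Cmod (f z0) <= Cmod z0 / r * M.
Proof.
intros Hr Hf Hf0 HM Hz0; apply le_of_forall_le_mult_eps with 4; [lra|].
intros e He; destruct (Hf e He) as [l Hl].
assert (Hl' : forall z, Cmod z <= r -> Cmod (f z - peval l z) <= e).
{ intros z Hz; specialize (Hl z).
  replace (z - 0)%C with z in Hl by ring; auto. }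
destruct (peval_div l 0) as [s Hs].
assert (Hp0 : Cmod (peval l 0) <= e).
{ specialize (Hl' 0%C ltac:(rewrite Cmod_0; lra)).
  rewrite Hf0 in Hl'.
  replace (0 - peval l 0)%C with (- peval l 0)%C in Hl' by ring.
  now rewrite Cmod_opp in Hl'. }
assert (H1 : Cmod (peval s z0) <= (M + 2 * e) / r).
{ apply (peval_max_modulus s r); auto; intros w Hw.
  assert (H2 : Cmod (peval l w) <= M + e).
  { assert (H2 := Cmod_triangle_sub (peval l w) (f w)).
    rewrite Cmod_sub_sym in H2.
    specialize (HM w ltac:(lra)); specialize (Hl' w ltac:(lra)); lra. }
  apply Rmult_le_reg_l with r; auto.
  replace (r * ((M + 2 * e) / r)) with (M + 2 * e) by (field; lra).
  rewrite <- Hw at 1; rewrite <- Cmod_mult.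
  replace (w * peval s w)%C with (peval l w - peval l 0)%C
    by (rewrite (Hs w); ring).
  eapply Rle_trans; [apply Cmod_triangle|]; rewrite Cmod_opp; lra. }
assert (H2 : Cmod (peval l z0) <= e + Cmod z0 / r * (M + 2 * e)).
{ rewrite (Hs z0); eapply Rle_trans; [apply Cmod_triangle|].
  apply Rplus_le_compat; auto.
  replace (z0 - 0)%C with z0 by ring; rewrite Cmod_mult.
  replace (Cmod z0 / r * (M + 2 * e)) with (Cmod z0 * ((M + 2 * e) / r))
    by (field; lra).
  apply Rmult_le_compat_l; auto using Cmod_ge_0. }
assert (H3 := Cmod_triangle_sub (f z0) (peval l z0)).
specialize (Hl' z0 Hz0).
assert (Cmod z0 / r <= 1).
{ apply Rmult_le_reg_r with r; auto; field_simplify; lra. }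
nra.
Qed.

(** One zero after the other is divided out: each division costs a factor [/ (r - d)] in the bound
    on the circle and contributes at most [rho + d] at [w0]. The zeros hold only up to [e], as they
    are those of a limit and not of the polynomial; hence [K] has to be chosen before [l] and
    [e]. *)
Lemma peval_small_of_zeros (r rho d : R) (n : nat) :
  0 <= d < r -> 0 <= rho <= r -> forall x : nat -> C,
  (forall i, Cmod (x i) <= d) -> (forall i j, i <> j -> x i <> x j) ->
  exists K, 0 <= K /\ forall l M e w0, 0 < e -> 0 <= M ->
  (forall w, Cmod w = r -> Cmod (peval l w) <= M) ->
  (forall i, (i < n)%nat -> Cmod (peval l (x i)) <= e) -> Cmod w0 <= rho ->
  Cmod (peval l w0) <= M * ((rho + d) / (r - d)) ^ n + K * e.
Proof.
intros Hd Hrho; induction n as [|n IH]; intros x Hx Hinj.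
- exists 0; split; [lra|]; intros l M e w0 He HM0 HM _ Hw0; simpl.
  assert (Cmod (peval l w0) <= M)
    by (apply (peval_max_modulus l r); auto; lra).
  lra.
- destruct (IH (fun i => x (S i))) as [K [HK IHK]]; auto.
  (* A common bound for the inverse distances from the remaining points to [x O], by which the
     quotient [s] is estimated at these points. *)
  set (D := fold_right Rplus 0 (map (fun i => / Cmod (x (S i) - x O)) (seq 0 n))).
  assert (Hpos : forall i, 0 < Cmod (x (S i) - x O)).
  { intros i; apply Cmod_gt_0; intros H; apply (Hinj (S i) O); auto.
    replace (x (S i)) with (x (S i) - x O + x O)%C by ring; rewrite H; ring. }
  assert (HDs : forall l : list nat, 0 <= fold_right Rplus 0
    (map (fun i => / Cmod (x (S i) - x O)) l) /\ forall i, In i l ->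
    / Cmod (x (S i) - x O) <= fold_right Rplus 0
    (map (fun i => / Cmod (x (S i) - x O)) l)).
  { induction l as [|a l [H0 H1]]; simpl; split.
    - lra.
    - tauto.
    - assert (H := Rinv_0_lt_compat _ (Hpos a)); lra.
    - assert (H := Rinv_0_lt_compat _ (Hpos a)).
      intros i [->|Hi]; [lra|]; specialize (H1 i Hi); lra. }
  destruct (HDs (seq 0 n)) as [HD0 HD]; fold D in HD0, HD.
  set (k := (rho + d) / (r - d)) in *.
  assert (Hk : 0 <= k) by (apply Rdiv_le_0_compat; lra).
  exists (1 + k * k ^ n + (rho + d) * K * (2 * D + 1)); split.
  { assert (0 <= k ^ n) by now apply pow_le.
    assert (0 <= (rho + d) * K) by (apply Rmult_le_pos; lra).
    nra. }
  intros l M e w0 He HM0 HM Hz Hw0.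
  destruct (peval_div l (x O)) as [s Hs].
  assert (Hl0 := Hz O ltac:(lia)).
  assert (Hb : Cmod (peval s w0) <= (M + e) / (r - d) * k ^ n + K * ((2 * D + 1) * e)).
  { apply IHK; auto.
    - apply Rmult_lt_0_compat; lra.
    - apply Rdiv_le_0_compat; lra.
    - intros w Hw; apply Rmult_le_reg_r with (r - d); [lra|].
      replace ((M + e) / (r - d) * (r - d)) with (M + e) by (field; lra).
      assert (Hrd : r - d <= Cmod (w - x O)).
      { assert (H := Cmod_triangle_sub w (x O)); specialize (Hx O); lra. }
      apply Rle_trans with (Cmod (peval s w) * Cmod (w - x O)).
      { apply Rmult_le_compat_l; auto using Cmod_ge_0. }
      rewrite Rmult_comm, <- Cmod_mult.
      replace ((w - x O) * peval s w)%C with (peval l w - peval l (x O))%C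
        by (rewrite (Hs w); ring).
      eapply Rle_trans; [apply Cmod_triangle|]; rewrite Cmod_opp.
      specialize (HM w Hw); lra.
    - intros i Hi.
      assert (Hzi := Hz (S i) ltac:(lia)).
      assert (H := HD i ltac:(apply in_seq; lia)).
      specialize (Hpos i).
      assert (H2 : Cmod (x (S i) - x O) * Cmod (peval s (x (S i))) <= 2 * e).
      { rewrite <- Cmod_mult.
        replace ((x (S i) - x O) * peval s (x (S i)))%C with
          (peval l (x (S i)) - peval l (x O))%C by (rewrite (Hs (x (S i))); ring).
        eapply Rle_trans; [apply Cmod_triangle|]; rewrite Cmod_opp; lra. }
      replace (Cmod (peval s (x (S i)))) with
        (Cmod (x (S i) - x O) * Cmod (peval s (x (S i))) * / Cmod (x (S i) - x O))
        by (field; lra).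
      assert (0 < / Cmod (x (S i) - x O)) by now apply Rinv_0_lt_compat.
      nra. }
  rewrite (Hs w0); eapply Rle_trans; [apply Cmod_triangle|].
  rewrite Cmod_mult.
  assert (Hw : Cmod (w0 - x O) <= rho + d).
  { eapply Rle_trans; [apply Cmod_triangle|]; rewrite Cmod_opp.
    specialize (Hx O); lra. }
  assert (Hm : Cmod (w0 - x O) * Cmod (peval s w0) <=
    (rho + d) * ((M + e) / (r - d) * k ^ n + K * ((2 * D + 1) * e)))
    by (apply Rmult_le_compat; auto using Cmod_ge_0).
  replace ((rho + d) * ((M + e) / (r - d) * k ^ n + K * ((2 * D + 1) * e)))
    with ((M + e) * (k * k ^ n) + (rho + d) * K * (2 * D + 1) * e) in Hm
    by (unfold k; field; lra).
  simpl pow; nra.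
Qed.

(** Identity theorem. The last hypothesis says that the ratio [k] of [peval_small_of_zeros] is below
    1, so the main term dies as the number [n] of zeros grows. Infinitely many zeros in the small
    disc take the place of an explicit accumulation point. *)
Lemma approx_identity (c : C) (r d : R) (f : C -> C) (x : nat -> C) (z0 : C) :
  0 <= d < r -> approx c r f -> (forall i, Cmod (x i - c) <= d) ->
  (forall i j, i <> j -> x i <> x j) -> (forall i, f (x i) = 0%C) ->
  Cmod (z0 - c) + d < r - d -> f z0 = 0%C.
Proof.
intros Hd Hf Hx Hinj Hfx Hz0; apply Cmod_0_ge.
set (rho := Cmod (z0 - c)) in *.
assert (Hrho : 0 <= rho) by apply Cmod_ge_0.
destruct (approx_bounded c r f ltac:(lra) Hf) as [B [HB HBf]].
set (k := (rho + d) / (r - d)) in *.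
assert (Hk : 0 <= k < 1).
{ unfold k; split; [apply Rdiv_le_0_compat; lra|].
  apply Rmult_lt_reg_r with (r - d); [lra|].
  replace ((rho + d) / (r - d) * (r - d)) with (rho + d) by (field; lra); lra. }
assert (Hn : forall n, Cmod (f z0) <= (B + 1) * k ^ n).
{ intros n.
  destruct (peval_small_of_zeros r rho d n Hd ltac:(lra) (fun i => x i - c)%C)
    as [K [HK Hsm]]; auto.
  { intros i j Hij H; apply (Hinj i j Hij).
    replace (x i) with (x i - c + c)%C by ring; rewrite H; ring. }
  apply le_of_forall_le_mult_eps with (K + 1); [lra|].
  intros e0 He0; set (e := Rmin e0 1).
  assert (He : 0 < e) by (apply Rmin_pos; lra).
  assert (He1 : e <= 1) by apply Rmin_r.
  assert (He2 : e <= e0) by apply Rmin_l.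
  destruct (Hf e He) as [l Hl].
  assert (H1 : Cmod (peval l (z0 - c)) <= (B + 1) * k ^ n + K * e).
  { apply Hsm; auto; try lra.
    - intros w Hw.
      assert (Hw' : ((w + c) - c)%C = w) by ring.
      specialize (HBf (w + c)%C); specialize (Hl (w + c)%C).
      rewrite Hw' in HBf, Hl.
      assert (H2 := Cmod_triangle_sub (peval l w) (f (w + c)%C)).
      rewrite (Cmod_sub_sym (peval l w)) in H2.
      specialize (HBf ltac:(lra)); specialize (Hl ltac:(lra)); lra.
    - intros i _; specialize (Hl (x i)); specialize (Hx i).
      rewrite Hfx in Hl.
      replace (0 - peval l (x i - c))%C with (- peval l (x i - c))%C in Hl by ring.
      rewrite Cmod_opp in Hl; apply Hl; lra.
    - unfold rho; lra. }
  assert (H2 := Cmod_triangle_sub (f z0) (peval l (z0 - c))).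
  specialize (Hl z0 ltac:(fold rho; lra)); nra. }
apply le_of_forall_le_mult_eps with (B + 1); [lra|].
intros e He; rewrite Rplus_0_l.
destruct (pow_lt_1_zero k ltac:(rewrite Rabs_pos_eq; lra) e He) as [N HN].
specialize (HN N (le_n N)); specialize (Hn N).
rewrite Rabs_pos_eq in HN by (apply pow_le; lra).
assert ((B + 1) * k ^ N <= (B + 1) * e) by (apply Rmult_le_compat_l; lra).
lra.
Qed.

(** * Limits with a geometric rate *)

Lemma Cmod_le_abs (z : C) : Cmod z <= Rabs (fst z) + Rabs (snd z).
Proof.
destruct z as [x y]; simpl.
replace (x, y) with (RtoC x + RtoC y * Ci)%C
  by (unfold Cplus, Cmult, RtoC, Ci; simpl; f_equal; ring).
eapply Rle_trans; [apply Cmod_triangle|].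
rewrite Cmod_mult, Cmod_Ci, !Cmod_R; lra.
Qed.

(** A total operator: an infinite limit of a coordinate is read as 0. It gets its meaning from
    [climit_geom], whose explicit rate also supplies the uniformity needed in [approx_climit]. *)
Definition climit (u : nat -> C) : C :=
  (real (Lim_seq (fun n => fst (u n))), real (Lim_seq (fun n => snd (u n)))).

Lemma lim_geom_increments (v : nat -> R) (A rho : R) :
  0 <= rho < 1 -> (forall n, Rabs (v (S n) - v n) <= A * rho ^ n) ->
  is_lim_seq v (real (Lim_seq v)).
Proof.
intros Hr H; apply Lim_seq_correct'.
assert (He : ex_series (fun n => v (S n) - v n)).
{ apply (ex_series_le (V := R_CompleteNormedModule) _ (fun n => A * rho ^ n)).
  - exact H.
  - apply (ex_series_scal (V := R_NormedModule) A (fun n => rho ^ n)), ex_series_geom.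
    rewrite Rabs_pos_eq; lra. }
destruct He as [s Hs]; exists (s + v O).
apply is_lim_seq_incr_1.
apply is_lim_seq_ext with (fun n => sum_n (fun m => v (S m) - v m) n + v O).
- intros n; induction n as [|n IH].
  + rewrite sum_O; ring.
  + rewrite sum_Sn; unfold plus; simpl.
    rewrite <- IH; ring.
- apply is_lim_seq_plus'; [exact Hs|apply is_lim_seq_const].
Qed.

Lemma climit_geom (u : nat -> C) (A rho : R) (n : nat) :
  0 <= rho < 1 -> (forall n, Cmod (u (S n) - u n) <= A * rho ^ n) ->
  Cmod (climit u - u n) <= A * rho ^ n / (1 - rho).
Proof.
intros Hr H.
assert (H1 : is_lim_seq (fun n => fst (u n)) (fst (climit u))).
{ apply (lim_geom_increments _ A rho Hr); intros m.
  eapply Rle_trans; [|apply H]; apply (re_le_Cmod (u (S m) - u m)%C). }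
assert (H2 : is_lim_seq (fun n => snd (u n)) (snd (climit u))).
{ apply (lim_geom_increments _ A rho Hr); intros m.
  eapply Rle_trans; [|apply H].
  eapply Rle_trans; [apply Rmax_r|apply (Rmax_Cmod (u (S m) - u m)%C)]. }
assert (Hk : forall k, Cmod (u (n + k)%nat - u n) <=
  A * rho ^ n * ((1 - rho ^ k) / (1 - rho))).
{ induction k as [|k IH].
  - rewrite Nat.add_0_r; unfold Cminus; rewrite Cplus_opp_r, Cmod_0.
    simpl; apply Req_le; field; lra.
  - rewrite Nat.add_succ_r.
    eapply Rle_trans; [apply (Cmod_sub_triangle _ (u (n + k)%nat))|].
    specialize (H (n + k)%nat); rewrite pow_add in H.
    replace (A * rho ^ n * ((1 - rho ^ S k) / (1 - rho))) with
      (A * (rho ^ n * rho ^ k) + A * rho ^ n * ((1 - rho ^ k) / (1 - rho)))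
      by (simpl; field; lra).
    lra. }
assert (HA : 0 <= A * rho ^ n)
  by (eapply Rle_trans; [apply Cmod_ge_0|apply H]).
assert (Hk' : forall k, Cmod (u (n + k)%nat - u n) <= A * rho ^ n / (1 - rho)).
{ intros k; eapply Rle_trans; [apply Hk|]; unfold Rdiv.
  assert (0 < / (1 - rho)) by (apply Rinv_0_lt_compat; lra).
  assert (0 <= rho ^ k) by (apply pow_le; lra).
  rewrite <- Rmult_assoc; apply Rmult_le_compat_r; [lra|].
  nra. }
apply le_of_forall_le_mult_eps with 2; [lra|].
intros e He.
apply is_lim_seq_spec in H1; apply is_lim_seq_spec in H2.
destruct (H1 (mkposreal e He)) as [N1 HN1].
destruct (H2 (mkposreal e He)) as [N2 HN2]; cbn [pos] in HN1, HN2.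
set (k := (N1 + N2)%nat).
specialize (HN1 (n + k)%nat ltac:(unfold k; lia)).
specialize (HN2 (n + k)%nat ltac:(unfold k; lia)).
eapply Rle_trans; [apply (Cmod_sub_triangle _ (u (n + k)%nat))|].
specialize (Hk' k).
assert (H3 : Cmod (climit u - u (n + k)%nat) <= 2 * e).
{ rewrite Cmod_sub_sym; eapply Rle_trans; [apply Cmod_le_abs|].
  change (Rabs (fst (u (n + k)%nat) - fst (climit u)) +
    Rabs (snd (u (n + k)%nat) - snd (climit u)) <= 2 * e).
  lra. }
lra.
Qed.

Lemma approx_climit (c : C) (r A rho : R) (u : nat -> C -> C) :
  0 <= rho < 1 -> (forall n, approx c r (u n)) ->
  (forall z n, Cmod (z - c) <= r -> Cmod (u (S n) z - u n z) <= A * rho ^ n) ->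
  approx c r (fun z => climit (fun n => u n z)).
Proof.
intros Hr Hu H; apply approx_lim; intros eps He.
assert (Hlim : is_lim_seq (fun n => A / (1 - rho) * rho ^ n) (A / (1 - rho) * 0)).
{ apply is_lim_seq_mult'; [apply is_lim_seq_const|].
  apply is_lim_seq_geom; rewrite Rabs_pos_eq; lra. }
rewrite Rmult_0_r in Hlim.
apply is_lim_seq_spec in Hlim.
destruct (Hlim (mkposreal eps He)) as [N HN]; simpl in HN.
specialize (HN N (le_n N)); exists (u N); split; [apply Hu|].
intros z Hz; eapply Rle_trans.
{ apply (climit_geom (fun n => u n z) A rho N Hr); intros n; now apply H. }
rewrite Rminus_0_r in HN; apply Rle_trans with (A / (1 - rho) * rho ^ N).
- apply Req_le; field; lra.
- apply Rlt_le, (Rle_lt_trans _ _ _ (Rle_abs _) HN).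
Qed.

Lemma approx_geom_inv (c : C) (r rho : R) (g : C -> C) :
  0 <= r -> 0 <= rho < 1 -> approx c r g ->
  (forall z, Cmod (z - c) <= r -> Cmod (g z) <= rho) ->
  approx c r (fun z => / (1 - g z))%C.
Proof.
intros Hr Hrho Hg Hb.
assert (Hne : forall z, Cmod (z - c) <= r -> (1 - g z)%C <> 0%C).
{ intros z Hz H; specialize (Hb z Hz).
  assert (Hg1 : g z = 1%C)
    by (replace (g z) with (1 - (1 - g z))%C by ring; rewrite H; ring).
  rewrite Hg1, Cmod_1 in Hb; lra. }
apply approx_ext with (fun z => climit (fun n => csum (fun k => g z ^ k)%C n)).
- intros z Hz.
  assert (Hc : forall n, Cmod (climit (fun n => csum (fun k => g z ^ k)%C n) -
    / (1 - g z)) <= 2 * rho ^ n / (1 - rho)).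
  { intros n; eapply Rle_trans;
      [apply (Cmod_sub_triangle _ (csum (fun k => g z ^ k)%C n))|].
    assert (H1 : Cmod (climit (fun n => csum (fun k => g z ^ k)%C n) -
      csum (fun k => g z ^ k)%C n) <= 1 * rho ^ n / (1 - rho)).
    { apply (climit_geom (fun n => csum (fun k => g z ^ k)%C n)); auto.
      intros m; cbn [csum].
      match goal with |- Cmod ?e <= _ => replace e with (g z ^ m)%C by ring end.
      rewrite Rmult_1_l, Cmod_pow; apply pow_incr; auto using Cmod_ge_0. }
    assert (H2 : (csum (fun k => g z ^ k) n - / (1 - g z))%C =
      (- (g z ^ n * / (1 - g z)))%C).
    { assert (H := csum_pow_geom (g z) n).
      specialize (Hne z Hz).
      replace (csum (fun k => g z ^ k)%C n) with
        (- ((g z - 1) * csum (fun k => g z ^ k)%C n) / (1 - g z))%C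
        by (field; auto).
      rewrite H; field; auto. }
    rewrite H2, Cmod_opp, Cmod_mult, Cmod_pow, Cmod_inv by auto.
    assert (H3 : 1 - rho <= Cmod (1 - g z)).
    { assert (H := Cmod_triangle_sub 1 (g z)); rewrite Cmod_1 in H.
      specialize (Hb z Hz); lra. }
    assert (H4 : Cmod (g z) ^ n * / Cmod (1 - g z) <= rho ^ n * / (1 - rho)).
    { apply Rmult_le_compat.
      - apply pow_le, Cmod_ge_0.
      - apply Rlt_le, Rinv_0_lt_compat; lra.
      - apply pow_incr; auto using Cmod_ge_0.
      - apply Rinv_le_contravar; lra. }
    unfold Rdiv in *; lra. }
  assert (H0 : (climit (fun n => csum (fun k => g z ^ k)%C n) -
    / (1 - g z))%C = 0%C).
  { apply Cmod_0_ge, le_of_forall_le_mult_eps with (2 / (1 - rho)).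
    { apply Rdiv_le_0_compat; lra. }
    intros e He; rewrite Rplus_0_l.
    destruct (pow_lt_1_zero rho ltac:(rewrite Rabs_pos_eq; lra) e He) as [N HN].
    specialize (HN N (le_n N)).
    rewrite Rabs_pos_eq in HN by (apply pow_le; lra).
    eapply Rle_trans; [apply (Hc N)|].
    replace (2 * rho ^ N / (1 - rho)) with (2 / (1 - rho) * rho ^ N)
      by (field; lra).
    apply Rmult_le_compat_l; [apply Rdiv_le_0_compat; lra|lra]. }
  match goal with |- ?a = ?b => replace a with (a - b + b)%C by ring end.
  rewrite H0; ring.
- apply approx_climit with 1 rho; auto.
  + intros n; induction n as [|n IH]; cbn [csum]; [apply approx_const|].
    apply approx_plus; auto; apply approx_pow; auto.
  + intros z n Hz; cbn [csum].
    match goal with |- Cmod ?e <= _ => replace e with (g z ^ n)%C by ring end.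
    rewrite Rmult_1_l, Cmod_pow; apply pow_incr; auto using Cmod_ge_0.
Qed.

(** * Euler's product *)

Definition cexp (z : C) : C := (RtoC (exp (fst z)) * cis (snd z))%C.

Lemma cexp_plus (z w : C) : cexp (z + w) = (cexp z * cexp w)%C.
Proof.
unfold cexp; simpl fst; simpl snd; rewrite exp_plus, cis_plus, RtoC_mult; ring.
Qed.

Lemma Cmod_cexp (z : C) : Cmod (cexp z) = exp (fst z).
Proof.
unfold cexp; rewrite Cmod_mult, Cmod_cis, Cmod_R, Rabs_pos_eq; [ring|].
apply Rlt_le, exp_pos.
Qed.

Lemma cexp_0 : cexp 0 = 1%C.
Proof.
unfold cexp; simpl; rewrite exp_0; unfold cis; rewrite cos_0, sin_0.
apply Cmult_1_l.
Qed.

Lemma cexp_neq_0 (z : C) : cexp z <> 0%C.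
Proof. apply Cmod_gt_0; rewrite Cmod_cexp; apply exp_pos. Qed.

Lemma cexp_pow (z : C) (n : nat) : (cexp z ^ n)%C = cexp (INR n * z).
Proof.
induction n as [|n IH].
- simpl; rewrite Cmult_0_l, cexp_0; reflexivity.
- rewrite Cpow_S, IH, <- cexp_plus; f_equal; rewrite S_INR, RtoC_plus; ring.
Qed.

Lemma cexp_RtoC (x : R) : cexp (RtoC x) = RtoC (exp x).
Proof.
unfold cexp; simpl; unfold cis; rewrite cos_0, sin_0; apply Cmult_1_r.
Qed.

(** Both sides come from [1 + x <= exp x], applied at [x] and at [- x]; the second gives
    [exp x * (1 - x) <= 1]. *)
Lemma exp_taylor1 (x : R) : Rabs x <= 1 / 2 -> Rabs (exp x - 1 - x) <= 2 * x ^ 2.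
Proof.
intros Hx; apply Rabs_le_between in Hx.
assert (H1 := exp_ineq1_le x); assert (H2 := exp_ineq1_le (- x)).
rewrite exp_Ropp in H2.
assert (H3 : exp x * / exp x = 1) by (apply Rinv_r, Rgt_not_eq, exp_pos).
assert (H4 : exp x * (1 - x) <= 1).
{ rewrite <- H3; apply Rmult_le_compat_l; [apply Rlt_le, exp_pos|lra]. }
apply Rabs_le; split; [nra|].
assert (exp x * (1 - x) <= (1 + x + 2 * x ^ 2) * (1 - x)) by nra.
assert (exp x <= 1 + x + 2 * x ^ 2).
{ apply Rmult_le_reg_r with (1 - x); lra. }
lra.
Qed.

Lemma sin_mvt (y : R) : exists c, Rabs c <= Rabs y /\ sin y = y * cos c.
Proof.
destruct (MVT_gen sin 0 y cos) as [c [Hc H]].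
- intros x _; auto_derive; auto; ring.
- intros x _; apply continuity_pt_filterlim, continuous_sin.
- rewrite sin_0 in H; exists c; split; [|lra].
  unfold Rmin, Rmax in Hc; destruct (Rle_dec 0 y).
  + rewrite !Rabs_pos_eq; lra.
  + rewrite !Rabs_left1; lra.
Qed.

Lemma Rabs_sin_le (y : R) : Rabs (sin y) <= Rabs y.
Proof.
destruct (sin_mvt y) as [c [_ ->]]; rewrite Rabs_mult.
assert (Rabs (cos c) <= 1) by (apply Rabs_le, COS_bound).
assert (0 <= Rabs y) by apply Rabs_pos; nra.
Qed.

Lemma one_minus_cos_le (y : R) : 0 <= 1 - cos y <= y ^ 2 / 2.
Proof.
replace y with (2 * (y / 2)) at 1 2 by field; rewrite cos_2a_sin.
assert (H := Rabs_sin_le (y / 2)).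
apply Rsqr_le_abs_1 in H; unfold Rsqr in H.
assert (0 <= sin (y / 2) * sin (y / 2)) by nra.
lra.
Qed.

Lemma cexp_taylor1 (w : C) :
  Cmod w <= 1 / 2 -> Cmod (cexp w - (1 + w)) <= 10 * Cmod w ^ 2.
Proof.
intros Hw; destruct w as [x y].
assert (H1 := re_le_Cmod (x, y)); unfold Re in H1; simpl in H1.
assert (H2 : Rabs y <= Cmod (x, y)).
{ eapply Rle_trans; [apply Rmax_r|apply (Rmax_Cmod (x, y))]. }
set (m := Cmod (x, y)) in *.
assert (Hx := exp_taylor1 x ltac:(lra)).
assert (Hx2 : x ^ 2 <= m ^ 2) by (apply pow_maj_Rabs; lra).
assert (Hy2 : y ^ 2 <= m ^ 2) by (apply pow_maj_Rabs; lra).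
destruct (one_minus_cos_le y) as [Hc0 Hc].
destruct (sin_mvt y) as [c [Hcy Hs]].
destruct (one_minus_cos_le c) as [Hd0 Hd].
assert (Hc2 : c ^ 2 <= m ^ 2) by (apply pow_maj_Rabs; lra).
eapply Rle_trans; [apply Cmod_le_abs|].
unfold cexp, cis, Cminus, Cplus, Copp, Cmult, RtoC; simpl fst; simpl snd.
assert (Hm : 0 <= m <= 1 / 2) by (split; [apply Cmod_ge_0|exact Hw]).
apply Rabs_le_between in Hx.
apply Rabs_le_between in H1; apply Rabs_le_between in H2.
assert (Hex : 0 <= exp x <= 2) by nra.
assert (Hm3 : m * m ^ 2 <= m ^ 2 / 2) by nra.
apply Rle_trans with (4 * m ^ 2 + 5 * m ^ 2); [|nra].
apply Rplus_le_compat.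
- replace (exp x * cos y - 0 * sin y + - (1 + x)) with
    ((exp x - 1 - x) - exp x * (1 - cos y)) by ring.
  apply Rabs_le; split; nra.
- replace (exp x * sin y + 0 * cos y + - (0 + y)) with
    (y * ((exp x - 1) - exp x * (1 - cos c))) by (rewrite Hs; ring).
  assert (Hin : Rabs ((exp x - 1) - exp x * (1 - cos c)) <= 5 * m).
  { apply Rabs_le; split; nra. }
  rewrite Rabs_mult.
  assert (Rabs y <= m) by (apply Rabs_le; lra).
  replace (5 * m ^ 2) with (m * (5 * m)) by ring.
  apply Rmult_le_compat; auto using Rabs_pos.
Qed.

Lemma Cmod_pow_sub_le (a b : C) (m : R) (n : nat) :
  1 <= m -> Cmod a <= m -> Cmod b <= m ->
  Cmod (a ^ n - b ^ n) <= INR n * Cmod (a - b) * m ^ n.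
Proof.
intros Hm Ha Hb; induction n as [|n IH].
- simpl; unfold Cminus; rewrite Cplus_opp_r, Cmod_0; lra.
- rewrite !Cpow_S.
  replace (a * a ^ n - b * b ^ n)%C with
    (a * (a ^ n - b ^ n) + (a - b) * b ^ n)%C by ring.
  eapply Rle_trans; [apply Cmod_triangle|]; rewrite !Cmod_mult, S_INR.
  assert (H1 : Cmod a * Cmod (a ^ n - b ^ n) <=
    m * (INR n * Cmod (a - b) * m ^ n))
    by (apply Rmult_le_compat; auto using Cmod_ge_0).
  assert (H2 : Cmod (b ^ n) <= m * m ^ n).
  { rewrite Cmod_pow.
    assert (Cmod b ^ n <= m ^ n) by (apply pow_incr; auto using Cmod_ge_0).
    assert (0 <= m ^ n) by (apply pow_le; lra); nra. }
  assert (H3 := Rmult_le_compat_l _ _ _ (Cmod_ge_0 (a - b)) H2).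
  simpl pow; lra.
Qed.

(** Approximation by the polynomials [(1 + z / n) ^ n]. They are compared with [cexp (z / n) ^ n]
    through the bound for a difference of [n]-th powers, with [m = exp (B / n)], so that the factor
    [m ^ n] remains [exp B]. *)
Lemma approx_cexp (c : C) (r : R) : 0 <= r -> approx c r cexp.
Proof.
intros Hr; apply approx_lim; intros eps He.
set (B := Cmod c + r).
assert (HB : 0 <= B) by (assert (H := Cmod_ge_0 c); unfold B; lra).
destruct (INR_unbounded (2 * B + 10 * B ^ 2 * exp B / eps + 1)) as [n Hn].
assert (H0 : 0 <= 10 * B ^ 2 * exp B / eps).
{ assert (H := exp_pos B); apply Rdiv_le_0_compat; nra. }
assert (Hn0 : 0 < INR n) by lra.
assert (HnC : RtoC (INR n) <> 0%C) by (intros H; injection H; lra).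
exists (fun z => (1 + / RtoC (INR n) * z) ^ n)%C; split.
- apply approx_pow; auto; apply approx_plus; [apply approx_const|].
  apply approx_mult; auto using approx_const, approx_id.
- intros z Hz.
  assert (HzB : Cmod z <= B).
  { assert (H := Cmod_triangle_sub z c); unfold B; lra. }
  set (w := (/ RtoC (INR n) * z)%C).
  assert (Hw : Cmod w <= B / INR n).
  { unfold w; rewrite Cmod_mult, Cmod_inv, Cmod_R, Rabs_pos_eq by (auto; lra).
    unfold Rdiv; rewrite Rmult_comm; apply Rmult_le_compat_r; auto.
    apply Rlt_le, Rinv_0_lt_compat; lra. }
  assert (Hw2 : B / INR n <= 1 / 2).
  { apply Rmult_le_reg_r with (INR n); auto; unfold Rdiv at 1.
    rewrite Rmult_assoc, Rinv_l; lra. }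
  replace (cexp z) with (cexp w ^ n)%C
    by (rewrite cexp_pow; f_equal; unfold w; field; auto).
  set (m := exp (B / INR n)).
  assert (HBn : 0 <= B / INR n) by (apply Rdiv_le_0_compat; lra).
  eapply Rle_trans; [apply Cmod_pow_sub_le with (m := m)|].
  + unfold m; assert (H := exp_ineq1_le (B / INR n)); lra.
  + rewrite Cmod_cexp; unfold m.
    assert (H := re_le_Cmod w); apply Rabs_le_between in H; unfold Re in H.
    destruct (Req_dec (fst w) (B / INR n)) as [->|]; [lra|].
    apply Rlt_le, exp_increasing; lra.
  + eapply Rle_trans; [apply Cmod_triangle|]; rewrite Cmod_1.
    unfold m; assert (H := exp_ineq1_le (B / INR n)); lra.
  + assert (H1 : Cmod (cexp w - (1 + w)) <= 10 * (B / INR n) ^ 2).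
    { eapply Rle_trans; [apply cexp_taylor1; lra|].
      apply Rmult_le_compat_l; [lra|]; apply pow_incr.
      split; [apply Cmod_ge_0|lra]. }
    replace (m ^ n) with (exp B).
    2:{ assert (HE : forall k, m ^ k = exp (INR k * (B / INR n))).
        { induction k as [|k IH]; [simpl; now rewrite Rmult_0_l, exp_0|].
          simpl pow; rewrite IH; unfold m; rewrite <- exp_plus; f_equal.
          rewrite S_INR; ring. }
        rewrite HE; f_equal; field; lra. }
    apply Rle_trans with (INR n * (10 * (B / INR n) ^ 2) * exp B).
    * apply Rmult_le_compat_r; [apply Rlt_le, exp_pos|].
      apply Rmult_le_compat_l; lra.
    * apply Rmult_le_reg_r with (INR n); auto.
      replace (INR n * (10 * (B / INR n) ^ 2) * exp B * INR n) with
        (10 * B ^ 2 * exp B / eps * eps) by (field; lra).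
      rewrite Rmult_comm; apply Rmult_le_compat_l; lra.
Qed.

Definition geom_lim (u : nat -> C) (l : C) : Prop :=
  exists A rho, 0 <= rho < 1 /\ forall n, Cmod (l - u n) <= A * rho ^ n.

Lemma geom_lim_unique (u : nat -> C) (l m : C) :
  geom_lim u l -> geom_lim u m -> l = m.
Proof.
intros [A [rho [Hr H1]]] [B [sig [Hs H2]]].
assert (H : (l - m)%C = 0%C).
{ apply Cmod_0_ge.
  assert (HA : 0 <= A).
  { specialize (H1 O); simpl in H1; assert (H := Cmod_ge_0 (l - u O)); lra. }
  assert (HB : 0 <= B).
  { specialize (H2 O); simpl in H2; assert (H := Cmod_ge_0 (m - u O)); lra. }
  apply le_of_forall_le_mult_eps with (A + B); [lra|].
  intros e He.
  destruct (pow_lt_1_zero rho ltac:(rewrite Rabs_pos_eq; lra) e He) as [N HN].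
  destruct (pow_lt_1_zero sig ltac:(rewrite Rabs_pos_eq; lra) e He) as [M HM].
  set (k := (N + M)%nat).
  specialize (HN k ltac:(unfold k; lia)); specialize (HM k ltac:(unfold k; lia)).
  rewrite Rabs_pos_eq in HN, HM by (apply pow_le; lra).
  specialize (H1 k); specialize (H2 k).
  eapply Rle_trans; [apply (Cmod_sub_triangle _ (u k))|].
  rewrite (Cmod_sub_sym (u k)); nra. }
replace l with (l - m + m)%C by ring; rewrite H; ring.
Qed.

Lemma geom_lim_climit (u : nat -> C) (A rho : R) :
  0 <= rho < 1 -> (forall n, Cmod (u (S n) - u n) <= A * rho ^ n) ->
  geom_lim u (climit u).
Proof.
intros Hr H; exists (A / (1 - rho)), rho; split; auto.
intros n; replace (A / (1 - rho) * rho ^ n) with (A * rho ^ n / (1 - rho))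
  by (field; lra).
now apply climit_geom.
Qed.

Lemma geom_lim_affine (u : nat -> C) (l a b : C) :
  geom_lim u l -> geom_lim (fun n => a + b * u n)%C (a + b * l)%C.
Proof.
intros [A [rho [Hr H]]]; exists (Cmod b * A), rho; split; auto.
intros n; replace (a + b * l - (a + b * u n))%C with (b * (l - u n))%C by ring.
rewrite Cmod_mult, Rmult_assoc; apply Rmult_le_compat_l; auto using Cmod_ge_0.
Qed.

Lemma geom_lim_S (u : nat -> C) (l : C) :
  geom_lim u l -> geom_lim (fun n => u (S n)) l.
Proof.
intros [A [rho [Hr H]]]; exists (A * rho), rho; split; auto.
intros n; specialize (H (S n)); simpl in H; lra.
Qed.

Lemma geom_lim_ext (u v : nat -> C) (l : C) :
  (forall n, u n = v n) -> geom_lim u l -> geom_lim v l.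
Proof.
intros Huv [A [rho [Hr H]]]; exists A, rho; split; auto.
intros n; rewrite <- Huv; apply H.
Qed.

Lemma climit_RtoC (v : nat -> R) :
  climit (fun n => RtoC (v n)) = RtoC (real (Lim_seq v)).
Proof.
unfold climit, RtoC; simpl; now rewrite Lim_seq_const.
Qed.

Lemma climit_ext (u v : nat -> C) : (forall n, u n = v n) -> climit u = climit v.
Proof.
intros H; unfold climit; f_equal; f_equal; apply Lim_seq_ext; intros n;
  now rewrite H.
Qed.

(** This is [(q;q)_n], and [phi] is Euler's function; eta is [q^(1/24)] times [phi q]. *)
Fixpoint qpoch (q : C) (n : nat) : C :=
  match n with O => 1%C | S m => (qpoch q m * (1 - q ^ S m))%C end.

Definition phi (q : C) : C := climit (qpoch q).

Lemma exp_le (x y : R) : x <= y -> exp x <= exp y.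
Proof.
intros [H | ->]; [apply Rlt_le; now apply exp_increasing|apply Rle_refl].
Qed.

Lemma Cmod_qpoch_le (q : C) (r : R) (n : nat) :
  0 <= r < 1 -> Cmod q <= r -> Cmod (qpoch q n) <= exp (1 / (1 - r)).
Proof.
intros Hr Hq.
apply Rle_trans with (exp ((1 - r ^ n) / (1 - r))).
- induction n as [|n IH].
  + simpl; rewrite Cmod_1; replace ((1 - 1) / (1 - r)) with 0 by (field; lra).
    rewrite exp_0; lra.
  + cbn [qpoch]; rewrite Cmod_mult.
    replace ((1 - r ^ S n) / (1 - r)) with ((1 - r ^ n) / (1 - r) + r ^ n)
      by (simpl; field; lra).
    rewrite exp_plus; apply Rmult_le_compat; auto using Cmod_ge_0.
    eapply Rle_trans; [apply Cmod_triangle|].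
    rewrite Cmod_opp, Cmod_1, Cmod_pow.
    assert (Cmod q ^ S n <= r ^ S n) by (apply pow_incr; auto using Cmod_ge_0).
    assert (0 <= r ^ n) by (apply pow_le; lra).
    assert (Hexp := exp_ineq1_le (r ^ n)); simpl in *; nra.
- apply exp_le; unfold Rdiv; apply Rmult_le_compat_r.
  + apply Rlt_le, Rinv_0_lt_compat; lra.
  + assert (0 <= r ^ n) by (apply pow_le; lra); lra.
Qed.

(** From [1 - x >= exp (- x / (1 - x))] at [x = r ^ (n + 1)] together with [1 - x >= 1 - r]; the
    exponents add up to a geometric series. A lower bound independent of [n] is what makes [/ phi]
    approximable. *)
Lemma Cmod_qpoch_ge (q : C) (r : R) (n : nat) :
  0 <= r < 1 -> Cmod q <= r -> exp (- (1 / (1 - r) ^ 2)) <= Cmod (qpoch q n).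
Proof.
intros Hr Hq.
apply Rle_trans with (exp (- ((1 - r ^ n) / (1 - r) ^ 2))).
- apply exp_le, Ropp_le_contravar; unfold Rdiv; apply Rmult_le_compat_r.
  + apply Rlt_le, Rinv_0_lt_compat, pow_lt; lra.
  + assert (0 <= r ^ n) by (apply pow_le; lra); lra.
- induction n as [|n IH].
  + replace (- ((1 - r ^ 0) / (1 - r) ^ 2)) with 0 by (simpl; field; lra).
    rewrite exp_0; cbn [qpoch]; rewrite Cmod_1; lra.
  + cbn [qpoch]; rewrite Cmod_mult.
    replace (- ((1 - r ^ S n) / (1 - r) ^ 2)) with
      (- ((1 - r ^ n) / (1 - r) ^ 2) + - (r ^ n / (1 - r)))
      by (simpl; field; lra).
    rewrite exp_plus; apply Rmult_le_compat; auto using Rlt_le, exp_pos.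
    assert (Hrn : 0 <= r ^ n) by (apply pow_le; lra).
    assert (Hrn1 : r ^ n <= 1) by (rewrite <- (pow1 n); apply pow_incr; lra).
    assert (H1 : 1 - r ^ S n <= Cmod (1 - q ^ S n)).
    { assert (H := Cmod_triangle_sub 1 (q ^ S n)).
      rewrite Cmod_1, Cmod_pow in H.
      assert (Cmod q ^ S n <= r ^ S n) by (apply pow_incr; auto using Cmod_ge_0).
      lra. }
    eapply Rle_trans; [|exact H1].
    set (x := r ^ S n) in *.
    assert (Hx : 0 <= x <= r) by (unfold x; simpl; split; nra).
    apply Rle_trans with (exp (- (x / (1 - x)))).
    * apply exp_le, Ropp_le_contravar; unfold Rdiv.
      apply Rmult_le_compat; try lra.
      -- apply Rlt_le, Rinv_0_lt_compat; lra.
      -- unfold x; simpl; nra.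
      -- apply Rinv_le_contravar; lra.
    * assert (H := exp_ineq1_le (x / (1 - x))).
      rewrite exp_Ropp; replace (1 - x) with (/ (1 + x / (1 - x))) at 2
        by (field; lra).
      apply Rinv_le_contravar; auto.
      assert (0 <= x / (1 - x)) by (apply Rdiv_le_0_compat; lra); lra.
Qed.

Lemma qpoch_increment (q : C) (r : R) (n : nat) :
  0 <= r < 1 -> Cmod q <= r ->
  Cmod (qpoch q (S n) - qpoch q n) <= exp (1 / (1 - r)) * r ^ n.
Proof.
intros Hr Hq; cbn [qpoch].
replace (qpoch q n * (1 - q ^ S n) - qpoch q n)%C with
  (- (qpoch q n * q ^ S n))%C by ring.
rewrite Cmod_opp, Cmod_mult, Cmod_pow.
apply Rmult_le_compat; auto using Cmod_ge_0, Cmod_qpoch_le.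
- apply pow_le, Cmod_ge_0.
- simpl.
  assert (Cmod q ^ n <= r ^ n) by (apply pow_incr; auto using Cmod_ge_0).
  assert (0 <= Cmod q ^ n) by apply pow_le, Cmod_ge_0.
  assert (0 <= Cmod q) by apply Cmod_ge_0.
  nra.
Qed.

Lemma geom_lim_phi (q : C) : Cmod q < 1 -> geom_lim (qpoch q) (phi q).
Proof.
intros Hq; apply geom_lim_climit with (exp (1 / (1 - Cmod q))) (Cmod q).
- split; [apply Cmod_ge_0|auto].
- intros n; apply qpoch_increment; [split; [apply Cmod_ge_0|auto]|lra].
Qed.

Lemma approx_qpoch (r : R) (n : nat) :
  0 <= r -> approx 0 r (fun q => qpoch q n).
Proof.
intros Hr; induction n as [|n IH]; cbn [qpoch]; [apply approx_const|].
apply approx_mult; auto; apply approx_minus; auto using approx_const.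
apply approx_pow; auto using approx_id.
Qed.

Lemma Cminus_0_r (z : C) : (z - 0)%C = z.
Proof. ring. Qed.

Lemma approx_phi (r : R) : 0 <= r < 1 -> approx 0 r phi.
Proof.
intros Hr; apply (approx_climit 0 r (exp (1 / (1 - r))) r (fun n q => qpoch q n)).
- exact Hr.
- intros n; apply approx_qpoch; lra.
- intros q n Hq; rewrite Cminus_0_r in Hq; now apply qpoch_increment.
Qed.

Lemma Cmod_geom_lim_ge (u : nat -> C) (l : C) (m : R) :
  geom_lim u l -> (forall n, m <= Cmod (u n)) -> m <= Cmod l.
Proof.
intros [A [rho [Hr H]]] Hm.
assert (HA : 0 <= A).
{ specialize (H O); simpl in H; assert (H' := Cmod_ge_0 (l - u O)); lra. }
apply le_of_forall_le_mult_eps with A; auto; intros e He.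
destruct (pow_lt_1_zero rho ltac:(rewrite Rabs_pos_eq; lra) e He) as [N HN].
specialize (HN N (le_n N)); rewrite Rabs_pos_eq in HN by (apply pow_le; lra).
assert (H1 := Cmod_triangle_sub (u N) l); rewrite Cmod_sub_sym in H1.
specialize (H N); specialize (Hm N); nra.
Qed.

Lemma Cmod_phi_ge (q : C) (r : R) :
  0 <= r < 1 -> Cmod q <= r -> exp (- (1 / (1 - r) ^ 2)) <= Cmod (phi q).
Proof.
intros Hr Hq; apply Cmod_geom_lim_ge with (qpoch q).
- apply geom_lim_phi; lra.
- intros n; now apply Cmod_qpoch_ge.
Qed.

Lemma phi_neq_0 (q : C) : Cmod q < 1 -> phi q <> 0%C.
Proof.
intros Hq; apply Cmod_gt_0.
eapply Rlt_le_trans; [apply exp_pos|apply (Cmod_phi_ge q (Cmod q))].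
- split; [apply Cmod_ge_0|auto].
- lra.
Qed.

Lemma approx_qpoch_inv (r : R) (n : nat) :
  0 <= r < 1 -> approx 0 r (fun q => / qpoch q n)%C.
Proof.
intros Hr; induction n as [|n IH].
- exact (approx_const 0 r (/ 1)%C).
- apply approx_ext with (fun q => / qpoch q n * / (1 - q ^ S n))%C.
  + intros q Hq; rewrite Cminus_0_r in Hq; cbn [qpoch].
    assert (H1 : qpoch q (S n) <> 0%C).
    { apply Cmod_gt_0; eapply Rlt_le_trans;
        [apply exp_pos|apply (Cmod_qpoch_ge q r (S n)); auto]. }
    cbn [qpoch] in H1; field; split; intros H; apply H1; rewrite H; ring.
  + apply approx_mult; auto; [lra|].
    apply approx_geom_inv with r; auto; [lra| |].
    * apply approx_pow; [lra|apply approx_id].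
    * intros q Hq; rewrite Cminus_0_r in Hq; rewrite Cmod_pow; simpl.
      assert (H : Cmod q ^ n <= 1 ^ n)
        by (apply pow_incr; split; [apply Cmod_ge_0|lra]).
      rewrite pow1 in H.
      assert (0 <= Cmod q) by apply Cmod_ge_0.
      assert (0 <= Cmod q ^ n) by apply pow_le, Cmod_ge_0.
      nra.
Qed.

Lemma approx_phi_inv (r : R) : 0 <= r < 1 -> approx 0 r (fun q => / phi q)%C.
Proof.
intros Hr; apply approx_lim; intros eps He.
set (B := exp (1 / (1 - r))); set (m := exp (- (1 / (1 - r) ^ 2))).
assert (Hm : 0 < m) by apply exp_pos.
assert (HB : 0 < B) by apply exp_pos.
assert (He' : 0 < eps * (m * m) * (1 - r) / B).
{ apply Rdiv_lt_0_compat; auto; repeat apply Rmult_lt_0_compat; lra. }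
destruct (pow_lt_1_zero r ltac:(rewrite Rabs_pos_eq; lra) _ He') as [N HN].
specialize (HN N (le_n N)); rewrite Rabs_pos_eq in HN by (apply pow_le; lra).
exists (fun q => / qpoch q N)%C; split; [now apply approx_qpoch_inv|].
intros q Hq; rewrite Cminus_0_r in Hq.
assert (H1 := Cmod_phi_ge q r Hr Hq); fold m in H1.
assert (H2 := Cmod_qpoch_ge q r N Hr Hq); fold m in H2.
assert (H3 : Cmod (phi q - qpoch q N) <= B * r ^ N / (1 - r)).
{ apply (climit_geom (qpoch q)); auto; intros n; now apply qpoch_increment. }
assert (Hp : phi q <> 0%C) by (apply Cmod_gt_0; lra).
assert (Hq' : qpoch q N <> 0%C) by (apply Cmod_gt_0; lra).
replace (/ phi q - / qpoch q N)%C with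
  (- ((phi q - qpoch q N) / (phi q * qpoch q N)))%C by (field; auto).
rewrite Cmod_opp, Cmod_div, Cmod_mult by (apply Cmult_neq_0; auto).
apply Rmult_le_reg_r with (Cmod (phi q) * Cmod (qpoch q N)); [nra|].
unfold Rdiv; rewrite Rmult_assoc, Rinv_l, Rmult_1_r by nra.
apply Rle_trans with (eps * (m * m)).
- eapply Rle_trans; [exact H3|].
  apply Rmult_le_reg_r with ((1 - r) / B);
    [apply Rdiv_lt_0_compat; lra|].
  replace (B * r ^ N / (1 - r) * ((1 - r) / B)) with (r ^ N) by (field; lra).
  unfold Rdiv in *; lra.
- apply Rmult_le_compat_l; [lra|]; apply Rmult_le_compat; lra.
Qed.

(** The second-order remainder of [phi] at 0, summed from the telescoping identity [(q;q)_(n+1) -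
    (q;q)_n = - q^(n+1) (q;q)_n]. Having it as a uniform limit of polynomials allows powers of [q]
    to be divided out of modular forms later. *)
Definition phi_tail (q : C) : C :=
  climit (fun n => - csum (fun k => q ^ k * qpoch q (S k)) n)%C.

Lemma phi_tail_increment (q : C) (r : R) (n : nat) :
  0 <= r < 1 -> Cmod q <= r ->
  Cmod (- csum (fun k => q ^ k * qpoch q (S k)) (S n) -
    - csum (fun k => q ^ k * qpoch q (S k)) n)%C <= exp (1 / (1 - r)) * r ^ n.
Proof.
intros Hr Hq; cbn [csum].
match goal with |- Cmod ?e <= _ =>
  replace e with (- (q ^ n * qpoch q (S n)))%C by ring end.
rewrite Cmod_opp, Cmod_mult, Cmod_pow, Rmult_comm.
apply Rmult_le_compat; auto using Cmod_ge_0, Cmod_qpoch_le.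
- apply pow_le, Cmod_ge_0.
- apply pow_incr; auto using Cmod_ge_0.
Qed.

Lemma approx_phi_tail (r : R) : 0 <= r < 1 -> approx 0 r phi_tail.
Proof.
intros Hr; apply (approx_climit 0 r (exp (1 / (1 - r))) r
  (fun n q => - csum (fun k => q ^ k * qpoch q (S k)) n)%C); auto.
- intros n; apply approx_opp; [lra|].
  induction n as [|n IH]; cbn [csum]; [apply approx_const|].
  apply approx_plus; auto; apply approx_mult; [lra| |apply approx_qpoch; lra].
  apply approx_pow; [lra|apply approx_id].
- intros q n Hq; rewrite Cminus_0_r in Hq; now apply phi_tail_increment.
Qed.

Lemma phi_expand (q : C) :
  Cmod q < 1 -> phi q = (1 - q + q ^ 2 * phi_tail q)%C.
Proof.
intros Hq; apply geom_lim_unique with (fun n => qpoch q (S n)).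
- apply geom_lim_S, geom_lim_phi, Hq.
- apply geom_lim_ext with (fun n => (1 - q) + q ^ 2 *
    (- csum (fun k => q ^ k * qpoch q (S k)) n))%C.
  + intros n; induction n as [|n IH]; [simpl; ring|].
    cbn [csum]; change (qpoch q (S (S n))) with
      (qpoch q (S n) * (1 - q ^ S (S n)))%C.
    rewrite !Cpow_S in *.
    replace ((1 - q + (q * (q * q ^ 0)) * - (csum (fun k =>
      q ^ k * qpoch q (S k)) n + q ^ n * qpoch q (S n)))%C) with
      ((1 - q + (q * (q * q ^ 0)) * - csum (fun k => q ^ k * qpoch q (S k)) n)
       - q * (q * q ^ 0) * (q ^ n * qpoch q (S n)))%C by ring.
    rewrite IH; simpl; ring.
  + apply geom_lim_affine, geom_lim_climit with
      (exp (1 / (1 - Cmod q))) (Cmod q).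
    * split; [apply Cmod_ge_0|auto].
    * intros n; apply phi_tail_increment; [split; [apply Cmod_ge_0|auto]|lra].
Qed.

(** * Schwarz's lemma on the upper half-plane *)

(** With [z = - i tau] the upper half-plane becomes the right half-plane, [-1/tau] becomes [1/z],
    and the imaginary axis becomes the positive reals, where the identities are first proved. *)
Definition nome (z : C) : C := cexp (RtoC (-2 * PI) * z).

Lemma Cmod_nome (z : C) : Cmod (nome z) = exp (-2 * PI * fst z).
Proof. unfold nome; rewrite Cmod_cexp; simpl; f_equal; ring. Qed.

Lemma Cmod_nome_lt (z : C) (x : R) :
  x <= fst z -> Cmod (nome z) <= exp (-2 * PI * x).
Proof.
intros H; rewrite Cmod_nome; apply exp_le; assert (Hp := PI_RGT_0); nra.
Qed.

Lemma exp_neg_lt_1 (x : R) : 0 < x -> 0 < exp (-2 * PI * x) < 1.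
Proof.
intros H; split; [apply exp_pos|]; rewrite <- exp_0; apply exp_increasing.
assert (Hp := PI_RGT_0); nra.
Qed.

Lemma fst_ge_disc (X r : R) (z : C) : Cmod (z - RtoC X) <= r -> X - r <= fst z.
Proof.
intros H; assert (H1 := re_le_Cmod (z - RtoC X)); unfold Re in H1; simpl in H1.
apply Rabs_le_between in H1; lra.
Qed.

Lemma disc_neq_0 (X r : R) (z : C) :
  r < X -> Cmod (z - RtoC X) <= r -> z <> 0%C.
Proof.
intros Hr Hz H; assert (H1 := fst_ge_disc X r z Hz); rewrite H in H1.
simpl in H1; lra.
Qed.

Lemma approx_Cinv (X r : R) : 0 < r < X -> approx (RtoC X) r (fun z => / z)%C.
Proof.
intros Hr.
assert (HX : RtoC X <> 0%C) by (intros H; injection H; lra).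
apply approx_ext with (fun z => / X * / (1 - (1 - / X * z)))%C.
- intros z Hz; field; split; auto.
  apply (disc_neq_0 X r); auto; lra.
- apply approx_mult; [lra|apply approx_const|].
  apply approx_geom_inv with (r / X); [lra| | |].
  + split; [apply Rdiv_le_0_compat; lra|].
    apply Rmult_lt_reg_r with X; [lra|].
    unfold Rdiv; rewrite Rmult_assoc, Rinv_l; lra.
  + apply approx_minus; [lra|apply approx_const|].
    apply approx_mult; [lra|apply approx_const|apply approx_id].
  + intros z Hz; replace (1 - / X * z)%C with (- ((z - X) / X))%C
      by (field; auto).
    rewrite Cmod_opp, Cmod_div, Cmod_R, (Rabs_pos_eq X) by (auto; lra).
    unfold Rdiv; apply Rmult_le_compat_r; auto.
    apply Rlt_le, Rinv_0_lt_compat; lra.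
Qed.

Lemma approx_nome (X r : R) : 0 < r < X -> approx (RtoC X) r nome.
Proof.
intros Hr; unfold nome.
destruct (approx_bounded (RtoC X) r (fun z => RtoC (-2 * PI) * z)%C)
  as [B [HB HBz]]; [lra| |].
- apply approx_mult; [lra|apply approx_const|apply approx_id].
- apply (approx_comp _ 0 r B cexp (fun z => RtoC (-2 * PI) * z)%C); [lra| | |].
  + apply approx_cexp; lra.
  + apply approx_mult; [lra|apply approx_const|apply approx_id].
  + intros z Hz; rewrite Cminus_0_r; auto.
Qed.

Lemma approx_comp_nome (F : C -> C) (X r : R) :
  (forall s, 0 <= s < 1 -> approx 0 s F) -> 0 < r < X ->
  approx (RtoC X) r (fun z => F (nome z)).
Proof.
intros HF Hr.
assert (He := exp_neg_lt_1 (X - r) ltac:(lra)).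
apply (approx_comp _ 0 r (exp (-2 * PI * (X - r))) F nome); [lra| | |].
- apply HF; lra.
- now apply approx_nome.
- intros z Hz; rewrite Cminus_0_r; apply Cmod_nome_lt.
  now apply fst_ge_disc.
Qed.

(* [1/z] is again at positive distance from the imaginary axis, so a disc with
   real centre [Y] and radius [s < Y] contains the image. *)
Lemma Cinv_disc (X r : R) :
  0 < r < X -> exists Y s, 0 < s < Y /\ forall z,
  Cmod (z - RtoC X) <= r -> Cmod (/ z - RtoC Y) <= s.
Proof.
intros Hr; set (D := X ^ 2 - r ^ 2).
assert (HD : 0 < D) by (unfold D; nra).
(* Inversion sends the circle with diameter from [X - r] to [X + r] to the one with diameter from
   [/ (X + r)] to [/ (X - r)], which has this centre and radius. *)
exists (X / D), (r / D); split.
{ split; [apply Rdiv_lt_0_compat; lra|].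
  apply Rmult_lt_compat_r; [apply Rinv_0_lt_compat; lra|lra]. }
intros z Hz.
assert (Hz0 : z <> 0%C) by (apply (disc_neq_0 X r); auto; lra).
assert (HDC : RtoC D <> 0%C) by (intros H; injection H; lra).
replace (/ z - RtoC (X / D))%C with ((D - X * z) / (D * z))%C
  by (rewrite RtoC_div by lra; field; auto).
assert (Hzp := proj1 (Cmod_gt_0 z) Hz0).
rewrite Cmod_div, Cmod_mult, Cmod_R, (Rabs_pos_eq D)
  by (try apply Cmult_neq_0; auto; lra).
apply Rmult_le_reg_r with (D * Cmod z); [nra|].
unfold Rdiv at 1; rewrite Rmult_assoc, Rinv_l, Rmult_1_r by nra.
replace (r / D * (D * Cmod z)) with (r * Cmod z) by (field; lra).
apply Rsqr_incr_0_var; [|nra].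
rewrite Rsqr_mult, !Rsqr_pow2, !Cmod2_alt.
assert (Hz2 : Cmod (z - RtoC X) ^ 2 <= r ^ 2)
  by (apply pow_incr; split; [apply Cmod_ge_0|auto]).
rewrite Cmod2_alt in Hz2.
destruct z as [x y]; unfold Re, Im in *; simpl in *.
unfold D in *; nra.
Qed.

(** Transfer from the positive real axis to the half-plane, by the identity theorem in a disc around
    a real point far enough to the right. *)
Lemma right_half_identity (f : C -> C) :
  (forall X r, 0 < r < X -> approx (RtoC X) r f) ->
  (forall x, 0 < x -> f (RtoC x) = 0%C) ->
  forall z, 0 < fst z -> f z = 0%C.
Proof.
intros Hf H0 z Hz.
(* With [X * fst z = |z|^2 + 1] one gets [|z - X|^2 = X^2 - |z|^2 - 2], so [z] lies inside the
   circle around [X] that touches the imaginary axis. *)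
set (X := (Cmod z ^ 2 + 1) / fst z).
assert (HX : 0 < X).
{ apply Rdiv_lt_0_compat; auto; assert (H := Cmod_ge_0 z); nra. }
set (rho := Cmod (z - RtoC X)).
assert (Hrho0 : 0 <= rho) by apply Cmod_ge_0.
assert (Hrho : rho < X).
{ apply Rsqr_incrst_0; try lra; rewrite !Rsqr_pow2; unfold rho.
  rewrite Cmod2_alt.
  assert (HXz : X * fst z = Cmod z ^ 2 + 1) by (unfold X; field; lra).
  rewrite Cmod2_alt in HXz; clearbody X; clear rho Hrho0.
  destruct z as [x y]; unfold Re, Im in *; simpl in *.
  match goal with |- ?l < ?r => replace l with
    (x * (x * 1) + y * (y * 1) - 2 * (X * x) + X * (X * 1)) by ring end.
  rewrite HXz; assert (0 <= x * x) by nra; nra. }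
(* A quarter of the margin: the disc has radius [X - d], the zeros lie within [d] of [X], and
   [rho + d < X - 2 * d]. *)
set (d := (X - rho) / 4).
assert (Hd : 0 < d) by (unfold d; lra).
assert (Hi : forall i, 0 < / INR (S i) <= 1).
{ intros i; split; [apply Rinv_0_lt_compat, lt_0_INR; lia|].
  rewrite <- Rinv_1; apply Rinv_le_contravar; [lra|].
  rewrite S_INR; assert (H := pos_INR i); lra. }
apply (approx_identity (RtoC X) (X - d) d f (fun i => RtoC (X + d * / INR (S i)))).
- unfold d in *; lra.
- apply Hf; unfold d in *; lra.
- intros i; rewrite <- RtoC_minus, Cmod_R.
  specialize (Hi i); revert Hi; generalize (/ INR (S i)); intros h Hi.
  replace (X + d * h - X) with (d * h) by ring.
  rewrite Rabs_pos_eq; nra.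
- intros i j Hij H; apply RtoC_inj in H; apply Hij.
  assert (H2 : / INR (S i) = / INR (S j)).
  { apply Rmult_eq_reg_l with d; lra. }
  apply Rinv_eq_reg in H2; apply INR_eq in H2; lia.
- intros i; apply H0; specialize (Hi i); revert Hi.
  generalize (/ INR (S i)); intros h Hi; nra.
- fold rho; unfold d in *; lra.
Qed.

Lemma polar (z : C) : exists x, z = (RtoC (Cmod z) * cis x)%C.
Proof.
destruct (Ceq_dec z 0) as [->|Hz].
{ exists 0; rewrite Cmod_0; ring. }
apply Cmod_gt_0 in Hz; set (m := Cmod z) in *.
assert (Hm : fst z ^ 2 + snd z ^ 2 = m ^ 2).
{ unfold m; rewrite Cmod2_alt; reflexivity. }
set (x := fst z / m); set (y := snd z / m).
assert (Hxy : x ^ 2 + y ^ 2 = 1).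
{ transitivity ((fst z ^ 2 + snd z ^ 2) / m ^ 2).
  - unfold x, y; field; lra.
  - rewrite Hm; field; lra. }
assert (Hx : -1 <= x <= 1) by nra.
assert (Hs : sin (acos x) = Rabs y).
{ rewrite sin_acos by auto; rewrite <- sqrt_Rsqr_abs; f_equal.
  unfold Rsqr; nra. }
assert (Hzm : z = (RtoC m * (x, y))%C).
{ destruct z as [u v]; unfold x, y, RtoC, Cmult; simpl; f_equal; field; lra. }
destruct (Rle_dec 0 y) as [Hy|Hy].
- exists (acos x); rewrite Hzm at 1; unfold cis.
  now rewrite cos_acos, Hs, Rabs_pos_eq.
- exists (- acos x); rewrite Hzm at 1; unfold cis.
  rewrite cos_neg, sin_neg, cos_acos, Hs, Rabs_left1 by lra.
  now rewrite Ropp_involutive.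
Qed.

(* [qq tau] is the usual [exp (2 pi i tau)]. *)
Definition qq (t : C) : C := nome (- (Ci * t)).

Lemma Cmod_qq (t : C) : Cmod (qq t) = exp (-2 * PI * snd t).
Proof. unfold qq; rewrite Cmod_nome; simpl; f_equal; ring. Qed.

Lemma Cmod_qq_lt_1 (t : C) : 0 < snd t -> Cmod (qq t) < 1.
Proof. intros H; rewrite Cmod_qq; apply exp_neg_lt_1, H. Qed.

Lemma cis_2nPI (n : Z) : cis (IZR n * (2 * PI)) = 1%C.
Proof.
destruct n as [|p|p].
- rewrite Rmult_0_l; unfold cis; now rewrite cos_0, sin_0.
- rewrite <- (cis_2kPI (Pos.to_nat p)); f_equal.
  rewrite INR_IZR_INZ, positive_nat_Z; ring.
- assert (H : cis (2 * INR (Pos.to_nat p) * PI) = 1%C) by apply cis_2kPI.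
  rewrite INR_IZR_INZ, positive_nat_Z in H.
  unfold cis in *; injection H; intros Hs Hc.
  replace (IZR (Z.neg p) * (2 * PI)) with (- (2 * IZR (Z.pos p) * PI))
    by (change (Z.neg p) with (- Z.pos p)%Z; rewrite opp_IZR; ring).
  rewrite cos_neg, sin_neg, Hs, Hc, Ropp_0; reflexivity.
Qed.

Lemma qq_shift (t : C) (n : Z) : qq (t + RtoC (IZR n)) = qq t.
Proof.
unfold qq, nome.
replace (RtoC (-2 * PI) * - (Ci * (t + RtoC (IZR n))))%C with
  (RtoC (-2 * PI) * - (Ci * t) + RtoC (2 * PI) * (Ci * RtoC (IZR n)))%C
  by (replace (-2 * PI) with (- (2 * PI)) by ring; rewrite RtoC_opp; ring).
rewrite cexp_plus.
replace (cexp (RtoC (2 * PI) * (Ci * RtoC (IZR n)))) with (RtoC 1); [ring|].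
rewrite <- (cis_2nPI n); unfold cexp; simpl.
match goal with |- _ = (RtoC (exp ?a) * cis ?b)%C =>
  replace a with 0 by ring; replace b with (IZR n * (2 * PI)) by ring end.
rewrite exp_0; ring.
Qed.

Lemma qq_surj (q : C) :
  0 < Cmod q < 1 -> exists t, 0 < snd t /\ qq t = q.
Proof.
intros Hq; destruct (polar q) as [x Hx].
assert (Hp := PI_RGT_0).
exists (x / (2 * PI), - ln (Cmod q) / (2 * PI)); split.
- simpl; apply Rdiv_lt_0_compat; [|lra].
  assert (H : ln (Cmod q) < ln 1) by (apply ln_increasing; lra).
  rewrite ln_1 in H; lra.
- rewrite Hx at 2; unfold qq, nome, cexp; simpl.
  match goal with |- (RtoC (exp ?a) * cis ?b)%C = _ =>
    replace a with (ln (Cmod q)) by (field; lra);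
    replace b with x by (field; lra) end.
  rewrite exp_ln by lra; reflexivity.
Qed.

(* If every orbit meets [|q| <= rho], the supremum over the disc is attained on
   [|q| <= rho], where Schwarz's lemma improves it by a factor below [1]. *)
Lemma vanish_of_orbits (f : C -> C) (rho : R) :
  (forall r, 0 <= r < 1 -> approx 0 r f) -> f 0%C = 0%C -> 0 < rho < 1 ->
  (forall q, 0 < Cmod q < 1 ->
    exists q', 0 < Cmod q' <= rho /\ Cmod (f q) = Cmod (f q')) ->
  forall q, 0 < Cmod q < 1 -> f q = 0%C.
Proof.
intros Hf Hf0 Hrho Horb q Hq.
set (r := (1 + rho) / 2).
destruct (approx_bounded 0 rho f ltac:(lra) (Hf rho ltac:(lra))) as [B [HB HBf]].
assert (H1 : forall n z, Cmod z < 1 -> Cmod (f z) <= B * (rho / r) ^ n).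
{ assert (Hr0 : 0 < rho / r < 1).
  { unfold r; split; [apply Rdiv_lt_0_compat; lra|].
    apply Rmult_lt_reg_r with ((1 + rho) / 2); [lra|].
    unfold Rdiv at 1; rewrite Rmult_assoc, Rinv_l; lra. }
  induction n as [|n IH]; intros z Hz.
  - destruct (Req_dec (Cmod z) 0) as [H0|H0].
    { apply Cmod_eq_0 in H0; rewrite H0, Hf0, Cmod_0; simpl; lra. }
    destruct (Horb z) as [z' [Hz' ->]].
    { assert (H := Cmod_ge_0 z); lra. }
    simpl; rewrite Rmult_1_r; apply HBf; rewrite Cminus_0_r; lra.
  - assert (Hn : 0 <= B * (rho / r) ^ n)
      by (apply Rmult_le_pos; [lra|apply pow_le; lra]).
    destruct (Req_dec (Cmod z) 0) as [H0|H0].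
    { apply Cmod_eq_0 in H0; rewrite H0, Hf0, Cmod_0; simpl; nra. }
    destruct (Horb z) as [z' [Hz' ->]].
    { assert (H := Cmod_ge_0 z); lra. }
    eapply Rle_trans.
    + apply (approx_schwarz r (B * (rho / r) ^ n) f z'); unfold r; try lra.
      * apply Hf; lra.
      * exact Hf0.
      * intros w Hw; apply IH; unfold r in Hw; lra.
    + simpl; replace (B * (rho / r * (rho / r) ^ n)) with
        (rho / r * (B * (rho / r) ^ n)) by ring.
      apply Rmult_le_compat_r; auto.
      unfold Rdiv; apply Rmult_le_compat_r; [|lra].
      apply Rlt_le, Rinv_0_lt_compat; unfold r; lra. }
apply Cmod_0_ge, le_of_forall_le_mult_eps with B; auto; intros e He.
assert (Hr0 : 0 < rho / r < 1).
{ unfold r; split; [apply Rdiv_lt_0_compat; lra|].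
  apply Rmult_lt_reg_r with ((1 + rho) / 2); [lra|].
  unfold Rdiv at 1; rewrite Rmult_assoc, Rinv_l; lra. }
destruct (pow_lt_1_zero (rho / r) ltac:(rewrite Rabs_pos_eq; lra) e He) as [N HN].
specialize (HN N (le_n N)); rewrite Rabs_pos_eq in HN by (apply pow_le; lra).
specialize (H1 N q ltac:(lra)); nra.
Qed.

(** Integer translations are free, as [qq] has period 1, and each use of the hypothesis raises the
    imaginary part by the factor [lam]; so every orbit reaches height [c], that is the disc of
    radius [exp (-2 * PI * c)]. Only moduli are compared, so unimodular multipliers do no harm. *)
Lemma vanish_of_reduction (f : C -> C) (x0 c lam : R) :
  (forall r, 0 <= r < 1 -> approx 0 r f) -> f 0%C = 0%C -> 0 < c -> 1 < lam ->
  (forall t, 0 < snd t < c -> x0 <= fst t <= x0 + 1 ->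
    exists t', Cmod (f (qq t)) = Cmod (f (qq t')) /\ lam * snd t <= snd t') ->
  forall t, 0 < snd t -> f (qq t) = 0%C.
Proof.
intros Hf Hf0 Hc Hlam Hred.
assert (Hstep : forall n t, 0 < snd t -> exists t', 0 < snd t' /\
  Cmod (f (qq t)) = Cmod (f (qq t')) /\
  (c <= snd t' \/ lam ^ n * snd t <= snd t')).
{ induction n as [|n IH]; intros t Ht.
  - exists t; simpl; split; [auto|split; [auto|right; lra]].
  - destruct (IH t Ht) as [t' [Ht' [He [Hl|Hl]]]].
    + exists t'; auto.
    + destruct (Rle_lt_dec c (snd t')) as [Hl'|Hl'].
      { exists t'; auto. }
      (* The integer translation that brings [fst t'] between [x0] and [x0 + 1]. *)
      set (n0 := (1 - up (fst t' - x0))%Z).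
      destruct (archimed (fst t' - x0)) as [Ha Hb].
      destruct (Hred (t' + RtoC (IZR n0))%C) as [t'' [He' Hl'']].
      * simpl; lra.
      * change (x0 <= fst t' + IZR n0 <= x0 + 1).
        unfold n0; rewrite minus_IZR; lra.
      * simpl in Hl''; exists t''; rewrite qq_shift in He'.
        rewrite Rplus_0_r in Hl''.
        split; [nra|split; [congruence|right]].
        simpl; nra. }
assert (Hall : forall t, 0 < snd t -> exists t', c <= snd t' /\
  Cmod (f (qq t)) = Cmod (f (qq t'))).
{ intros t Ht.
  destruct (Pow_x_infinity lam ltac:(rewrite Rabs_pos_eq; lra) (c / snd t))
    as [N HN].
  specialize (HN N (le_n N)); rewrite Rabs_pos_eq in HN by (apply pow_le; lra).
  destruct (Hstep N t Ht) as [t' [Ht' [He Hl]]].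
  exists t'; split; auto; destruct Hl as [|Hl]; auto.
  apply Rle_trans with (lam ^ N * snd t); auto.
  apply Rmult_le_reg_r with (/ snd t); [now apply Rinv_0_lt_compat|].
  rewrite Rmult_assoc, Rinv_r by lra.
  unfold Rdiv in HN; lra. }
intros t Ht; apply (vanish_of_orbits f (exp (-2 * PI * c))); auto.
- now apply exp_neg_lt_1.
- intros q Hq; destruct (qq_surj q Hq) as [s [Hs <-]].
  destruct (Hall s Hs) as [s' [Hs' He]].
  exists (qq s'); split; auto; rewrite Cmod_qq; split; [apply exp_pos|].
  apply exp_le; assert (Hp := PI_RGT_0); nra.
- split; [rewrite Cmod_qq; apply exp_pos|now apply Cmod_qq_lt_1].
Qed.

(** * Jacobi's triple product *)

Fixpoint rsum (f : nat -> R) (n : nat) : R :=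
  match n with O => 0 | S m => rsum f m + f m end.

Lemma rsum_ext (f g : nat -> R) (n : nat) :
  (forall k, (k < n)%nat -> f k = g k) -> rsum f n = rsum g n.
Proof.
induction n as [|n IH]; intros H; simpl; auto.
rewrite IH, H; auto with arith.
Qed.

Lemma rsum_plus (f g : nat -> R) (n : nat) :
  rsum (fun k => f k + g k) n = rsum f n + rsum g n.
Proof. induction n as [|n IH]; simpl; [ring|rewrite IH; ring]. Qed.

Lemma rsum_scal (c : R) (f : nat -> R) (n : nat) :
  rsum (fun k => c * f k) n = c * rsum f n.
Proof. induction n as [|n IH]; simpl; [ring|rewrite IH; ring]. Qed.

Lemma rsum_shift (f : nat -> R) (n : nat) :
  rsum f (S n) = f O + rsum (fun k => f (S k)) n.
Proof.
induction n as [|n IH]; [simpl; ring|].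
change (rsum f (S (S n))) with (rsum f (S n) + f (S n)).
rewrite IH; simpl; ring.
Qed.

Definition rser (f : nat -> R) : R := real (Lim_seq (rsum f)).

Lemma rser_ext (f g : nat -> R) : (forall n, f n = g n) -> rser f = rser g.
Proof.
intros H; unfold rser; f_equal; apply Lim_seq_ext; intros n.
apply rsum_ext; auto.
Qed.

Lemma rser_lim (f : nat -> R) (A rho : R) :
  0 <= rho < 1 -> (forall n, Rabs (f n) <= A * rho ^ n) ->
  is_lim_seq (rsum f) (rser f).
Proof.
intros Hr H; apply (lim_geom_increments _ A rho Hr); intros n; simpl.
replace (rsum f n + f n - rsum f n) with (f n) by ring; apply H.
Qed.

Lemma is_lim_seq_const_unique (u : nat -> R) (l m : R) :
  is_lim_seq u l -> is_lim_seq u m -> l = m.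
Proof.
intros H1 H2; apply is_lim_seq_unique in H1; apply is_lim_seq_unique in H2.
rewrite H1 in H2; now injection H2.
Qed.

Lemma rser_unique (f : nat -> R) (l : R) : is_lim_seq (rsum f) l -> rser f = l.
Proof. intros H; unfold rser; now rewrite (is_lim_seq_unique _ _ H). Qed.

Lemma rsum_tail_bound (f : nat -> R) (A rho : R) (n k : nat) :
  0 <= rho < 1 -> (forall n, Rabs (f n) <= A * rho ^ n) ->
  Rabs (rsum f (n + k) - rsum f n) <= A * rho ^ n / (1 - rho).
Proof.
intros Hr H.
assert (HA : 0 <= A * rho ^ n)
  by (eapply Rle_trans; [apply Rabs_pos|apply H]).
apply Rle_trans with (A * rho ^ n * ((1 - rho ^ k) / (1 - rho))).
- induction k as [|k IH].
  + rewrite Nat.add_0_r, Rminus_diag, Rabs_R0.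
    simpl; apply Req_le; field; lra.
  + rewrite Nat.add_succ_r; cbn [rsum].
    replace (rsum f (n + k) + f (n + k)%nat - rsum f n) with
      ((rsum f (n + k) - rsum f n) + f (n + k)%nat) by ring.
    eapply Rle_trans; [apply Rabs_triang|].
    specialize (H (n + k)%nat); rewrite pow_add in H.
    replace (A * rho ^ n * ((1 - rho ^ S k) / (1 - rho))) with
      (A * rho ^ n * ((1 - rho ^ k) / (1 - rho)) + A * (rho ^ n * rho ^ k))
      by (simpl; field; lra).
    lra.
- unfold Rdiv; rewrite <- Rmult_assoc; apply Rmult_le_compat_r.
  + apply Rlt_le, Rinv_0_lt_compat; lra.
  + assert (0 <= rho ^ k) by (apply pow_le; lra); nra.
Qed.

(** Dominated convergence for sums whose number of terms [M N] grows with [N]. It takes both the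
    finite triple product and Polya's finite identity to their limits. *)
Lemma tannery (f : nat -> nat -> R) (g : nat -> R) (M : nat -> nat) (A rho : R) :
  0 <= rho < 1 -> (forall n, is_lim_seq (fun N => f N n) (g n)) ->
  (forall N n, Rabs (f N n) <= A * rho ^ n) ->
  (forall K, exists N0, forall N, (N0 <= N)%nat -> (K <= M N)%nat) ->
  is_lim_seq (fun N => rsum (f N) (M N)) (rser g).
Proof.
intros Hr Hlim Hb HM.
assert (Hg : forall n, Rabs (g n) <= A * rho ^ n).
{ intros n; apply (is_lim_seq_le (fun N => Rabs (f N n)) (fun _ => A * rho ^ n)
    (Rabs (g n)) (A * rho ^ n)).
  - intros N; apply Hb.
  - apply (is_lim_seq_abs _ (g n)), Hlim.
  - apply is_lim_seq_const. }
assert (Hgl := rser_lim g A rho Hr Hg).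
apply is_lim_seq_spec; intros eps.
assert (Hlim0 : is_lim_seq (fun n => A / (1 - rho) * rho ^ n) (A / (1 - rho) * 0)).
{ apply is_lim_seq_mult'; [apply is_lim_seq_const|].
  apply is_lim_seq_geom; rewrite Rabs_pos_eq; lra. }
rewrite Rmult_0_r in Hlim0.
assert (He : 0 < eps / 4) by (destruct eps; simpl; lra).
apply is_lim_seq_spec in Hlim0; destruct (Hlim0 (mkposreal _ He)) as [K1 HK1].
apply is_lim_seq_spec in Hgl; destruct (Hgl (mkposreal _ He)) as [K2 HK2].
cbn [pos] in HK1, HK2.
set (K := (K1 + K2)%nat).
specialize (HK1 K ltac:(unfold K; lia)); specialize (HK2 K ltac:(unfold K; lia)).
rewrite Rminus_0_r in HK1; apply Rabs_def2 in HK1.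
replace (A / (1 - rho) * rho ^ K) with (A * rho ^ K / (1 - rho)) in HK1
  by (field; lra).
assert (Hfin : is_lim_seq (fun N => rsum (f N) K) (rsum g K)).
{ clear -Hlim; induction K as [|K IH]; simpl.
  - apply is_lim_seq_const.
  - apply is_lim_seq_plus'; auto. }
apply is_lim_seq_spec in Hfin; destruct (Hfin (mkposreal _ He)) as [N1 HN1].
destruct (HM K) as [N2 HN2]; cbn [pos] in HN1.
exists (N1 + N2)%nat; intros N HN.
specialize (HN1 N ltac:(lia)); specialize (HN2 N ltac:(lia)).
assert (Ht := rsum_tail_bound (f N) A rho K (M N - K) Hr (Hb N)).
replace (K + (M N - K))%nat with (M N) in Ht by lia.
apply Rabs_le_between in Ht.
apply Rabs_def2 in HN1; apply Rabs_def2 in HK2.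
apply Rabs_def1; lra.
Qed.

Fixpoint tri (n : nat) : nat := match n with O => O | S m => (tri m + S m)%nat end.

Lemma tri_ge (n : nat) : (n <= tri n)%nat.
Proof. induction n as [|n IH]; simpl; lia. Qed.

Lemma INR_tri (n : nat) : INR (tri n) = INR n * (INR n + 1) / 2.
Proof.
induction n as [|n IH]; [simpl; field|].
cbn [tri]; rewrite plus_INR, IH, S_INR; field.
Qed.

Fixpoint rqpoch (q : R) (n : nat) : R :=
  match n with O => 1 | S m => rqpoch q m * (1 - q ^ S m) end.

Definition rphi (q : R) : R := real (Lim_seq (rqpoch q)).

Lemma qpoch_RtoC (q : R) (n : nat) : qpoch (RtoC q) n = RtoC (rqpoch q n).
Proof.
induction n as [|n IH]; [reflexivity|].
cbn [qpoch rqpoch]; now rewrite IH, RtoC_mult, RtoC_minus, RtoC_pow.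
Qed.

Lemma phi_RtoC (q : R) : phi (RtoC q) = RtoC (rphi q).
Proof.
unfold phi, rphi; rewrite <- climit_RtoC; apply climit_ext, qpoch_RtoC.
Qed.

Lemma pow_lt_1' (q : R) (n : nat) : 0 < q < 1 -> (0 < n)%nat -> 0 < q ^ n < 1.
Proof.
intros Hq Hn; split; [apply pow_lt; lra|].
apply pow_lt_1_compat; [lra|auto].
Qed.

Lemma rqpoch_pos (q : R) (n : nat) : 0 < q < 1 -> 0 < rqpoch q n.
Proof.
intros Hq; induction n as [|n IH]; [simpl; lra|].
cbn [rqpoch]; assert (H := pow_lt_1' q (S n) Hq ltac:(lia)).
apply Rmult_lt_0_compat; lra.
Qed.

Lemma rqpoch_le_1 (q : R) (n : nat) : 0 < q < 1 -> rqpoch q n <= 1.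
Proof.
intros Hq; induction n as [|n IH]; [simpl; lra|].
cbn [rqpoch]; assert (H := pow_lt_1' q (S n) Hq ltac:(lia)).
assert (H1 := rqpoch_pos q n Hq); nra.
Qed.

Lemma rqpoch_ge (q : R) : 0 < q < 1 -> exists m, 0 < m /\ forall n, m <= rqpoch q n.
Proof.
intros Hq; exists (exp (- (1 / (1 - q) ^ 2))); split; [apply exp_pos|].
intros n; rewrite <- (Rabs_pos_eq (rqpoch q n)), <- Cmod_R, <- qpoch_RtoC
  by (apply Rlt_le, rqpoch_pos, Hq).
apply Cmod_qpoch_ge; [lra|]; rewrite Cmod_R, Rabs_pos_eq; lra.
Qed.

Lemma rphi_lim (q : R) : 0 < q < 1 -> is_lim_seq (rqpoch q) (rphi q).
Proof.
intros Hq; apply (lim_geom_increments _ (exp (1 / (1 - q))) q); [lra|].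
intros n; rewrite <- Cmod_R, RtoC_minus, <- !qpoch_RtoC.
apply qpoch_increment; [lra|]; rewrite Cmod_R, Rabs_pos_eq; lra.
Qed.

Lemma rphi_pos (q : R) : 0 < q < 1 -> 0 < rphi q.
Proof.
intros Hq; destruct (rqpoch_ge q Hq) as [m [Hm H]].
assert (m <= rphi q); [|lra].
apply (is_lim_seq_le (fun _ => m) (rqpoch q) m (rphi q)); auto.
- apply is_lim_seq_const.
- now apply rphi_lim.
Qed.

Lemma is_lim_seq_comp (u : nat -> R) (l : Rbar) (M : nat -> nat) :
  is_lim_seq u l ->
  (forall K, exists N0, forall N, (N0 <= N)%nat -> (K <= M N)%nat) ->
  is_lim_seq (fun N => u (M N)) l.
Proof.
intros Hu HM; apply (filterlim_comp _ _ _ M u eventually eventually); auto.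
intros P [K HK]; destruct (HM K) as [N0 HN0]; exists N0; auto.
Qed.

(** The Gaussian binomial coefficient of [2 N] over [N + n], extended by 0. *)
Definition jtp_coef (q : R) (N n : nat) : R :=
  if (n <=? N)%nat then rqpoch q (2 * N) / (rqpoch q (N - n) * rqpoch q (N + n))
  else 0.

Lemma jtp_coef_le (q : R) (N n : nat) : (n <= N)%nat ->
  jtp_coef q N n = rqpoch q (2 * N) / (rqpoch q (N - n) * rqpoch q (N + n)).
Proof.
intros H; unfold jtp_coef; now rewrite (proj2 (Nat.leb_le n N) H).
Qed.

Lemma jtp_coef_gt (q : R) (N n : nat) : (N < n)%nat -> jtp_coef q N n = 0.
Proof.
intros H; unfold jtp_coef; now rewrite (proj2 (Nat.leb_gt n N) H).
Qed.

Lemma one_minus_pow_neq (q : R) (n : nat) : 0 < q < 1 -> 1 - q * q ^ n <> 0.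
Proof.
intros Hq; assert (H := pow_lt_1' q (S n) Hq ltac:(lia)); simpl in H; lra.
Qed.

(** Two applications of the q-Pascal rule, from row [2 N] to row [2 N + 2]. Indices close to [N] are
    treated apart, because coefficients outside the row are 0 by convention and not by the quotient
    formula. *)
Lemma jtp_coef_rec (q : R) (N n : nat) : 0 < q < 1 -> (n <= N)%nat ->
  jtp_coef q (S N) (S n) = (1 + q ^ (2 * N + 1)) * jtp_coef q N (S n) +
    q ^ (N - n) * jtp_coef q N n + q ^ (N + n + 2) * jtp_coef q N (S (S n)).
Proof.
intros Hq Hn.
assert (Hnz : forall k, rqpoch q k <> 0)
  by (intros k; apply Rgt_not_eq, rqpoch_pos, Hq).
assert (Hnp := fun k => one_minus_pow_neq q k Hq).
destruct (Nat.eq_dec n N) as [->|H1]; [|destruct (Nat.eq_dec (S n) N) as [H2|H2]].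
- rewrite (jtp_coef_gt q N (S N)), (jtp_coef_gt q N (S (S N))) by lia.
  rewrite !jtp_coef_le by lia; rewrite !Nat.sub_diag.
  replace (S N + S N)%nat with (S (S (N + N))) by lia.
  replace (2 * S N)%nat with (S (S (N + N))) by lia.
  replace (2 * N)%nat with (N + N)%nat by lia.
  cbn [rqpoch pow]; field; repeat split; auto.
  + apply (Hnp (S (N + N))).
- subst N; rewrite (jtp_coef_gt q (S n) (S (S n))) by lia.
  rewrite !jtp_coef_le by lia.
  replace (S (S n) - S n)%nat with 1%nat by lia.
  replace (S n - S n)%nat with 0%nat by lia.
  replace (S n - n)%nat with 1%nat by lia.
  replace (S (S n) + S n)%nat with (S (S (n + S n))) by lia.
  replace (2 * S (S n))%nat with (S (S (S (n + S n)))) by lia.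
  replace (S n + S n)%nat with (S (n + S n)) by lia.
  replace (2 * S n)%nat with (S (n + S n)) by lia.
  replace (S n + n)%nat with (n + S n)%nat by lia.
  replace (S (n + S n) + 1)%nat with (S (S (n + S n))) by lia.
  cbn [rqpoch pow]; generalize (Hnp (n + S n)%nat), (Hnp (S (n + S n))), (Hnp O).
  cbn [pow]; intros Ha Hb Hc; field; repeat split; auto; lra.
- rewrite !jtp_coef_le by lia.
  set (D := (N - n - 2)%nat); set (Y := (N + n)%nat).
  replace (S N - S n)%nat with (S (S D)) by (unfold D; lia).
  replace (N - S n)%nat with (S D) by (unfold D; lia).
  replace (N - S (S n))%nat with D by (unfold D; lia).
  replace (N - n)%nat with (S (S D)) by (unfold D; lia).
  replace (S N + S n)%nat with (S (S Y)) by (unfold Y; lia).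
  replace (N + S n)%nat with (S Y) by (unfold Y; lia).
  replace (N + S (S n))%nat with (S (S Y)) by (unfold Y; lia).
  replace (2 * S N)%nat with (S (S (2 * N))) by lia.
  replace (Y + 2)%nat with (S (S Y)) by lia.
  replace (2 * N + 1)%nat with (S (2 * N)) by lia.
  cbn [rqpoch]; rewrite <- !tech_pow_Rmult.
  replace (2 * N)%nat with (D + 2 + Y)%nat by (unfold D, Y; lia).
  rewrite !pow_add; cbn [pow].
  generalize (Hnp D), (Hnp (S D)), (Hnp Y), (Hnp (S Y)).
  cbn [pow]; intros Ha Hb Hc Hd; field; repeat split; auto.
Qed.

Lemma jtp_coef_rec0 (q : R) (N : nat) : 0 < q < 1 ->
  jtp_coef q (S N) 0 = (1 + q ^ (2 * N + 1)) * jtp_coef q N 0 +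
    2 * q ^ (N + 1) * jtp_coef q N 1.
Proof.
intros Hq.
assert (Hnz : forall k, rqpoch q k <> 0)
  by (intros k; apply Rgt_not_eq, rqpoch_pos, Hq).
assert (Hnp := fun k => one_minus_pow_neq q k Hq).
destruct N as [|N].
- rewrite (jtp_coef_gt q 0 1), !jtp_coef_le by lia; simpl.
  generalize (Hnp O); simpl; intros H; field; lra.
- rewrite !jtp_coef_le by lia.
  replace (2 * S (S N))%nat with (S (S (2 * S N))) by lia.
  replace (S N - 0)%nat with (S N) by lia.
  replace (S (S N) - 0)%nat with (S (S N)) by lia.
  replace (S N - 1)%nat with N by lia.
  rewrite !Nat.add_0_r.
  replace (S N + 1)%nat with (S (S N)) by lia.
  replace (2 * S N + 1)%nat with (S (2 * S N)) by lia.
  cbn [rqpoch]; rewrite <- !tech_pow_Rmult.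
  replace (q ^ (2 * S N)) with (q * q ^ N * (q * q ^ N))
    by (replace (2 * S N)%nat with (S N + S N)%nat by lia; rewrite pow_add; simpl; ring).
  generalize (Hnp N), (Hnp (S N)); cbn [pow]; intros Ha Hb.
  field; repeat split; auto.
Qed.

(** The term of index [n >= 0] of Jacobi's bilateral series; the term of index [- n] is
    [jtp_term b a n]. *)
Definition jtp_term (a b : R) (n : nat) : R :=
  (-1) ^ n * a ^ tri n * b ^ tri (pred n).

Lemma jtp_term_S (a b : R) (n : nat) :
  jtp_term a b (S n) = - (a * (a * b) ^ n * jtp_term a b n).
Proof.
unfold jtp_term; destruct n as [|n]; [simpl; ring|].
cbn [tri pred pow]; rewrite !pow_add, Rpow_mult_distr; cbn [pow]; ring.
Qed.

Fixpoint jprod (a b : R) (N : nat) : R :=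
  match N with
  | O => 1
  | S N => jprod a b N * ((1 - a * (a * b) ^ N) * (1 - b * (a * b) ^ N))
  end.

(** One factor of the product carries row [N] to row [N + 1], seen on one half of the bilateral sum.
    The extra terms sit at its two ends. The length [M] varies separately from [N] to allow
    induction; at [M = N] the terms of the upper end vanish with their coefficients. *)
Lemma jtp_half_step (a b : R) (N M : nat) : 0 < a < 1 -> 0 < b < 1 ->
  (M <= N)%nat ->
  let q := a * b in
  (1 - a * q ^ N) * (1 - b * q ^ N) *
    rsum (fun n => jtp_term a b n * jtp_coef q N n) (S M) =
  rsum (fun n => jtp_term a b (S n) * jtp_coef q (S N) (S n)) (S M) +
  (1 + q ^ (2 * N + 1)) * jtp_coef q N 0 + q ^ (N + 1) * jtp_coef q N 1
  - b * q ^ N * jtp_coef q N 0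
  - jtp_term a b (S M) * ((1 + q ^ (2 * N + 1)) * jtp_coef q N (S M)
     + q ^ (N + M + 2) * jtp_coef q N (S (S M)))
  - jtp_term a b M * q ^ (N + M + 1) * jtp_coef q N (S M).
Proof.
intros Ha Hb HM q.
assert (Hq : 0 < q < 1) by (unfold q; nra).
assert (Hprod : (1 - a * q ^ N) * (1 - b * q ^ N) =
  1 + q ^ (2 * N + 1) - a * q ^ N - b * q ^ N).
{ replace (2 * N + 1)%nat with (S (N + N)) by lia; simpl; rewrite pow_add.
  unfold q at 3; ring. }
induction M as [|M IH].
- cbn [rsum]; rewrite Hprod, jtp_coef_rec by (auto; lia).
  rewrite jtp_term_S, !Nat.add_0_r, Nat.sub_0_r; unfold jtp_term; simpl tri.
  simpl pred; fold q; simpl pow; ring.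
- specialize (IH ltac:(lia)).
  cbn [rsum] in IH |- *.
  rewrite Rmult_plus_distr_l, IH, Hprod.
  rewrite (jtp_coef_rec q N (S M)) by (auto; lia).
  rewrite !(jtp_term_S a b (S M)), !(jtp_term_S a b M); fold q.
  assert (E1 : q ^ N = q ^ (N - S M) * q * q ^ M)
    by (rewrite <- (pow_1 q) at 3; rewrite <- !pow_add; f_equal; lia).
  replace (N + S M + 1)%nat with (S (S (N + M))) by lia.
  replace (N + S M + 2)%nat with (S (S (S (N + M)))) by lia.
  replace (N + M + 1)%nat with (S (N + M)) by lia.
  replace (N + M + 2)%nat with (S (S (N + M))) by lia.
  assert (E2 : a * b = q) by reflexivity.
  cbn [pow]; rewrite !pow_add, !E1.
  replace b with (q / a) by (unfold q; field; lra).
  field; lra.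
Qed.

(** Cauchy's finite form of the triple product. The term of index 0 belongs to both halves and is
    subtracted once; in the induction the lower boundary terms of the two halves combine through
    [jtp_coef_rec0]. *)
Lemma jtp_finite (a b : R) (N : nat) : 0 < a < 1 -> 0 < b < 1 ->
  jprod a b N =
    rsum (fun n => jtp_term a b n * jtp_coef (a * b) N n) (S N) +
    rsum (fun n => jtp_term b a n * jtp_coef (a * b) N n) (S N) -
    jtp_coef (a * b) N 0.
Proof.
intros Ha Hb; induction N as [|N IH].
- cbn [rsum jprod]; rewrite jtp_coef_le by lia; unfold jtp_term; simpl; field.
- assert (Hq : 0 < a * b < 1) by nra.
  assert (H1 := jtp_half_step a b N N Ha Hb (le_n N)).
  assert (H2 := jtp_half_step b a N N Hb Ha (le_n N)).
  cbv zeta in H1, H2; rewrite (Rmult_comm b a) in H2.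
  set (q := a * b) in *.
  rewrite (jtp_coef_gt q N (S N)), (jtp_coef_gt q N (S (S N))) in H1, H2 by lia.
  assert (HS : forall x y, rsum (fun n => jtp_term x y n * jtp_coef q (S N) n)
    (S (S N)) = jtp_coef q (S N) 0 +
    rsum (fun n => jtp_term x y (S n) * jtp_coef q (S N) (S n)) (S N)).
  { intros x y; rewrite rsum_shift; unfold jtp_term at 1; simpl tri.
    simpl pred; simpl pow; ring. }
  rewrite !HS, jtp_coef_rec0 by auto.
  cbn [jprod]; fold q; rewrite IH.
  replace ((rsum (fun n => jtp_term a b n * jtp_coef q N n) (S N) +
    rsum (fun n => jtp_term b a n * jtp_coef q N n) (S N) - jtp_coef q N 0) *
    ((1 - a * q ^ N) * (1 - b * q ^ N))) with
    ((1 - a * q ^ N) * (1 - b * q ^ N) *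
      rsum (fun n => jtp_term a b n * jtp_coef q N n) (S N) +
     (1 - b * q ^ N) * (1 - a * q ^ N) *
      rsum (fun n => jtp_term b a n * jtp_coef q N n) (S N) -
     (1 - a * q ^ N) * (1 - b * q ^ N) * jtp_coef q N 0) by ring.
  rewrite H1, H2.
  assert (Hprod : (1 - a * q ^ N) * (1 - b * q ^ N) =
    1 + q ^ (2 * N + 1) - a * q ^ N - b * q ^ N).
  { replace (2 * N + 1)%nat with (S (N + N)) by lia; simpl; rewrite pow_add.
    unfold q at 3; ring. }
  rewrite Hprod; ring.
Qed.

(** Ramanujan's [f(-a,-b)], with the terms of index [n] and [- n - 1] put together, as
    [tri (n + 1) = tri (n - 1) + 2 n + 1]. The Gaussian sums below use the same pairing, so the two
    series match term by term. *)
Definition theta_term (a b : R) (n : nat) : R :=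
  (-1) ^ n * a ^ tri n * b ^ tri (pred n) * (1 - b ^ (2 * n + 1)).

Definition theta (a b : R) : R := rser (theta_term a b).

Lemma Rabs_pow_m1 (n : nat) : Rabs ((-1) ^ n) = 1.
Proof.
rewrite <- RPow_abs, Rabs_left1 by lra.
replace (- -1) with 1 by ring; apply pow1.
Qed.

Lemma pow_tri_le (a : R) (n : nat) : 0 < a < 1 -> a ^ tri n <= a ^ n.
Proof.
intros Ha; replace (tri n) with (n + (tri n - n))%nat
  by (assert (H := tri_ge n); lia).
rewrite pow_add; assert (0 <= a ^ n) by (apply pow_le; lra).
assert (a ^ (tri n - n) <= 1) by (rewrite <- (pow1 (tri n - n)); apply pow_incr; lra).
nra.
Qed.

Lemma pow_le_1 (a : R) (n : nat) : 0 <= a <= 1 -> 0 <= a ^ n <= 1.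
Proof.
intros Ha; split; [apply pow_le; lra|].
rewrite <- (pow1 n); apply pow_incr; lra.
Qed.

Lemma theta_term_bound (a b : R) (n : nat) : 0 < a < 1 -> 0 < b < 1 ->
  Rabs (theta_term a b n) <= 1 * a ^ n.
Proof.
intros Ha Hb; unfold theta_term; rewrite !Rabs_mult, Rabs_pow_m1.
assert (H1 := pow_tri_le a n Ha).
assert (H2 := pow_le_1 b (tri (pred n)) ltac:(lra)).
assert (H3 := pow_le_1 b (2 * n + 1) ltac:(lra)).
assert (H4 := pow_le a (tri n) ltac:(lra)).
rewrite !Rabs_pos_eq by lra.
rewrite !Rmult_1_l.
apply Rle_trans with (a ^ tri n * 1 * 1); [|lra].
apply Rmult_le_compat; try lra; [nra|].
apply Rmult_le_compat; lra.
Qed.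

Lemma theta_lim (a b : R) : 0 < a < 1 -> 0 < b < 1 ->
  is_lim_seq (rsum (theta_term a b)) (theta a b).
Proof.
intros Ha Hb; apply (rser_lim _ 1 a); [lra|].
intros n; now apply theta_term_bound.
Qed.

Lemma jtp_coef_lim (q : R) (n : nat) : 0 < q < 1 ->
  is_lim_seq (fun N => jtp_coef q N n) (/ rphi q).
Proof.
intros Hq; assert (Hp := rphi_pos q Hq); assert (Hl := rphi_lim q Hq).
apply is_lim_seq_ext_loc with
  (fun N => rqpoch q (2 * N) / (rqpoch q (N - n) * rqpoch q (N + n))).
- exists n; intros N HN; now rewrite jtp_coef_le.
- replace (/ rphi q) with (rphi q / (rphi q * rphi q)) by (field; lra).
  apply is_lim_seq_div'; [| |nra].
  + apply (is_lim_seq_comp _ _ (fun N => (2 * N)%nat) Hl).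
    intros K; exists K; intros; lia.
  + apply is_lim_seq_mult'.
    * apply (is_lim_seq_comp _ _ (fun N => (N - n)%nat) Hl).
      intros K; exists (K + n)%nat; intros; lia.
    * apply (is_lim_seq_comp _ _ (fun N => (N + n)%nat) Hl).
      intros K; exists K; intros; lia.
Qed.

Lemma jtp_coef_bound (q : R) : 0 < q < 1 ->
  exists B, 0 <= B /\ forall N n, 0 <= jtp_coef q N n <= B.
Proof.
intros Hq; destruct (rqpoch_ge q Hq) as [m [Hm H]].
exists (/ (m * m)); split.
{ apply Rlt_le, Rinv_0_lt_compat; nra. }
intros N n; destruct (le_lt_dec n N) as [Hn|Hn].
- rewrite jtp_coef_le by auto.
  assert (H1 := H (N - n)%nat); assert (H2 := H (N + n)%nat).
  assert (H3 := rqpoch_pos q (2 * N) Hq); assert (H4 := rqpoch_le_1 q (2 * N) Hq).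
  assert (H5 : 0 < / (rqpoch q (N - n) * rqpoch q (N + n)) <= / (m * m)).
  { split; [apply Rinv_0_lt_compat; nra|].
    apply Rinv_le_contravar; [nra|apply Rmult_le_compat; lra]. }
  unfold Rdiv; nra.
- rewrite jtp_coef_gt by auto; split; [lra|].
  apply Rlt_le, Rinv_0_lt_compat; nra.
Qed.

(** Jacobi's triple product, as the limit of [jtp_finite]: every Gaussian coefficient tends to
    [/ rphi (a * b)], and all of them are bounded by one constant. *)
Lemma jprod_lim (a b : R) : 0 < a < 1 -> 0 < b < 1 ->
  is_lim_seq (jprod a b) (theta a b / rphi (a * b)).
Proof.
intros Ha Hb; assert (Hq : 0 < a * b < 1) by nra.
set (q := a * b) in *; assert (Hp := rphi_pos q Hq).
destruct (jtp_coef_bound q Hq) as [B [HB Hc]].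
set (f := fun N n => (-1) ^ n * a ^ tri n * b ^ tri (pred n) *
  (jtp_coef q N n - b ^ (2 * n + 1) * jtp_coef q N (S n))).
apply is_lim_seq_ext with (fun N => rsum (f N) (S N)).
- intros N; rewrite jtp_finite by auto; fold q.
  assert (H0 : jtp_coef q N (S N) = 0) by (apply jtp_coef_gt; lia).
  assert (HS : forall M, rsum (f N) (S M) =
    rsum (fun n => jtp_term a b n * jtp_coef q N n) (S M) +
    rsum (fun n => jtp_term b a n * jtp_coef q N n) (S M) -
    jtp_coef q N 0 + jtp_term b a (S M) * jtp_coef q N (S M)).
  { induction M as [|M IH].
    - cbn [rsum]; unfold f, jtp_term; simpl; ring.
    - change (rsum (f N) (S (S M))) with (rsum (f N) (S M) + f N (S M)).
      rewrite IH; cbn [rsum]; unfold f, jtp_term.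
      replace (2 * S M + 1)%nat with (S M + S (S M))%nat by lia.
      cbn [pred tri]; rewrite !pow_add; cbn [pow]; ring. }
  rewrite HS, H0; ring.
- replace (theta a b / rphi q) with (rser (fun n => theta_term a b n / rphi q)).
  + apply tannery with (B * (1 + 1)) a; try lra.
    * intros n; unfold f, theta_term.
      replace ((-1) ^ n * a ^ tri n * b ^ tri (pred n) * (1 - b ^ (2 * n + 1)) /
        rphi q) with ((-1) ^ n * a ^ tri n * b ^ tri (pred n) *
        (/ rphi q - b ^ (2 * n + 1) * / rphi q)) by (field; lra).
      apply is_lim_seq_mult'; [apply is_lim_seq_const|].
      apply is_lim_seq_minus'; [now apply jtp_coef_lim|].
      apply is_lim_seq_mult'; [apply is_lim_seq_const|now apply jtp_coef_lim].
    * intros N n; unfold f; rewrite !Rabs_mult, Rabs_pow_m1.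
      assert (H1 := pow_tri_le a n Ha).
      assert (H2 := pow_le_1 b (tri (pred n)) ltac:(lra)).
      assert (H3 := pow_le_1 b (2 * n + 1) ltac:(lra)).
      assert (H4 := pow_le a (tri n) ltac:(lra)).
      rewrite (Rabs_pos_eq (a ^ _)), (Rabs_pos_eq (b ^ _)) by lra.
      assert (H5 := Hc N n); assert (H6 := Hc N (S n)).
      assert (H7 : Rabs (jtp_coef q N n - b ^ (2 * n + 1) * jtp_coef q N (S n))
        <= B * (1 + 1)) by (apply Rabs_le; nra).
      rewrite Rmult_1_l, Rmult_comm.
      apply Rmult_le_compat; auto using Rabs_pos; nra.
    * intros K; exists K; intros; lia.
  + apply rser_unique.
    apply is_lim_seq_ext with (fun n => / rphi q * rsum (theta_term a b) n).
    * intros n; rewrite <- rsum_scal; apply rsum_ext; intros; field; lra.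
    * unfold Rdiv; rewrite Rmult_comm.
      apply is_lim_seq_mult'; [apply is_lim_seq_const|now apply theta_lim].
Qed.

(** Euler's pentagonal number theorem: the factors of [jprod (q ^ 2) q] have the exponents not
    divisible by 3, and [rphi (q ^ 3)] supplies the multiples of 3. *)
Lemma pentagonal (q : R) : 0 < q < 1 -> theta (q ^ 2) q = rphi q.
Proof.
intros Hq; assert (H2 := pow_lt_1' q 2 Hq ltac:(lia)).
assert (H3 := pow_lt_1' q 3 Hq ltac:(lia)).
assert (Hp := rphi_pos (q ^ 3) H3).
assert (H : is_lim_seq (fun N => jprod (q ^ 2) q N * rqpoch (q ^ 3) N)
  (theta (q ^ 2) q / rphi (q ^ 2 * q) * rphi (q ^ 3))).
{ apply is_lim_seq_mult'; [now apply jprod_lim|now apply rphi_lim]. }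
replace (q ^ 2 * q) with (q ^ 3) in H by ring.
replace (theta (q ^ 2) q / rphi (q ^ 3) * rphi (q ^ 3)) with (theta (q ^ 2) q)
  in H by (field; lra).
apply (is_lim_seq_const_unique _ _ _ H).
apply is_lim_seq_ext with (fun N => rqpoch q (3 * N)).
- intros N; induction N as [|N IH]; [simpl; ring|].
  replace (3 * S N)%nat with (S (S (S (3 * N)))) by lia.
  cbn [rqpoch jprod]; rewrite IH; cbn [pow].
  rewrite (Nat.mul_comm 3), !pow_mult, !Rpow_mult_distr, !pow1; ring.
- apply (is_lim_seq_comp _ _ (fun N => (3 * N)%nat) (rphi_lim q Hq)).
  intros K; exists K; intros; lia.
Qed.

(** Together the two infinite products run over the exponents not divisible by 5; one of the two
    factors [rphi (q ^ 5)] supplies the multiples of 5 and the other remains. *)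
Lemma theta5_mult (q : R) : 0 < q < 1 ->
  theta (q ^ 4) q * theta (q ^ 3) (q ^ 2) = rphi q * rphi (q ^ 5).
Proof.
intros Hq; assert (Hpow := fun n => pow_lt_1' q (S n) Hq ltac:(lia)).
assert (H2 := Hpow 1%nat); assert (H3 := Hpow 2%nat); assert (H4 := Hpow 3%nat).
assert (H5 := Hpow 4%nat).
assert (Hp := rphi_pos (q ^ 5) H5).
assert (H : is_lim_seq (fun N => jprod (q ^ 4) q N * jprod (q ^ 3) (q ^ 2) N *
    rqpoch (q ^ 5) N) (theta (q ^ 4) q / rphi (q ^ 4 * q) *
    (theta (q ^ 3) (q ^ 2) / rphi (q ^ 3 * q ^ 2)) * rphi (q ^ 5))).
{ repeat apply is_lim_seq_mult'; try (now apply jprod_lim); now apply rphi_lim. }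
replace (q ^ 4 * q) with (q ^ 5) in H by ring.
replace (q ^ 3 * q ^ 2) with (q ^ 5) in H by ring.
assert (H' : is_lim_seq (fun N => jprod (q ^ 4) q N * jprod (q ^ 3) (q ^ 2) N *
    rqpoch (q ^ 5) N) (rphi q)).
{ apply is_lim_seq_ext with (fun N => rqpoch q (5 * N)).
  - intros N; induction N as [|N IH]; [simpl; ring|].
    replace (5 * S N)%nat with (S (S (S (S (S (5 * N)))))) by lia.
    cbn [rqpoch jprod]; rewrite IH; cbn [pow].
    rewrite (Nat.mul_comm 5), !pow_mult, !Rpow_mult_distr, !pow1; ring.
  - apply (is_lim_seq_comp _ _ (fun N => (5 * N)%nat) (rphi_lim q Hq)).
    intros K; exists K; intros; lia. }
assert (E := is_lim_seq_const_unique _ _ _ H H').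
rewrite <- E; field; lra.
Qed.

(** * Poisson summation from binomial coefficients *)

(** The binomial coefficient of [2 m + 1] over [m - i], which is half the coefficient of
    [cos ((2 i + 1) x)] in [(2 cos x) ^ (2 m + 1)]. *)
Definition odd_binom (m i : nat) : R :=
  if (i <=? m)%nat
  then INR (fact (2 * m + 1)) / (INR (fact (m - i)) * INR (fact (m + 1 + i)))
  else 0.

Lemma odd_binom_le (m i : nat) : (i <= m)%nat -> odd_binom m i =
  INR (fact (2 * m + 1)) / (INR (fact (m - i)) * INR (fact (m + 1 + i))).
Proof.
intros H; unfold odd_binom; now rewrite (proj2 (Nat.leb_le i m) H).
Qed.

Lemma odd_binom_gt (m i : nat) : (m < i)%nat -> odd_binom m i = 0.
Proof.
intros H; unfold odd_binom; now rewrite (proj2 (Nat.leb_gt i m) H).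
Qed.

Lemma INR_fact_S (n : nat) : INR (fact (S n)) = INR (S n) * INR (fact n).
Proof. now rewrite fact_simpl, mult_INR. Qed.

Lemma odd_binom_pos (m i : nat) : (i <= m)%nat -> 0 < odd_binom m i.
Proof.
intros H; rewrite odd_binom_le by auto; apply Rdiv_lt_0_compat.
- apply INR_fact_lt_0.
- apply Rmult_lt_0_compat; apply INR_fact_lt_0.
Qed.

Lemma odd_binom_S0 (m : nat) :
  odd_binom (S m) 0 = 3 * odd_binom m 0 + odd_binom m 1.
Proof.
destruct m as [|m].
- rewrite (odd_binom_gt 0 1), !odd_binom_le by lia; simpl; field.
- rewrite !odd_binom_le by lia.
  replace (2 * S (S m) + 1)%nat with (S (S (2 * S m + 1))) by lia.
  replace (S (S m) - 0)%nat with (S (S m)) by lia.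
  replace (S m - 0)%nat with (S m) by lia.
  replace (S m - 1)%nat with m by lia.
  replace (S (S m) + 1 + 0)%nat with (S (S (S m))) by lia.
  replace (S m + 1 + 0)%nat with (S (S m)) by lia.
  replace (S m + 1 + 1)%nat with (S (S (S m))) by lia.
  rewrite !INR_fact_S, !S_INR, !plus_INR, !mult_INR, !S_INR; simpl INR.
  assert (H := pos_INR m); field.
  repeat split; try apply INR_fact_neq_0; lra.
Qed.

Lemma odd_binom_SS (m i : nat) : odd_binom (S m) (S i) =
  odd_binom m i + 2 * odd_binom m (S i) + odd_binom m (S (S i)).
Proof.
destruct (le_lt_dec i m) as [Hi|Hi].
2:{ rewrite !odd_binom_gt by lia; ring. }
destruct (Nat.eq_dec i m) as [->|H1]; [|destruct (Nat.eq_dec (S i) m) as [H2|H2]].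
- rewrite (odd_binom_gt m (S m)), (odd_binom_gt m (S (S m))), !odd_binom_le by lia.
  rewrite !Nat.sub_diag.
  replace (2 * S m + 1)%nat with (S m + 1 + S m)%nat by lia.
  replace (2 * m + 1)%nat with (m + 1 + m)%nat by lia.
  field; repeat split; apply INR_fact_neq_0.
- subst m; rewrite (odd_binom_gt (S i) (S (S i))), !odd_binom_le by lia.
  rewrite !Nat.sub_diag.
  replace (S (S i) - S i)%nat with 1%nat by lia.
  replace (S i - i)%nat with 1%nat by lia.
  replace (2 * S (S i) + 1)%nat with (S (S (2 * i + 3))) by lia.
  replace (2 * S i + 1)%nat with (2 * i + 3)%nat by lia.
  replace (S (S i) + 1 + S i)%nat with (S (2 * i + 3)) by lia.
  replace (S i + 1 + i)%nat with (2 * i + 2)%nat by lia.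
  replace (S i + 1 + S i)%nat with (2 * i + 3)%nat by lia.
  replace (2 * i + 3)%nat with (S (2 * i + 2)) by lia.
  rewrite !INR_fact_S, !S_INR, !plus_INR, !mult_INR; simpl INR; simpl fact.
  assert (H := pos_INR i); field.
  repeat split; try apply INR_fact_neq_0; lra.
- rewrite !odd_binom_le by lia.
  set (d := (m - i - 2)%nat).
  replace (S m - S i)%nat with (S (S d)) by (unfold d; lia).
  replace (m - i)%nat with (S (S d)) by (unfold d; lia).
  replace (m - S i)%nat with (S d) by (unfold d; lia).
  replace (m - S (S i))%nat with d by (unfold d; lia).
  replace m with (d + i + 2)%nat by (unfold d; lia).
  replace (2 * S (d + i + 2) + 1)%nat with (S (S (2 * (d + i + 2) + 1))) by lia.
  replace (S (d + i + 2) + 1 + S i)%nat with (S (S (d + i + 2 + 1 + i))) by lia.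
  replace (d + i + 2 + 1 + S i)%nat with (S (d + i + 2 + 1 + i)) by lia.
  replace (d + i + 2 + 1 + S (S i))%nat with (S (S (d + i + 2 + 1 + i))) by lia.
  rewrite !INR_fact_S, !S_INR, !plus_INR, !mult_INR, !plus_INR; simpl INR.
  assert (H := pos_INR i); assert (H' := pos_INR d); field.
  repeat split; try apply INR_fact_neq_0; lra.
Qed.

(** Induction by multiplication with [(2 cos x) ^ 2]. The length [I] is arbitrary above [m], where
    the coefficients vanish; it will be a multiple of the number of sample points. *)
Lemma cos_odd_pow (x : R) (m I : nat) : (m < I)%nat ->
  (2 * cos x) ^ (2 * m + 1) =
  2 * rsum (fun i => odd_binom m i * cos ((2 * INR i + 1) * x)) I.
Proof.
revert I; induction m as [|m IH]; intros I HI.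
- destruct I as [|I]; [lia|].
  assert (H : rsum (fun i => odd_binom 0 i * cos ((2 * INR i + 1) * x)) (S I) =
    cos x).
  { clear HI; induction I as [|I IH].
    - cbn [rsum]; rewrite odd_binom_le by lia; simpl.
      replace ((2 * 0 + 1) * x) with x by ring; field.
    - change (rsum (fun i => odd_binom 0 i * cos ((2 * INR i + 1) * x)) (S (S I)))
        with (rsum (fun i => odd_binom 0 i * cos ((2 * INR i + 1) * x)) (S I) +
          odd_binom 0 (S I) * cos ((2 * INR (S I) + 1) * x)).
      rewrite IH, odd_binom_gt by lia; ring. }
  rewrite H; simpl; ring.
- set (c := fun i => cos ((2 * INR i + 1) * x)).
  assert (Hc : forall i, (2 * cos x) ^ 2 * c (S i) =
    2 * c (S i) + c (S (S i)) + c i).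
  { intros i; unfold c; rewrite !S_INR.
    replace ((2 * (INR i + 1 + 1) + 1) * x) with
      ((2 * (INR i + 1) + 1) * x + 2 * x) by ring.
    replace ((2 * INR i + 1) * x) with ((2 * (INR i + 1) + 1) * x - 2 * x) by ring.
    rewrite cos_plus, cos_minus, cos_2a_cos; ring. }
  assert (Hc0 : (2 * cos x) ^ 2 * c O = 3 * c O + c 1%nat).
  { unfold c; simpl INR; replace ((2 * 0 + 1) * x) with x by ring.
    replace ((2 * 1 + 1) * x) with (x + 2 * x) by ring.
    rewrite cos_plus, cos_2a_cos, sin_2a.
    assert (H := sin2_cos2 x); unfold Rsqr in H.
    replace (sin x * (2 * sin x * cos x)) with (2 * cos x * (sin x * sin x)) by ring.
    replace (sin x * sin x) with (1 - cos x * cos x) by lra; ring. }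
  assert (Hs : forall J, (2 * cos x) ^ 2 * rsum (fun i => odd_binom m i * c i) (S J)
    = rsum (fun i => odd_binom (S m) i * c i) (S J) +
      odd_binom m J * c (S J) - odd_binom m (S J) * c J).
  { induction J as [|J IHJ].
    - cbn [rsum]; rewrite odd_binom_S0.
      replace ((2 * cos x) ^ 2 * (0 + odd_binom m 0 * c 0%nat)) with
        (odd_binom m 0 * ((2 * cos x) ^ 2 * c 0%nat)) by ring.
      rewrite Hc0; ring.
    - change (rsum (fun i => odd_binom m i * c i) (S (S J))) with
        (rsum (fun i => odd_binom m i * c i) (S J) + odd_binom m (S J) * c (S J)).
      change (rsum (fun i => odd_binom (S m) i * c i) (S (S J))) with
        (rsum (fun i => odd_binom (S m) i * c i) (S J) +
         odd_binom (S m) (S J) * c (S J)).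
      rewrite Rmult_plus_distr_l, IHJ, odd_binom_SS.
      replace ((2 * cos x) ^ 2 * (odd_binom m (S J) * c (S J))) with
        (odd_binom m (S J) * ((2 * cos x) ^ 2 * c (S J))) by ring.
      rewrite Hc; ring. }
  destruct I as [|J]; [lia|].
  replace (2 * S m + 1)%nat with (2 * m + 1 + 2)%nat by lia.
  rewrite pow_add, (IH (S J)) by lia; fold c.
  specialize (Hs J).
  rewrite (odd_binom_gt m J), (odd_binom_gt m (S J)) in Hs by lia.
  change (rsum (fun i => odd_binom m i * cos ((2 * INR i + 1) * x)) (S J))
    with (rsum (fun i => odd_binom m i * c i) (S J)).
  change (rsum (fun i => odd_binom (S m) i * cos ((2 * INR i + 1) * x)) (S J))
    with (rsum (fun i => odd_binom (S m) i * c i) (S J)).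
  lra.
Qed.

Lemma dirichlet_kernel (t : R) (N : nat) :
  sin (t / 2) * (1 + 2 * rsum (fun v => cos (INR (S v) * t)) N) =
  sin ((2 * INR N + 1) * (t / 2)).
Proof.
induction N as [|N IH].
- simpl; rewrite !Rmult_0_r, Rplus_0_r, Rplus_0_l, Rmult_1_l; ring.
- cbn [rsum].
  replace (sin (t / 2) * (1 + 2 * (rsum (fun v => cos (INR (S v) * t)) N +
    cos (INR (S N) * t)))) with
    (sin (t / 2) * (1 + 2 * rsum (fun v => cos (INR (S v) * t)) N) +
     2 * (sin (t / 2) * cos (INR (S N) * t))) by ring.
  rewrite IH.
  replace ((2 * INR N + 1) * (t / 2)) with (INR (S N) * t - t / 2)
    by (rewrite S_INR; field).
  replace ((2 * INR (S N) + 1) * (t / 2)) with (INR (S N) * t + t / 2) by field.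
  rewrite sin_plus, sin_minus; ring.
Qed.

Lemma cos_plus_nPI (x : R) (n : nat) : cos (x + INR n * PI) = (-1) ^ n * cos x.
Proof.
induction n as [|n IH]; [simpl; rewrite Rmult_0_l, Rplus_0_r; ring|].
rewrite S_INR; replace (x + (INR n + 1) * PI) with (x + INR n * PI + PI) by ring.
rewrite neg_cos, IH; simpl; ring.
Qed.

(* For odd [l = 2N+1] the signed sum over a full period selects the
   frequencies [2i+1] divisible by [l]. *)
Lemma signed_period_sum (N j u : nat) (al : R) : (u < 2 * N + 1)%nat ->
  let l := (2 * N + 1)%nat in
  let ph := (2 * INR (l * j + u) + 1) * PI / INR l in
  cos (ph * al) + rsum (fun v => (-1) ^ S v *
    (cos (ph * (INR (S v) + al)) + cos (ph * (INR (S v) - al)))) N =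
  if (u =? N)%nat then INR l * cos ((2 * INR j + 1) * PI * al) else 0.
Proof.
intros Hu l ph.
assert (Hl : INR l = 2 * INR N + 1)
  by (unfold l; rewrite plus_INR, mult_INR; simpl; ring).
assert (HN := pos_INR N); assert (Hpi := PI_RGT_0).
assert (E : cos (ph * al) + rsum (fun v => (-1) ^ S v *
    (cos (ph * (INR (S v) + al)) + cos (ph * (INR (S v) - al)))) N =
  cos (ph * al) * (1 + 2 * rsum (fun v => cos (INR (S v) * (ph + PI))) N)).
{ rewrite Rmult_plus_distr_l, Rmult_1_r; f_equal.
  rewrite <- !Rmult_assoc, <- rsum_scal; apply rsum_ext; intros v _.
  replace (INR (S v) * (ph + PI)) with (INR (S v) * ph + INR (S v) * PI) by ring.
  rewrite cos_plus_nPI.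
  replace (ph * (INR (S v) + al)) with (INR (S v) * ph + ph * al) by ring.
  replace (ph * (INR (S v) - al)) with (INR (S v) * ph - ph * al) by ring.
  rewrite cos_plus, cos_minus; ring. }
rewrite E; destruct (Nat.eqb_spec u N) as [->|Hne].
- assert (Hph : ph = (2 * INR j + 1) * PI).
  { unfold ph; rewrite plus_INR, mult_INR, Hl; field; lra. }
  rewrite Hph.
  assert (Hs : rsum (fun v => cos (INR (S v) * ((2 * INR j + 1) * PI + PI))) N =
    INR N).
  { rewrite (rsum_ext _ (fun _ => 1)).
    - clear; induction N as [|N IH]; [reflexivity|].
      cbn [rsum]; rewrite IH, S_INR; ring.
    - intros v _; replace (INR (S v) * ((2 * INR j + 1) * PI + PI)) with
        (0 + 2 * INR (S v * S j) * PI) by (rewrite mult_INR, (S_INR j); ring).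
      rewrite cos_period; apply cos_0. }
  rewrite Hs, Hl; ring.
- assert (HD := dirichlet_kernel (ph + PI) N).
  assert (Hx : (ph + PI) / 2 = INR (l * j + u + N + 1) * PI / INR l).
  { unfold ph; rewrite !plus_INR, mult_INR, Hl; simpl INR; field; lra. }
  assert (H0 : sin ((2 * INR N + 1) * ((ph + PI) / 2)) = 0).
  { rewrite Hx, <- Hl.
    replace (INR l * (INR (l * j + u + N + 1) * PI / INR l)) with
      (INR (l * j + u + N + 1) * PI) by (field; lra).
    apply sin_eq_0_1; exists (Z.of_nat (l * j + u + N + 1)).
    now rewrite <- INR_IZR_INZ. }
  rewrite H0 in HD.
  assert (Hs : sin ((ph + PI) / 2) <> 0).
  { rewrite Hx; intros Hs; apply sin_eq_0_0 in Hs; destruct Hs as [k Hk].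
    assert (Hk' : INR (l * j + u + N + 1) = IZR k * INR l).
    { apply Rmult_eq_reg_r with PI; [|lra].
      apply Rmult_eq_reg_r with (/ INR l);
        [|apply Rinv_neq_0_compat; lra].
      unfold Rdiv in Hk; rewrite Hk; field; lra. }
    rewrite !INR_IZR_INZ, <- mult_IZR in Hk'; apply eq_IZR in Hk'.
    unfold l in Hk'; apply Hne.
    assert (Hz : (Z.of_nat u + Z.of_nat N + 1 =
      (k - Z.of_nat j) * (2 * Z.of_nat N + 1))%Z) by nia.
    assert (k - Z.of_nat j = 1)%Z by nia.
    nia. }
  apply Rmult_integral in HD; destruct HD as [HD|HD]; [lra|].
  rewrite HD; ring.
Qed.

Lemma rsum_blocks (f : nat -> R) (g : nat -> R) (N J : nat) :
  let l := (2 * N + 1)%nat in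
  (forall j u, (u < l)%nat -> f (l * j + u)%nat = if (u =? N)%nat then g j else 0) ->
  rsum f (l * J) = rsum g J.
Proof.
intros l H; induction J as [|J IH]; [rewrite Nat.mul_0_r; reflexivity|].
assert (Hin : forall n, (n <= l)%nat -> rsum f (l * J + n) =
  rsum f (l * J) + if (N <? n)%nat then g J else 0).
{ induction n as [|n IHn]; intros Hn.
  - rewrite Nat.add_0_r; simpl; ring.
  - rewrite Nat.add_succ_r; cbn [rsum]; rewrite IHn, H by lia.
    destruct (Nat.ltb_spec N n), (Nat.ltb_spec N (S n)), (Nat.eqb_spec n N);
      try lia; ring. }
replace (l * S J)%nat with (l * J + l)%nat by lia.
rewrite Hin, IH by lia; cbn [rsum].
destruct (Nat.ltb_spec N l); [ring|unfold l in *; lia].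
Qed.

Lemma rsum_swap (f : nat -> nat -> R) (n m : nat) :
  rsum (fun i => rsum (f i) m) n = rsum (fun j => rsum (fun i => f i j) n) m.
Proof.
induction n as [|n IH]; simpl.
- induction m as [|m IHm]; simpl; [auto|rewrite <- IHm; ring].
- now rewrite IH, <- rsum_plus.
Qed.

(** Signed samples of the [M]-th power of cosine at the [l] points [PI * (v + al) / l] with [v] from
    [- N] to [N], where [v] and [- v] are put together. *)
Definition polya_lhs (N M : nat) (al : R) (v : nat) : R :=
  let l := INR (2 * N + 1) in
  match v with
  | O => cos (PI * al / l) ^ M
  | S _ => (-1) ^ v * (cos (PI * (INR v + al) / l) ^ M +
                       cos (PI * (INR v - al) / l) ^ M)
  end.

(** Polya's theta transformation at finite level. The signed samples keep only the frequencies
    [2 i + 1] divisible by [l], that is [i = l * j + N]. As [l] grows with [m / l^2] nearly fixed,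
    the powers of cosine on the left and the binomial coefficients on the right both become
    Gaussian. *)
Lemma polya_finite (N m : nat) (al : R) :
  let l := (2 * N + 1)%nat in
  rsum (polya_lhs N (2 * m + 1) al) (S N) =
  INR l / 4 ^ m * rsum (fun j => odd_binom m (l * j + N) *
    cos ((2 * INR j + 1) * PI * al)) (S m).
Proof.
intros l.
assert (Hl : 0 < INR l) by (apply lt_0_INR; unfold l; lia).
set (M := (2 * m + 1)%nat).
assert (H2M : 2 ^ M = 2 * 4 ^ m).
{ unfold M; rewrite pow_add, pow_mult, pow_1.
  replace (2 ^ 2) with 4 by ring; ring. }
assert (H4 : 0 < 4 ^ m) by (apply pow_lt; lra).
set (I := (l * S m)%nat).
assert (HI : (m < I)%nat) by (unfold I, l; lia).
assert (Hcos : forall x, cos x ^ M =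
  / 4 ^ m * rsum (fun i => odd_binom m i * cos ((2 * INR i + 1) * x)) I).
{ intros x; assert (H := cos_odd_pow x m I HI); fold M in H.
  rewrite Rpow_mult_distr, H2M in H.
  apply Rmult_eq_reg_l with (2 * 4 ^ m); [|lra]; rewrite H; field; lra. }
set (ph := fun i => (2 * INR i + 1) * PI / INR l).
assert (Hx : forall x, cos (PI * x / INR l) ^ M =
  / 4 ^ m * rsum (fun i => odd_binom m i * cos (ph i * x)) I).
{ intros x; rewrite Hcos; f_equal; apply rsum_ext; intros i _; f_equal.
  unfold ph; f_equal; field; lra. }
rewrite rsum_shift.
rewrite (rsum_ext (fun k => polya_lhs N M al (S k)) (fun v => / 4 ^ m *
  rsum (fun i => odd_binom m i * ((-1) ^ S v * (cos (ph i * (INR (S v) + al)) +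
    cos (ph i * (INR (S v) - al))))) I)).
2:{ intros v _; unfold polya_lhs; fold l; rewrite !Hx.
    replace ((-1) ^ S v * (/ 4 ^ m * rsum (fun i => odd_binom m i *
      cos (ph i * (INR (S v) + al))) I + / 4 ^ m * rsum (fun i =>
      odd_binom m i * cos (ph i * (INR (S v) - al))) I)) with
      (/ 4 ^ m * ((-1) ^ S v * (rsum (fun i => odd_binom m i *
      cos (ph i * (INR (S v) + al))) I + rsum (fun i =>
      odd_binom m i * cos (ph i * (INR (S v) - al))) I))) by ring.
    f_equal; rewrite <- rsum_plus, <- rsum_scal; apply rsum_ext; intros; ring. }
rewrite rsum_scal, rsum_swap; unfold polya_lhs at 1; fold l; rewrite Hx.
rewrite <- Rmult_plus_distr_l, <- rsum_plus.
unfold Rdiv; rewrite (Rmult_comm (INR l)), Rmult_assoc; f_equal.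
rewrite <- rsum_scal; unfold I.
apply (rsum_blocks _ _ N); intros j u Hu.
rewrite rsum_scal, <- Rmult_plus_distr_l.
assert (H := signed_period_sum N j u al Hu); cbv zeta in H; fold l in H.
unfold ph; fold l; rewrite H; destruct (u =? N)%nat eqn:E; [|ring].
apply Nat.eqb_eq in E; subst u; ring.
Qed.

Lemma one_minus_ge_exp (y : R) : 0 <= y < 1 -> exp (- (y / (1 - y))) <= 1 - y.
Proof.
intros Hy; assert (H := exp_ineq1_le (y / (1 - y))).
assert (0 <= y / (1 - y)) by (apply Rdiv_le_0_compat; lra).
rewrite exp_Ropp; replace (1 - y) with (/ (1 + y / (1 - y))) at 2 by (field; lra).
apply Rinv_le_contravar; lra.
Qed.

Lemma exp_pow (x : R) (n : nat) : exp x ^ n = exp (INR n * x).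
Proof.
induction n as [|n IH]; [simpl; now rewrite Rmult_0_l, exp_0|].
cbn [pow]; rewrite IH, <- exp_plus, S_INR; f_equal; ring.
Qed.

Lemma is_lim_seq_exp (u : nat -> R) (l : R) :
  is_lim_seq u l -> is_lim_seq (fun n => exp (u n)) (exp l).
Proof.
intros H; apply (is_lim_seq_continuous exp); auto.
apply derivable_continuous_pt, derivable_pt_exp.
Qed.

Lemma one_minus_pow_lim (y : nat -> R) (k : nat -> nat) (t : R) :
  (forall n, 0 <= y n) -> is_lim_seq y 0 ->
  is_lim_seq (fun n => INR (k n) * y n) t ->
  is_lim_seq (fun n => (1 - y n) ^ k n) (exp (- t)).
Proof.
intros Hy0 Hy Hk.
apply (is_lim_seq_le_le_loc (fun n => exp (- (INR (k n) * y n / (1 - y n))))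
  _ (fun n => exp (- (INR (k n) * y n)))).
- apply is_lim_seq_spec in Hy; destruct (Hy (mkposreal (1 / 2) ltac:(lra)))
    as [N HN]; cbn [pos] in HN.
  exists N; intros n Hn; specialize (HN n Hn); apply Rabs_def2 in HN.
  specialize (Hy0 n).
  replace (- (INR (k n) * y n / (1 - y n))) with
    (INR (k n) * - (y n / (1 - y n))) by (field; lra).
  replace (- (INR (k n) * y n)) with (INR (k n) * - y n) by ring.
  rewrite <- !exp_pow; split; apply pow_incr; split;
    auto using Rlt_le, exp_pos; try lra.
  + apply one_minus_ge_exp; lra.
  + assert (H := exp_ineq1_le (- y n)); lra.
- apply is_lim_seq_exp; replace (- t) with (- (t / (1 - 0))) by field.
  apply (is_lim_seq_opp _ (t / (1 - 0))), is_lim_seq_div'; auto; [|lra].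
  apply is_lim_seq_minus'; auto; apply is_lim_seq_const.
- apply is_lim_seq_exp, (is_lim_seq_opp _ t); auto.
Qed.

Lemma one_minus_cos_ge (x : R) : x ^ 2 / 2 * (1 - x ^ 2 / 4) <= 1 - cos x.
Proof.
replace x with (2 * (x / 2)) at 3 by field; rewrite cos_2a_sin.
destruct (sin_mvt (x / 2)) as [c [Hc ->]].
assert (Hs := Rabs_sin_le c).
assert (H1 : sin c ^ 2 <= x ^ 2 / 4).
{ rewrite <- (pow2_abs (sin c)).
  replace (x ^ 2 / 4) with ((x / 2) ^ 2) by field; rewrite <- (pow2_abs (x / 2)).
  apply pow_incr; split; [apply Rabs_pos|lra]. }
assert (H2 := sin2_cos2 c); unfold Rsqr in H2.
replace (1 - (1 - 2 * (x / 2 * cos c) * (x / 2 * cos c))) with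
  (x ^ 2 / 2 * (cos c * cos c)) by field.
apply Rmult_le_compat_l; nra.
Qed.

Lemma one_minus_cos_ge_quarter (x : R) : Rabs x <= PI / 2 -> x ^ 2 / 4 <= 1 - cos x.
Proof.
intros Hx; replace x with (2 * (x / 2)) at 2 by field; rewrite cos_2a_sin.
destruct (sin_mvt (x / 2)) as [c [Hc ->]].
assert (Hc4 : Rabs c <= PI / 4).
{ rewrite (Rabs_div x 2), (Rabs_pos_eq 2) in Hc by lra; lra. }
assert (H : cos (PI / 4) <= cos c).
{ assert (Hpi := PI_RGT_0).
  replace (cos c) with (cos (Rabs c)).
  - apply cos_decr_1; try lra; auto using Rabs_pos.
  - unfold Rabs; destruct (Rcase_abs c); [apply cos_neg|auto]. }
rewrite cos_PI4 in H.
assert (H2 : 1 / 2 <= cos c * cos c).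
{ assert (Hs2 : sqrt 2 * sqrt 2 = 2) by (apply sqrt_sqrt; lra).
  assert (Hs : 0 < sqrt 2) by (apply sqrt_lt_R0; lra).
  assert (H3 : 0 < 1 / sqrt 2) by (apply Rdiv_lt_0_compat; lra).
  replace (1 / 2) with (1 / sqrt 2 * (1 / sqrt 2))
    by (rewrite <- Hs2 at 3; field; lra).
  apply Rmult_le_compat; lra. }
replace (1 - (1 - 2 * (x / 2 * cos c) * (x / 2 * cos c))) with
  (x ^ 2 / 2 * (cos c * cos c)) by field.
nra.
Qed.

(** With [m] close to [s l^2 / PI], the power [cos (PI x / l) ^ (2 m + 1)] tends to
    [exp (- PI s x^2)]. *)
Definition polya_m (s : R) (N : nat) : nat :=
  Z.to_nat (up (s * INR (2 * N + 1) ^ 2 / PI)).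

Lemma polya_m_bounds (s : R) (N : nat) : 0 < s ->
  s * INR (2 * N + 1) ^ 2 / PI < INR (polya_m s N) <=
  s * INR (2 * N + 1) ^ 2 / PI + 1.
Proof.
intros Hs; unfold polya_m; set (x := s * INR (2 * N + 1) ^ 2 / PI).
assert (Hx : 0 <= x).
{ apply Rdiv_le_0_compat; [|apply PI_RGT_0].
  apply Rmult_le_pos; [lra|apply pow2_ge_0]. }
destruct (archimed x) as [H1 H2].
assert (Hz : (0 <= up x)%Z) by (apply le_IZR; lra).
rewrite INR_IZR_INZ, Z2Nat.id by auto; lra.
Qed.

Lemma odd_lim : is_lim_seq (fun N => / INR (2 * N + 1)) 0.
Proof.
apply is_lim_seq_ext with (fun N => / INR (S (2 * N))).
- intros N; do 2 f_equal; lia.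
- apply (is_lim_seq_comp (fun n => / INR (S n)) 0 (fun N => (2 * N)%nat)).
  + apply (is_lim_seq_incr_1 (fun n => / INR n)).
    replace (Finite 0) with (Rbar_inv p_infty) by reflexivity.
    apply is_lim_seq_inv; [apply is_lim_seq_INR|discriminate].
  + intros K; exists K; intros; lia.
Qed.

Lemma polya_m_lim (s : R) : 0 < s ->
  is_lim_seq (fun N => INR (polya_m s N) / INR (2 * N + 1) ^ 2) (s / PI).
Proof.
intros Hs.
assert (Hl : forall N, 0 < INR (2 * N + 1)) by (intros N; apply lt_0_INR; lia).
assert (Hpi := PI_RGT_0).
apply (is_lim_seq_le_le (fun _ => s / PI) _
  (fun N => s / PI + / INR (2 * N + 1) * / INR (2 * N + 1))).
- intros N; specialize (Hl N); destruct (polya_m_bounds s N Hs) as [H1 H2].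
  assert (Hl2 : 0 < INR (2 * N + 1) ^ 2) by now apply pow_lt.
  split; apply Rmult_le_reg_r with (INR (2 * N + 1) ^ 2); auto.
  + replace (INR (polya_m s N) / INR (2 * N + 1) ^ 2 * INR (2 * N + 1) ^ 2) with
      (INR (polya_m s N)) by (field; lra).
    apply Rlt_le; eapply Rle_lt_trans; [|exact H1]; apply Req_le; field; lra.
  + replace (INR (polya_m s N) / INR (2 * N + 1) ^ 2 * INR (2 * N + 1) ^ 2) with
      (INR (polya_m s N)) by (field; lra).
    eapply Rle_trans; [exact H2|]; apply Req_le; field; lra.
- apply is_lim_seq_const.
- replace (Finite (s / PI)) with (Finite (s / PI + 0 * 0)) by (f_equal; ring).
  apply is_lim_seq_plus'; [apply is_lim_seq_const|].
  apply is_lim_seq_mult'; apply odd_lim.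
Qed.

Lemma polya_cos_lim (s x : R) : 0 < s ->
  is_lim_seq (fun N => cos (PI * x / INR (2 * N + 1)) ^ (2 * polya_m s N + 1))
    (exp (- (PI * s * x ^ 2))).
Proof.
intros Hs.
assert (Hl : forall N, 0 < INR (2 * N + 1)) by (intros N; apply lt_0_INR; lia).
assert (Hpi := PI_RGT_0).
set (h := fun N => PI * x / INR (2 * N + 1)).
assert (Hh : is_lim_seq h 0).
{ replace (Finite 0) with (Finite (PI * x * 0)) by (f_equal; ring).
  apply is_lim_seq_mult'; [apply is_lim_seq_const|apply odd_lim]. }
assert (Hh2 : is_lim_seq (fun N => h N ^ 2) 0).
{ apply is_lim_seq_ext with (fun N => h N * h N); [intros; ring|].
  replace (Finite 0) with (Finite (0 * 0)) by (f_equal; ring).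
  now apply is_lim_seq_mult'. }
assert (HM : is_lim_seq (fun N => INR (2 * polya_m s N + 1) * (h N ^ 2 / 2))
  (PI * s * x ^ 2)).
{ apply is_lim_seq_ext with (fun N => (PI * x) ^ 2 *
    (INR (polya_m s N) / INR (2 * N + 1) ^ 2) + h N ^ 2 * / 2).
  - intros N; specialize (Hl N); unfold h.
    rewrite (plus_INR (2 * polya_m s N)), (mult_INR 2 (polya_m s N)).
    simpl (INR 2); simpl (INR 1); field; lra.
  - replace (PI * s * x ^ 2) with ((PI * x) ^ 2 * (s / PI) + 0 * / 2)
      by (field; lra).
    apply is_lim_seq_plus'.
    + apply is_lim_seq_mult'; [apply is_lim_seq_const|now apply polya_m_lim].
    + apply is_lim_seq_mult'; [auto|apply is_lim_seq_const]. }
apply is_lim_seq_ext with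
  (fun N => (1 - (1 - cos (h N))) ^ (2 * polya_m s N + 1)).
{ intros N; f_equal; unfold h; ring. }
apply one_minus_pow_lim.
- intros N; assert (H := COS_bound (h N)); lra.
- apply (is_lim_seq_le_le (fun _ => 0) _ (fun N => h N ^ 2 * / 2)).
  + intros N; assert (H := one_minus_cos_le (h N)); lra.
  + apply is_lim_seq_const.
  + replace (Finite 0) with (Finite (0 * / 2)) by (f_equal; ring).
    apply is_lim_seq_mult'; [auto|apply is_lim_seq_const].
- apply (is_lim_seq_le_le
    (fun N => INR (2 * polya_m s N + 1) * (h N ^ 2 / 2) * (1 - h N ^ 2 * / 4)) _
    (fun N => INR (2 * polya_m s N + 1) * (h N ^ 2 / 2))).
  + intros N; assert (H := one_minus_cos_le (h N)).
    assert (H' := one_minus_cos_ge (h N)).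
    assert (H0 := pos_INR (2 * polya_m s N + 1)).
    split; [rewrite Rmult_assoc|]; apply Rmult_le_compat_l; lra.
  + replace (PI * s * x ^ 2) with (PI * s * x ^ 2 * (1 - 0 * / 4)) by ring.
    apply is_lim_seq_mult'; auto.
    apply is_lim_seq_minus'; [apply is_lim_seq_const|].
    apply is_lim_seq_mult'; [auto|apply is_lim_seq_const].
  + auto.
Qed.

(** The hypothesis on [x] keeps the angle [h] between [- PI / 2] and [PI / 2], where [1 - cos h] is
    at least [h^2 / 4]. This halves the exponent of the limit but gives a bound independent of
    [N]. *)
Lemma polya_cos_bound (s x : R) (N : nat) : 0 < s ->
  Rabs x <= INR N + 1 / 2 ->
  0 <= cos (PI * x / INR (2 * N + 1)) ^ (2 * polya_m s N + 1) <=
  exp (- (PI * s * x ^ 2 / 2)).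
Proof.
intros Hs Hx.
assert (Hl : INR (2 * N + 1) = 2 * INR N + 1)
  by (rewrite plus_INR, mult_INR; simpl; ring).
assert (HN := pos_INR N); assert (Hpi := PI_RGT_0).
set (h := PI * x / INR (2 * N + 1)).
assert (Hh : Rabs h <= PI / 2).
{ unfold h; rewrite Rabs_div, Rabs_mult, (Rabs_pos_eq PI), (Rabs_pos_eq (INR _))
    by lra.
  apply Rmult_le_reg_r with (INR (2 * N + 1)); [lra|].
  unfold Rdiv at 1; rewrite Rmult_assoc, Rinv_l, Rmult_1_r by lra.
  rewrite Hl; nra. }
assert (H1 := one_minus_cos_ge_quarter h Hh).
assert (H0 : 0 <= cos h).
{ apply Rabs_le_between in Hh; apply cos_ge_0; lra. }
split; [now apply pow_le|].
apply Rle_trans with (exp (- (h ^ 2 / 4)) ^ (2 * polya_m s N + 1)).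
- apply pow_incr; split; auto.
  assert (H := exp_ineq1_le (- (h ^ 2 / 4))); lra.
- rewrite exp_pow; apply exp_le.
  destruct (polya_m_bounds s N Hs) as [Hm _].
  rewrite plus_INR, mult_INR; simpl (INR 2); simpl (INR 1).
  assert (Hh2 : h ^ 2 = PI ^ 2 * x ^ 2 / INR (2 * N + 1) ^ 2)
    by (unfold h; field; lra).
  assert (H2 : PI * s * x ^ 2 / 2 =
    2 * (s * INR (2 * N + 1) ^ 2 / PI) * (h ^ 2 / 4))
    by (rewrite Hh2; field; lra).
  rewrite H2; assert (0 <= h ^ 2 / 4) by (assert (H := pow2_ge_0 h); lra).
  nra.
Qed.

(** The ratio is the product of the [i] factors [1 - (i + 1) / (m + 2 + n)] with [n < i], each of
    which lies between the first and the last. *)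
Lemma odd_binom_pow_bounds (m i : nat) : (i <= m)%nat ->
  (1 - INR (i + 1) / INR (m + 2)) ^ i <= odd_binom m i / odd_binom m 0 <=
  (1 - INR (i + 1) / INR (m + 1 + i)) ^ i.
Proof.
intros Hi.
assert (Hprod : forall n, (n <= i)%nat ->
  (1 - INR (i + 1) / INR (m + 2)) ^ n <=
  INR (fact (m + 1)) * INR (fact (m - i + n)) /
    (INR (fact (m - i)) * INR (fact (m + 1 + n))) <=
  (1 - INR (i + 1) / INR (m + 1 + i)) ^ n).
{ induction n as [|n IH]; intros Hn.
  - rewrite !Nat.add_0_r; simpl.
    assert (H1 := INR_fact_neq_0 (m + 1)); assert (H2 := INR_fact_neq_0 (m - i)).
    replace (INR (fact (m + 1)) * INR (fact (m - i)) /
      (INR (fact (m - i)) * INR (fact (m + 1)))) with 1 by (field; auto); lra.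
  - specialize (IH ltac:(lia)).
    rewrite (Nat.add_succ_r (m - i) n), (Nat.add_succ_r (m + 1) n).
    rewrite (INR_fact_S (m - i + n)), (INR_fact_S (m + 1 + n)).
    assert (Hf := INR_fact_lt_0).
    assert (H1 := Hf (m - i)%nat); assert (H2 := Hf (m + 1 + n)%nat).
    assert (Hd : 0 < INR (S (m + 1 + n))) by (apply lt_0_INR; lia).
    set (P := INR (fact (m + 1)) * INR (fact (m - i + n)) /
      (INR (fact (m - i)) * INR (fact (m + 1 + n)))) in *.
    replace (INR (fact (m + 1)) * (INR (S (m - i + n)) * INR (fact (m - i + n))) /
      (INR (fact (m - i)) * (INR (S (m + 1 + n)) * INR (fact (m + 1 + n))))) with
      ((1 - INR (i + 1) / INR (S (m + 1 + n))) * P).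
    2:{ unfold P; replace (INR (S (m - i + n))) with
          (INR (S (m + 1 + n)) - INR (i + 1))
          by (rewrite <- minus_INR by lia; f_equal; lia).
        field; lra. }
    assert (Hi1 : 0 < INR (i + 1)) by (apply lt_0_INR; lia).
    assert (Hm2 : 0 < INR (m + 2)) by (apply lt_0_INR; lia).
    assert (Hmi : 0 < INR (m + 1 + i)) by (apply lt_0_INR; lia).
    assert (L1 : INR (i + 1) / INR (S (m + 1 + n)) <= INR (i + 1) / INR (m + 2)).
    { apply Rmult_le_compat_l; [lra|]; apply Rinv_le_contravar; auto.
      apply le_INR; lia. }
    assert (L2 : INR (i + 1) / INR (m + 1 + i) <= INR (i + 1) / INR (S (m + 1 + n))).
    { apply Rmult_le_compat_l; [lra|]; apply Rinv_le_contravar; auto.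
      apply le_INR; lia. }
    assert (L3 : INR (i + 1) / INR (m + 2) <= 1).
    { apply Rmult_le_reg_r with (INR (m + 2)); auto.
      unfold Rdiv; rewrite Rmult_assoc, Rinv_l, Rmult_1_r, Rmult_1_l by lra.
      apply le_INR; lia. }
    assert (H3 : 0 <= (1 - INR (i + 1) / INR (m + 2)) ^ n) by (apply pow_le; lra).
    rewrite <- !tech_pow_Rmult; split; apply Rmult_le_compat; lra. }
specialize (Hprod i (le_n i)).
replace (odd_binom m i / odd_binom m 0) with
  (INR (fact (m + 1)) * INR (fact (m - i + i)) /
    (INR (fact (m - i)) * INR (fact (m + 1 + i)))); auto.
rewrite !odd_binom_le by lia.
replace (m - i + i)%nat with m by lia.
rewrite Nat.sub_0_r, Nat.add_0_r.
field; repeat split; apply INR_fact_neq_0.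
Qed.

Lemma odd_binom_bound (m i : nat) :
  0 <= odd_binom m i / odd_binom m 0 <=
  exp (- (INR i * INR (i + 1) / INR (2 * m + 1))).
Proof.
assert (H0 := odd_binom_pos m 0 ltac:(lia)).
destruct (le_lt_dec i m) as [Hi|Hi].
- split.
  { apply Rdiv_le_0_compat; auto; apply Rlt_le, odd_binom_pos, Hi. }
  destruct (odd_binom_pow_bounds m i Hi) as [_ H].
  eapply Rle_trans; [exact H|].
  assert (Hi1 : 0 < INR (i + 1)) by (apply lt_0_INR; lia).
  assert (Hmi : 0 < INR (m + 1 + i)) by (apply lt_0_INR; lia).
  assert (Hm : 0 < INR (2 * m + 1)) by (apply lt_0_INR; lia).
  assert (L3 : INR (i + 1) / INR (m + 1 + i) <= 1).
  { apply Rmult_le_reg_r with (INR (m + 1 + i)); auto.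
    unfold Rdiv; rewrite Rmult_assoc, Rinv_l, Rmult_1_r, Rmult_1_l by lra.
    apply le_INR; lia. }
  apply Rle_trans with (exp (- (INR (i + 1) / INR (m + 1 + i))) ^ i).
  + apply pow_incr; split; [lra|].
    assert (He := exp_ineq1_le (- (INR (i + 1) / INR (m + 1 + i)))); lra.
  + rewrite exp_pow; apply exp_le.
    rewrite Ropp_mult_distr_r_reverse; apply Ropp_le_contravar.
    unfold Rdiv; rewrite Rmult_assoc; apply Rmult_le_compat_l; [apply pos_INR|].
    apply Rmult_le_compat_l; [lra|]; apply Rinv_le_contravar; auto.
    apply le_INR; lia.
- rewrite odd_binom_gt by auto; unfold Rdiv; rewrite Rmult_0_l.
  split; [lra|apply Rlt_le, exp_pos].
Qed.

(** A local central limit theorem: with [i / l] near [j + 1/2] and [m / l^2] near [s / PI], both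
    bounds of [odd_binom_pow_bounds] behave as [exp (- i^2 / m)]. *)
Lemma odd_binom_lim (s : R) (j : nat) : 0 < s ->
  is_lim_seq (fun N => odd_binom (polya_m s N) ((2 * N + 1) * j + N) /
    odd_binom (polya_m s N) 0) (exp (- (PI * (INR j + 1 / 2) ^ 2 / s))).
Proof.
intros Hs; assert (Hpi := PI_RGT_0).
assert (Hl : forall N, 0 < INR (2 * N + 1)) by (intros N; apply lt_0_INR; lia).
set (r := fun N => / INR (2 * N + 1)).
set (mu := fun N => INR (polya_m s N) / INR (2 * N + 1) ^ 2).
set (i := fun N => ((2 * N + 1) * j + N)%nat).
set (a := fun N => INR j + 1 / 2 - r N * / 2).
assert (Hr : is_lim_seq r 0) by exact odd_lim.
assert (Hmu : is_lim_seq mu (s / PI)) by now apply polya_m_lim.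
assert (Ha : is_lim_seq a (INR j + 1 / 2)).
{ replace (INR j + 1 / 2) with (INR j + 1 / 2 - 0 * / 2) by ring.
  apply is_lim_seq_minus'; [apply is_lim_seq_const|].
  apply is_lim_seq_mult'; [auto|apply is_lim_seq_const]. }
assert (Har : is_lim_seq (fun N => a N * r N) 0).
{ replace (Finite 0) with (Finite ((INR j + 1 / 2) * 0)) by (f_equal; ring).
  now apply is_lim_seq_mult'. }
assert (Hr2 : is_lim_seq (fun N => r N * r N) 0).
{ replace (Finite 0) with (Finite (0 * 0)) by (f_equal; ring).
  now apply is_lim_seq_mult'. }
assert (Hsp : 0 < s / PI) by (apply Rdiv_lt_0_compat; lra).
assert (Hi : forall N, INR (i N) = a N * INR (2 * N + 1)).
{ intros N; specialize (Hl N); unfold i, a, r.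
  rewrite (plus_INR (_ * j)), mult_INR.
  replace (INR N) with ((INR (2 * N + 1) - 1) / 2)
    by (rewrite plus_INR, mult_INR; simpl (INR 2); simpl (INR 1); field).
  field; lra. }
assert (Hm : forall N, INR (polya_m s N) = mu N * INR (2 * N + 1) ^ 2).
{ intros N; specialize (Hl N); unfold mu; field; lra. }
assert (Hrl : forall N, r N * INR (2 * N + 1) = 1).
{ intros N; specialize (Hl N); unfold r; field; lra. }
(* Both sides of the squeeze have this shape: [d] is what the summand [2], respectively [1 + i],
   adds to the denominator after division by [l^2]. *)
assert (Hgen : forall d : nat -> R, is_lim_seq d 0 ->
  (forall N, 0 < (mu N + d N)) ->
  is_lim_seq (fun N => (1 - (a N * r N + r N * r N) / (mu N + d N)) ^ i N)
   (exp (- (PI * (INR j + 1 / 2) ^ 2 / s)))).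
{ intros d Hd Hpos.
  assert (Hden : is_lim_seq (fun N => mu N + d N) (s / PI)).
  { replace (s / PI) with (s / PI + 0) by ring; now apply is_lim_seq_plus'. }
  apply one_minus_pow_lim.
  - intros N; apply Rdiv_le_0_compat; auto.
    assert (H0 : 0 <= a N).
    { apply Rmult_le_reg_r with (INR (2 * N + 1)); auto.
      rewrite <- Hi, Rmult_0_l; apply pos_INR. }
    assert (H1 : 0 < r N) by apply Rinv_0_lt_compat, Hl; nra.
  - replace (Finite 0) with (Finite ((0 + 0) / (s / PI))) by (f_equal; field; lra).
    apply is_lim_seq_div'; [now apply is_lim_seq_plus'|auto|lra].
  - apply is_lim_seq_ext with
      (fun N => (a N * a N + a N * r N) / (mu N + d N)).
    + intros N; rewrite Hi; specialize (Hpos N); specialize (Hrl N).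
      replace (a N * INR (2 * N + 1) * ((a N * r N + r N * r N) / (mu N + d N)))
        with ((a N * a N + a N * r N) * (r N * INR (2 * N + 1)) / (mu N + d N))
        by (field; lra).
      rewrite Hrl; field; lra.
    + replace (PI * (INR j + 1 / 2) ^ 2 / s) with
        (((INR j + 1 / 2) * (INR j + 1 / 2) + 0) / (s / PI)) by (field; lra).
      apply is_lim_seq_div'; [|auto|lra].
      apply is_lim_seq_plus'; auto; now apply is_lim_seq_mult'. }
assert (Hmu0 : forall N, 0 < mu N).
{ intros N; unfold mu; apply Rdiv_lt_0_compat; [|apply pow_lt, Hl].
  destruct (polya_m_bounds s N Hs) as [H _].
  eapply Rle_lt_trans; [|exact H].
  apply Rdiv_le_0_compat; auto.
  apply Rmult_le_pos; [lra|apply pow2_ge_0]. }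
assert (Hr0 : forall N, 0 < r N) by (intros N; apply Rinv_0_lt_compat, Hl).
assert (Ha0 : forall N, 0 <= a N).
{ intros N; apply Rmult_le_reg_r with (INR (2 * N + 1)); auto.
  rewrite <- Hi, Rmult_0_l; apply pos_INR. }
apply (is_lim_seq_le_le_loc
  (fun N => (1 - (a N * r N + r N * r N) / (mu N + 2 * (r N * r N))) ^ i N) _
  (fun N => (1 - (a N * r N + r N * r N) / (mu N + (r N * r N + a N * r N))) ^ i N)).
- assert (Hev : is_lim_seq (fun N => mu N - a N * r N) (s / PI - 0))
    by now apply is_lim_seq_minus'.
  apply is_lim_seq_spec in Hev.
  destruct (Hev (mkposreal (s / PI) Hsp)) as [N0 HN0]; cbn [pos] in HN0.
  exists N0; intros N HN; specialize (HN0 N HN); apply Rabs_def2 in HN0.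
  assert (Him : (i N <= polya_m s N)%nat).
  { apply INR_le; rewrite Hi, Hm; specialize (Hl N); specialize (Hrl N).
    assert (0 < mu N - a N * r N) by lra.
    replace (a N * INR (2 * N + 1)) with
      (a N * r N * INR (2 * N + 1) ^ 2 * 1) by
      (rewrite <- Hrl at 1; unfold r; field; lra).
    assert (0 < INR (2 * N + 1) ^ 2) by now apply pow_lt.
    nra. }
  assert (H := odd_binom_pow_bounds _ _ Him); fold (i N).
  assert (E1 : INR (i N + 1) / INR (polya_m s N + 2) =
    (a N * r N + r N * r N) / (mu N + 2 * (r N * r N))).
  { rewrite !plus_INR, Hi, Hm; simpl (INR 1); simpl (INR 2).
    specialize (Hmu0 N); specialize (Hr0 N); specialize (Hl N).
    assert (E : r N = / INR (2 * N + 1)) by reflexivity; rewrite E.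
    generalize dependent (INR (2 * N + 1)); intros x; intros.
    assert (0 < mu N * x ^ 2) by (apply Rmult_lt_0_compat; [auto|apply pow_lt; auto]).
    field; repeat split; nra. }
  assert (E2 : INR (i N + 1) / INR (polya_m s N + 1 + i N) =
    (a N * r N + r N * r N) / (mu N + (r N * r N + a N * r N))).
  { rewrite !plus_INR, Hi, Hm; simpl (INR 1).
    specialize (Hmu0 N); specialize (Hr0 N); specialize (Hl N); specialize (Ha0 N).
    assert (E : r N = / INR (2 * N + 1)) by reflexivity; rewrite E.
    generalize dependent (INR (2 * N + 1)); intros x; intros.
    assert (0 < mu N * x ^ 2) by (apply Rmult_lt_0_compat; [auto|apply pow_lt; auto]).
    assert (0 <= a N * x) by nra.
    field; repeat split; nra. }
  rewrite <- E1, <- E2; exact H.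
- apply Hgen.
  + replace (Finite 0) with (Finite (2 * 0)) by (f_equal; ring).
    apply is_lim_seq_mult'; [apply is_lim_seq_const|auto].
  + intros N; specialize (Hmu0 N); specialize (Hr0 N); nra.
- apply Hgen.
  + replace (Finite 0) with (Finite (0 + 0)) by (f_equal; ring).
    now apply is_lim_seq_plus'.
  + intros N; specialize (Hmu0 N); specialize (Hr0 N); specialize (Ha0 N); nra.
Qed.

(** The exponent [i (i + 1) / (2 m + 1)] is at least [j / (2 s / PI + 3)], since
    [i (i + 1) >= j l^2] and [2 m + 1 <= 2 s l^2 / PI + 3] with [l >= 1]. *)
Lemma odd_binom_dom (s : R) (N j : nat) : 0 < s ->
  0 <= odd_binom (polya_m s N) ((2 * N + 1) * j + N) / odd_binom (polya_m s N) 0 <=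
  exp (- / (2 * s / PI + 3)) ^ j.
Proof.
intros Hs; assert (Hpi := PI_RGT_0).
destruct (odd_binom_bound (polya_m s N) ((2 * N + 1) * j + N)) as [H0 H1].
split; auto; eapply Rle_trans; [exact H1|]; rewrite exp_pow; apply exp_le.
rewrite Ropp_mult_distr_r_reverse; apply Ropp_le_contravar.
destruct (polya_m_bounds s N Hs) as [_ Hm].
assert (Hl : INR (2 * N + 1) = 2 * INR N + 1)
  by (rewrite plus_INR, mult_INR; simpl; ring).
assert (HN := pos_INR N); assert (Hj := pos_INR j).
assert (EI : INR ((2 * N + 1) * j + N) = (2 * INR N + 1) * INR j + INR N)
  by (rewrite plus_INR, mult_INR, Hl; ring).
assert (EM : INR (2 * polya_m s N + 1) = 2 * INR (polya_m s N) + 1)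
  by (rewrite plus_INR, mult_INR; simpl; ring).
rewrite (plus_INR ((2 * N + 1) * j + N) 1), EI, EM; simpl (INR 1); rewrite Hl in Hm; clear EI EM H0 H1.
assert (Hm0 := pos_INR (polya_m s N)).
set (x := 2 * INR N + 1) in *; set (m := INR (polya_m s N)) in *.
assert (Hc : 0 < 2 * s / PI + 3).
{ assert (0 < 2 * s / PI) by (apply Rdiv_lt_0_compat; lra); lra. }
apply Rmult_le_reg_r with ((2 * m + 1) * (2 * s / PI + 3)); [nra|].
replace ((x * INR j + INR N) * (x * INR j + INR N + 1) / (2 * m + 1) *
  ((2 * m + 1) * (2 * s / PI + 3))) with
  ((x * INR j + INR N) * (x * INR j + INR N + 1) * (2 * s / PI + 3))
  by (field; lra).
replace (INR j * / (2 * s / PI + 3) * ((2 * m + 1) * (2 * s / PI + 3))) with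
  (INR j * (2 * m + 1)).
2:{ assert (2 * s + 3 * PI <> 0) by lra.
    field; split; lra. }
assert (Hx : 1 <= x) by (unfold x; lra).
assert (H2 : 2 * m + 1 <= x ^ 2 * (2 * s / PI + 3)).
{ replace (s * x ^ 2 / PI) with (x ^ 2 * (s / PI)) in Hm by (field; lra).
  replace (2 * s / PI) with (2 * (s / PI)) by (field; lra); nra. }
assert (H3 : INR j * x ^ 2 <= (x * INR j + INR N) * (x * INR j + INR N + 1)).
{ replace (INR N) with ((x - 1) / 2) by (unfold x; field).
  replace ((x * INR j + (x - 1) / 2) * (x * INR j + (x - 1) / 2 + 1)) with
    (x ^ 2 * (INR j * INR j + INR j) + (x ^ 2 - 1) / 4) by field.
  assert (0 <= x ^ 2 * (INR j * INR j)) by (apply Rmult_le_pos; nra).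
  nra. }
apply Rle_trans with (INR j * (x ^ 2 * (2 * s / PI + 3))).
- apply Rmult_le_compat_l; auto.
- rewrite <- Rmult_assoc; apply Rmult_le_compat_r; lra.
Qed.

(** The bilateral sum of [(-1) ^ k exp (- PI s (k + al)^2)], with [k] and [- k - 1] put together as
    in [theta_term]; [centered_term] pairs [k] with [- k] as in [polya_lhs]. *)
Definition poisson_lhs (s al : R) (k : nat) : R :=
  (-1) ^ k * (exp (- (PI * s * (INR k + al) ^ 2)) -
              exp (- (PI * s * (INR k + 1 - al) ^ 2))).

Definition poisson_rhs (s al : R) (j : nat) : R :=
  exp (- (PI * (INR j + 1 / 2) ^ 2 / s)) * cos ((2 * INR j + 1) * PI * al).

Definition centered_term (s al : R) (v : nat) : R :=
  match v with
  | O => exp (- (PI * s * al ^ 2))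
  | S _ => (-1) ^ v * (exp (- (PI * s * (INR v + al) ^ 2)) +
                       exp (- (PI * s * (INR v - al) ^ 2)))
  end.

Lemma gauss_bound (s x : R) (v : nat) : 0 < s -> INR v - 1 / 2 <= Rabs x ->
  exp (- (PI * s * x ^ 2 / 2)) <= exp (- (PI * s / 8)) ^ v.
Proof.
intros Hs Hx; rewrite exp_pow; apply exp_le.
assert (Hpi := PI_RGT_0); assert (0 < PI * s) by nra.
rewrite <- (pow2_abs x); assert (Hx0 := Rabs_pos x).
assert (INR v / 4 <= Rabs x ^ 2); [|nra].
destruct v as [|v]; [simpl; nra|].
assert (1 <= INR (S v)) by (rewrite S_INR; assert (H0 := pos_INR v); lra).
nra.
Qed.

Lemma exp_neg_ratio (x : R) : 0 < x -> 0 <= exp (- x) < 1.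
Proof.
intros H; split; [apply Rlt_le, exp_pos|].
rewrite <- exp_0; apply exp_increasing; lra.
Qed.

Lemma polya_lhs_lim (s al : R) : 0 < s -> Rabs al <= 1 / 2 ->
  is_lim_seq (fun N => rsum (polya_lhs N (2 * polya_m s N + 1) al) (S N))
    (rser (centered_term s al)).
Proof.
intros Hs Hal; assert (Hpi := PI_RGT_0).
(* Terms beyond [N] are set to 0, because [polya_cos_bound] covers only angles up to [PI / 2]. *)
set (f := fun N v => if (v <=? N)%nat
  then polya_lhs N (2 * polya_m s N + 1) al v else 0).
apply is_lim_seq_ext with (fun N => rsum (f N) (S N)).
{ intros N; apply rsum_ext; intros k Hk; unfold f.
  now rewrite (proj2 (Nat.leb_le k N)) by lia. }
apply tannery with 2 (exp (- (PI * s / 8))).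
- apply exp_neg_ratio; nra.
- intros v; apply is_lim_seq_ext_loc with
    (fun N => polya_lhs N (2 * polya_m s N + 1) al v).
  { exists v; intros N HN; unfold f; now rewrite (proj2 (Nat.leb_le v N)). }
  destruct v as [|v]; unfold polya_lhs, centered_term.
  + now apply polya_cos_lim.
  + apply is_lim_seq_mult'; [apply is_lim_seq_const|].
    apply is_lim_seq_plus'; now apply polya_cos_lim.
- intros N v; unfold f; destruct (Nat.leb_spec v N) as [Hv|Hv].
  + apply Rabs_le_between in Hal.
    assert (HvN := le_INR v N Hv); assert (Hv0 := pos_INR v).
    assert (B1 : 0 <= cos (PI * (INR v + al) / INR (2 * N + 1)) ^
      (2 * polya_m s N + 1) <= exp (- (PI * s / 8)) ^ v).
    { destruct (polya_cos_bound s (INR v + al) N Hs) as [H1 H2].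
      - apply Rabs_le; lra.
      - split; auto; eapply Rle_trans; [exact H2|].
        apply gauss_bound; auto.
        eapply Rle_trans; [|apply Rle_abs]; lra. }
    assert (B2 : 0 <= cos (PI * (INR v - al) / INR (2 * N + 1)) ^
      (2 * polya_m s N + 1) <= exp (- (PI * s / 8)) ^ v).
    { destruct (polya_cos_bound s (INR v - al) N Hs) as [H1 H2].
      - apply Rabs_le; lra.
      - split; auto; eapply Rle_trans; [exact H2|].
        apply gauss_bound; auto.
        eapply Rle_trans; [|apply Rle_abs]; lra. }
    destruct v as [|v]; unfold polya_lhs.
    * simpl (INR 0) in B1; rewrite Rplus_0_l in B1.
      rewrite Rabs_pos_eq; lra.
    * rewrite Rabs_mult, Rabs_pow_m1, Rmult_1_l, Rabs_pos_eq; lra.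
  + rewrite Rabs_R0; assert (H := exp_pos (- (PI * s / 8))).
    assert (0 < exp (- (PI * s / 8)) ^ v) by now apply pow_lt.
    lra.
- intros K; exists K; intros; lia.
Qed.

Lemma polya_rhs_lim (s al : R) : 0 < s ->
  is_lim_seq (fun N => rsum (fun j =>
    odd_binom (polya_m s N) ((2 * N + 1) * j + N) / odd_binom (polya_m s N) 0 *
    cos ((2 * INR j + 1) * PI * al)) (S (polya_m s N)))
    (rser (poisson_rhs s al)).
Proof.
intros Hs; assert (Hpi := PI_RGT_0).
apply tannery with (f := fun N j => odd_binom (polya_m s N)
  ((2 * N + 1) * j + N) / odd_binom (polya_m s N) 0 *
  cos ((2 * INR j + 1) * PI * al)) (M := fun N => S (polya_m s N))
  (A := 1) (rho := exp (- / (2 * s / PI + 3))).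
- apply exp_neg_ratio, Rinv_0_lt_compat.
  assert (0 < 2 * s / PI) by (apply Rdiv_lt_0_compat; lra); lra.
- intros j; apply is_lim_seq_mult'; [now apply odd_binom_lim|].
  apply is_lim_seq_const.
- intros N j; rewrite Rabs_mult.
  destruct (odd_binom_dom s N j Hs) as [H0 H1].
  rewrite (Rabs_pos_eq (_ / _)) by auto.
  assert (H2 : Rabs (cos ((2 * INR j + 1) * PI * al)) <= 1)
    by (apply Rabs_le, COS_bound).
  rewrite Rmult_1_l, <- (Rmult_1_r (_ ^ j)).
  apply Rmult_le_compat; auto using Rabs_pos.
- intros K; destruct (INR_unbounded (INR K * PI / s)) as [N0 HN0].
  exists N0; intros N HN.
  destruct (polya_m_bounds s N Hs) as [H _].
  assert (INR K < INR (polya_m s N)); [|apply INR_lt in H0; lia].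
  eapply Rle_lt_trans; [|exact H].
  assert (HNr := le_INR _ _ HN).
  assert (Hl : INR (2 * N + 1) = 2 * INR N + 1)
    by (rewrite plus_INR, mult_INR; simpl; ring).
  assert (HN1 := pos_INR N0).
  assert (HK : INR K * PI / s * s = INR K * PI) by (field; lra).
  apply Rmult_le_reg_r with PI; auto.
  replace (s * INR (2 * N + 1) ^ 2 / PI * PI) with (s * INR (2 * N + 1) ^ 2)
    by (field; lra).
  rewrite Hl, <- HK, Rmult_comm; apply Rmult_le_compat_l; [lra|]; nra.
Qed.

Lemma poisson_lhs_lim (s al : R) : 0 < s -> Rabs al <= 1 / 2 ->
  is_lim_seq (rsum (poisson_lhs s al)) (rser (centered_term s al)).
Proof.
intros Hs Hal; assert (Hpi := PI_RGT_0); apply Rabs_le_between in Hal.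
assert (Hrho := exp_neg_ratio (PI * s / 8) ltac:(nra)).
set (rho := exp (- (PI * s / 8))) in *.
assert (Hg : forall v x, INR v - 1 / 2 <= Rabs x ->
  0 <= exp (- (PI * s * x ^ 2)) <= rho ^ v).
{ intros v x Hx; split; [apply Rlt_le, exp_pos|].
  eapply Rle_trans; [|apply (gauss_bound s x v Hs Hx)].
  apply exp_le; assert (0 <= PI * s * x ^ 2)
    by (apply Rmult_le_pos; [nra|apply pow2_ge_0]); lra. }
assert (Hc : is_lim_seq (rsum (centered_term s al)) (rser (centered_term s al))).
{ apply (rser_lim _ 2 rho); auto; intros v.
  assert (B1 := Hg v (INR v + al) ltac:(eapply Rle_trans; [|apply Rle_abs]; lra)).
  assert (B2 := Hg v (INR v - al) ltac:(eapply Rle_trans; [|apply Rle_abs]; lra)).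
  destruct v as [|v]; unfold centered_term.
  - simpl (INR 0) in B1; rewrite Rplus_0_l in B1; rewrite Rabs_pos_eq; lra.
  - rewrite Rabs_mult, Rabs_pow_m1, Rmult_1_l, Rabs_pos_eq; lra. }
apply is_lim_seq_incr_1.
(* The partial sums of the two pairings differ by one unpaired term at the upper end, which tends to
   0. *)
apply is_lim_seq_ext with (fun K => rsum (centered_term s al) (S K) +
  (-1) ^ S K * exp (- (PI * s * (INR (S K) - al) ^ 2))).
- intros K; induction K as [|K IH].
  + cbn [rsum]; unfold centered_term, poisson_lhs; simpl INR.
    rewrite !Rplus_0_l; simpl ((-1) ^ _); ring.
  + change (rsum (poisson_lhs s al) (S (S K))) with
      (rsum (poisson_lhs s al) (S K) + poisson_lhs s al (S K)).
    change (rsum (centered_term s al) (S (S K))) with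
      (rsum (centered_term s al) (S K) + centered_term s al (S K)).
    rewrite <- IH; unfold centered_term at 2, poisson_lhs.
    rewrite (S_INR (S K)); simpl ((-1) ^ S (S K)); simpl ((-1) ^ S K); ring.
- rewrite <- (Rplus_0_r (rser _)); apply is_lim_seq_plus'.
  + apply (is_lim_seq_incr_1 (rsum (centered_term s al))), Hc.
  + apply is_lim_seq_abs_0, (is_lim_seq_le_le (fun _ => 0) _ (fun K => rho * rho ^ K)).
    * intros K; split; [apply Rabs_pos|].
      assert (B2 := Hg (S K) (INR (S K) - al)
        ltac:(eapply Rle_trans; [|apply Rle_abs]; lra)).
      rewrite Rabs_mult, Rabs_pow_m1, Rmult_1_l, Rabs_pos_eq; simpl in *; lra.
    * apply is_lim_seq_const.
    * replace (Finite 0) with (Finite (rho * 0)) by (f_equal; ring).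
      apply is_lim_seq_mult'; [apply is_lim_seq_const|].
      apply is_lim_seq_geom; rewrite Rabs_pos_eq; lra.
Qed.

Lemma odd_binom_0_S (m : nat) : odd_binom (S m) 0 / 4 ^ S m =
  odd_binom m 0 / 4 ^ m * ((2 * INR m + 3) / (2 * (INR m + 2))).
Proof.
rewrite !odd_binom_le by lia.
rewrite !Nat.sub_0_r, !Nat.add_0_r.
replace (2 * S m + 1)%nat with (S (S (2 * m + 1))) by lia.
replace (S m + 1)%nat with (S (m + 1)) by lia.
rewrite !INR_fact_S, !S_INR, !plus_INR, !mult_INR; simpl (INR 2); simpl (INR 1).
assert (H := pos_INR m); assert (H4 : 4 ^ m <> 0) by (apply pow_nonzero; lra).
simpl pow; field; repeat split; try apply INR_fact_neq_0; auto; lra.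
Qed.

(** Only the existence of the limit is proved, from a bounded increasing sequence. Its value, known
    from Wallis's product, is never computed: the constant is recovered in [poisson_signed] from a
    self-dual case. *)
Lemma central_binom_lim :
  exists W : R, is_lim_seq (fun m => sqrt (INR m + 1) * (odd_binom m 0 / 4 ^ m)) W.
Proof.
set (b := fun m => odd_binom m 0 / 4 ^ m).
assert (Hb : forall m, 0 < b m).
{ intros m; apply Rdiv_lt_0_compat; [apply odd_binom_pos; lia|apply pow_lt; lra]. }
assert (HbS : forall m, b (S m) = b m * ((2 * INR m + 3) / (2 * (INR m + 2))))
  by exact odd_binom_0_S.
set (u := fun m => (INR m + 1) * b m ^ 2).
assert (Hu : ex_finite_lim_seq u).
{ apply (ex_finite_lim_seq_incr u (3 / 2)).
  - intros m; unfold u; rewrite HbS, S_INR; assert (H := pos_INR m).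
    replace ((INR m + 1 + 1) * (b m * ((2 * INR m + 3) / (2 * (INR m + 2)))) ^ 2)
      with (b m ^ 2 * ((2 * INR m + 3) ^ 2 / (4 * (INR m + 2)))) by (field; lra).
    rewrite Rmult_comm; apply Rmult_le_compat_l; [apply pow2_ge_0|].
    apply Rmult_le_reg_r with (4 * (INR m + 2)); [lra|].
    unfold Rdiv; rewrite Rmult_assoc, Rinv_l by lra; nra.
  (* While [(m + 1) b_m^2] increases, [(m + 3/2) b_m^2] decreases from its initial value [3/2]. *)
  - assert (Hv : forall m, (INR m + 3 / 2) * b m ^ 2 <= 3 / 2).
    { induction m as [|m IH].
      - unfold b; rewrite odd_binom_le by lia; simpl; lra.
      - eapply Rle_trans; [|exact IH].
        rewrite HbS, S_INR; assert (H := pos_INR m).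
        replace ((INR m + 1 + 3 / 2) *
          (b m * ((2 * INR m + 3) / (2 * (INR m + 2)))) ^ 2) with
          (b m ^ 2 * ((INR m + 5 / 2) * (2 * INR m + 3) ^ 2 / (4 * (INR m + 2) ^ 2)))
          by (field; lra).
        rewrite (Rmult_comm (INR m + 3 / 2)).
        apply Rmult_le_compat_l; [apply pow2_ge_0|].
        apply Rmult_le_reg_r with (4 * (INR m + 2) ^ 2); [nra|].
        unfold Rdiv at 1; rewrite Rmult_assoc, Rinv_l by nra; nra. }
    intros m; specialize (Hv m); unfold u.
    assert (H := pow2_ge_0 (b m)); lra. }
destruct Hu as [U HU]; exists (sqrt U).
apply is_lim_seq_ext with (fun m => sqrt (u m)).
- intros m; unfold u; assert (H := pos_INR m).
  rewrite sqrt_mult by (try apply pow2_ge_0; try lra).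
  rewrite sqrt_pow2 by (apply Rlt_le, Hb); reflexivity.
- apply (is_lim_seq_continuous sqrt u U); auto.
  apply continuity_pt_sqrt.
  apply (is_lim_seq_le (fun _ => 0) u 0 U); auto; [|apply is_lim_seq_const].
  intros m; unfold u; assert (H := pos_INR m); assert (H' := pow2_ge_0 (b m)); nra.
Qed.

Lemma polya_constant_lim (W s : R) : 0 < s ->
  is_lim_seq (fun m => sqrt (INR m + 1) * (odd_binom m 0 / 4 ^ m)) W ->
  is_lim_seq (fun N => INR (2 * N + 1) * (odd_binom (polya_m s N) 0 /
    4 ^ polya_m s N)) (sqrt PI * W / sqrt s).
Proof.
intros Hs HW; assert (Hpi := PI_RGT_0).
assert (Hl : forall N, 0 < INR (2 * N + 1)) by (intros N; apply lt_0_INR; lia).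
assert (Hsp : 0 < s / PI) by (apply Rdiv_lt_0_compat; lra).
assert (HM : is_lim_seq (fun N => sqrt ((INR (polya_m s N) + 1) /
  INR (2 * N + 1) ^ 2)) (sqrt (s / PI))).
{ apply (is_lim_seq_continuous sqrt (fun N => (INR (polya_m s N) + 1) /
    INR (2 * N + 1) ^ 2) (s / PI)).
  - apply continuity_pt_sqrt; lra.
  - apply is_lim_seq_ext with (fun N => INR (polya_m s N) / INR (2 * N + 1) ^ 2 +
      / INR (2 * N + 1) * / INR (2 * N + 1)).
    + intros N; specialize (Hl N); field; lra.
    + replace (s / PI) with (s / PI + 0 * 0) by ring.
      apply is_lim_seq_plus'; [now apply polya_m_lim|].
      apply is_lim_seq_mult'; apply odd_lim. }
assert (HWm : is_lim_seq (fun N => sqrt (INR (polya_m s N) + 1) *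
  (odd_binom (polya_m s N) 0 / 4 ^ polya_m s N)) W).
{ apply (is_lim_seq_comp _ _ (polya_m s) HW).
  intros K; destruct (INR_unbounded (INR K * PI / s)) as [N0 HN0].
  exists N0; intros N HN.
  destruct (polya_m_bounds s N Hs) as [H _].
  assert (INR K < INR (polya_m s N)); [|apply INR_lt in H0; lia].
  eapply Rle_lt_trans; [|exact H].
  assert (HNr := le_INR _ _ HN).
  assert (Hl' : INR (2 * N + 1) = 2 * INR N + 1)
    by (rewrite plus_INR, mult_INR; simpl; ring).
  assert (HN1 := pos_INR N0).
  assert (HK : INR K * PI / s * s = INR K * PI) by (field; lra).
  apply Rmult_le_reg_r with PI; auto.
  replace (s * INR (2 * N + 1) ^ 2 / PI * PI) with (s * INR (2 * N + 1) ^ 2)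
    by (field; lra).
  rewrite Hl', <- HK, Rmult_comm; apply Rmult_le_compat_l; [lra|]; nra. }
assert (Hsq : 0 < sqrt (s / PI)) by now apply sqrt_lt_R0.
replace (sqrt PI * W / sqrt s) with (W / sqrt (s / PI)).
- apply is_lim_seq_ext with (fun N => sqrt (INR (polya_m s N) + 1) *
    (odd_binom (polya_m s N) 0 / 4 ^ polya_m s N) /
    sqrt ((INR (polya_m s N) + 1) / INR (2 * N + 1) ^ 2)).
  + intros N; specialize (Hl N); assert (Hp := pos_INR (polya_m s N)).
    assert (Hl2 : 0 < INR (2 * N + 1) ^ 2) by (apply pow_lt; lra).
    rewrite sqrt_div by lra; rewrite sqrt_pow2 by lra.
    assert (0 < sqrt (INR (polya_m s N) + 1)) by (apply sqrt_lt_R0; lra).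
    assert (4 ^ polya_m s N <> 0) by (apply pow_nonzero; lra).
    field; repeat split; lra.
  + apply is_lim_seq_div'; auto; lra.
- rewrite sqrt_div by lra.
  assert (0 < sqrt s) by (apply sqrt_lt_R0; lra).
  assert (0 < sqrt PI) by (apply sqrt_lt_R0; lra).
  field; lra.
Qed.

Lemma poisson_up_to_constant : exists c, forall s al, 0 < s -> Rabs al <= 1 / 2 ->
  rser (poisson_lhs s al) = c / sqrt s * rser (poisson_rhs s al).
Proof.
destruct central_binom_lim as [W HW]; exists (sqrt PI * W).
intros s al Hs Hal.
rewrite (rser_unique _ _ (poisson_lhs_lim s al Hs Hal)).
apply (is_lim_seq_const_unique _ _ _ (polya_lhs_lim s al Hs Hal)).
apply is_lim_seq_ext with (fun N =>
  INR (2 * N + 1) * (odd_binom (polya_m s N) 0 / 4 ^ polya_m s N) *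
  rsum (fun j => odd_binom (polya_m s N) ((2 * N + 1) * j + N) /
    odd_binom (polya_m s N) 0 * cos ((2 * INR j + 1) * PI * al))
    (S (polya_m s N))).
- intros N; rewrite polya_finite; cbv zeta.
  assert (H := odd_binom_pos (polya_m s N) 0 ltac:(lia)).
  assert (H4 : 4 ^ polya_m s N <> 0) by (apply pow_nonzero; lra).
  replace (INR (2 * N + 1) * (odd_binom (polya_m s N) 0 / 4 ^ polya_m s N)) with
    (INR (2 * N + 1) / 4 ^ polya_m s N * odd_binom (polya_m s N) 0)
    by (field; auto).
  rewrite Rmult_assoc, <- rsum_scal; f_equal; apply rsum_ext; intros j _.
  field; lra.
- apply is_lim_seq_mult'; [apply polya_constant_lim; auto|now apply polya_rhs_lim].
Qed.

(** * Splitting the dual series by residue classes *)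

Lemma rser_blocks (f : nat -> R) (p : nat) (A rho : R) :
  (0 < p)%nat -> 0 <= rho < 1 -> (forall n, Rabs (f n) <= A * rho ^ n) ->
  rser f = rser (fun k => rsum (fun u => f (p * k + u)%nat) p).
Proof.
intros Hp Hr Hf; symmetry; apply rser_unique.
apply is_lim_seq_ext with (fun K => rsum f (p * K)).
- intros K; induction K as [|K IH]; [rewrite Nat.mul_0_r; reflexivity|].
  replace (p * S K)%nat with (p * K + p)%nat by lia.
  cbn [rsum]; rewrite <- IH.
  assert (H : forall n, rsum f (p * K + n) =
    rsum f (p * K) + rsum (fun u => f (p * K + u)%nat) n).
  { induction n as [|n IHn]; [rewrite Nat.add_0_r; simpl; ring|].
    rewrite Nat.add_succ_r; cbn [rsum]; rewrite IHn; ring. }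
  apply H.
- apply (is_lim_seq_comp _ _ (fun K => (p * K)%nat) (rser_lim f A rho Hr Hf)).
  intros K; exists K; intros N HN; nia.
Qed.

Lemma exp_square_bound (c x : R) (k : nat) : 0 < c -> INR k <= x ^ 2 ->
  0 <= exp (- (c * x ^ 2)) <= exp (- c) ^ k.
Proof.
intros Hc Hx; split; [apply Rlt_le, exp_pos|].
rewrite exp_pow; apply exp_le; nra.
Qed.

Lemma INR_le_square (k : nat) (x : R) : INR k <= x -> INR k <= x ^ 2.
Proof.
destruct k as [|k]; [simpl; nra|].
intros H; assert (1 <= INR (S k)) by (rewrite S_INR; assert (H0 := pos_INR k); lra).
nra.
Qed.

Lemma poisson_rhs_bound (s al : R) (j : nat) : 0 < s ->
  Rabs (poisson_rhs s al j) <= 1 * exp (- (PI / s)) ^ j.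
Proof.
intros Hs; assert (Hpi := PI_RGT_0); unfold poisson_rhs; rewrite Rabs_mult.
assert (H2 : Rabs (cos ((2 * INR j + 1) * PI * al)) <= 1)
  by (apply Rabs_le, COS_bound).
replace (PI * (INR j + 1 / 2) ^ 2 / s) with (PI / s * (INR j + 1 / 2) ^ 2)
  by (field; lra).
destruct (exp_square_bound (PI / s) (INR j + 1 / 2) j) as [H0 H1].
- apply Rdiv_lt_0_compat; lra.
- apply INR_le_square; lra.
- rewrite (Rabs_pos_eq (exp _)), Rmult_comm by auto.
  apply Rmult_le_compat; auto using Rabs_pos.
Qed.

Lemma poisson_lhs_bound (s al : R) (k : nat) : 0 < s -> 0 <= al <= 1 / 2 ->
  Rabs (poisson_lhs s al k) <= 2 * exp (- (PI * s)) ^ k.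
Proof.
intros Hs Hal; assert (Hpi := PI_RGT_0); assert (Hc : 0 < PI * s) by nra.
unfold poisson_lhs; rewrite Rabs_mult, Rabs_pow_m1, Rmult_1_l.
destruct (exp_square_bound (PI * s) (INR k + al) k Hc) as [H0 H1].
{ apply INR_le_square; lra. }
destruct (exp_square_bound (PI * s) (INR k + 1 - al) k Hc) as [H2 H3].
{ apply INR_le_square; lra. }
apply Rabs_le; lra.
Qed.

Definition poisson_sum (s al : R) : R := rser (poisson_lhs s al).

Lemma poisson_sum_lim (s al : R) : 0 < s -> 0 <= al <= 1 / 2 ->
  is_lim_seq (rsum (poisson_lhs s al)) (poisson_sum s al).
Proof.
intros Hs Hal; apply (rser_lim _ 2 (exp (- (PI * s)))).
- apply exp_neg_ratio; assert (Hpi := PI_RGT_0); nra.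
- intros k; now apply poisson_lhs_bound.
Qed.

Lemma poisson_sum_lin (a b s al be : R) :
  0 < s -> 0 <= al <= 1 / 2 -> 0 <= be <= 1 / 2 ->
  rser (fun k => a * poisson_lhs s al k + b * poisson_lhs s be k) =
  a * poisson_sum s al + b * poisson_sum s be.
Proof.
intros Hs Ha Hb; apply rser_unique.
apply is_lim_seq_ext with
  (fun n => a * rsum (poisson_lhs s al) n + b * rsum (poisson_lhs s be) n).
{ intros n; now rewrite <- !rsum_scal, <- rsum_plus. }
apply is_lim_seq_plus'; apply is_lim_seq_mult'; try apply is_lim_seq_const;
  now apply poisson_sum_lim.
Qed.

Lemma pow_m1_odd (k a : nat) : Nat.Odd a -> (-1) ^ (k * a) = (-1) ^ k.
Proof.
intros [b ->]; replace (k * (2 * b + 1))%nat with (2 * (k * b) + k)%nat by lia.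
rewrite pow_add, pow_1_even; ring.
Qed.

(** For [al = a / (2 p)] with [a] odd, advancing the index by [p] changes the angle by an odd
    multiple of [PI]. Within a residue class the cosine is thus a constant times [(-1) ^ k], and the
    Gaussians are again of left-hand type, with [p^2 / s] in place of [s]. *)
Lemma poisson_rhs_block (s : R) (p a k u : nat) :
  0 < s -> (0 < p)%nat -> Nat.Odd a ->
  poisson_rhs s (INR a / (2 * INR p)) (p * k + u) =
  cos ((2 * INR u + 1) * INR a * PI / (2 * INR p)) * (-1) ^ k *
  exp (- (PI * (INR p ^ 2 / s) *
    (INR k + (2 * INR u + 1) / (2 * INR p)) ^ 2)).
Proof.
intros Hs Hp Ha; unfold poisson_rhs.
assert (Hp0 : 0 < INR p) by (apply lt_0_INR; lia).
rewrite plus_INR, mult_INR.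
replace ((2 * (INR p * INR k + INR u) + 1) * PI * (INR a / (2 * INR p))) with
  ((2 * INR u + 1) * INR a * PI / (2 * INR p) + INR (k * a) * PI)
  by (rewrite mult_INR; field; lra).
rewrite cos_plus_nPI, (pow_m1_odd k a Ha).
replace (PI * (INR p * INR k + INR u + 1 / 2) ^ 2 / s) with
  (PI * (INR p ^ 2 / s) * (INR k + (2 * INR u + 1) / (2 * INR p)) ^ 2)
  by (field; lra).
ring.
Qed.

Lemma cos_PI_minus (x : R) : cos (PI - x) = - cos x.
Proof. rewrite cos_minus, cos_PI, sin_PI; ring. Qed.

(** Of the three classes modulo 3 the middle one has [cos (PI / 2) = 0]; the outer two have opposite
    cosines and make up the pairs of [poisson_lhs]. *)
Lemma poisson_rhs_6 (s : R) : 0 < s ->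
  rser (poisson_rhs s (1 / 6)) = cos (PI / 6) * poisson_sum (9 / s) (1 / 6).
Proof.
intros Hs; assert (Hpi := PI_RGT_0).
rewrite (rser_blocks _ 3 1 (exp (- (PI / s)))); [|lia| |].
- rewrite (rser_ext _ (fun k => cos (PI / 6) * poisson_lhs (9 / s) (1 / 6) k +
    0 * poisson_lhs (9 / s) (1 / 6) k)).
  + rewrite poisson_sum_lin; try lra.
    apply Rdiv_lt_0_compat; lra.
  + intros k; cbn [rsum]; replace (1 / 6) with (INR 1 / (2 * INR 3))
      by (simpl; field).
    rewrite !poisson_rhs_block by (auto; try lia; now exists 0%nat).
    simpl INR.
    replace ((2 * 0 + 1) * 1 * PI / (2 * (1 + 1 + 1))) with (PI / 6) by field.
    replace ((2 * 1 + 1) * 1 * PI / (2 * (1 + 1 + 1))) with (PI / 2) by field.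
    replace ((2 * (1 + 1) + 1) * 1 * PI / (2 * (1 + 1 + 1))) with (PI - PI / 6)
      by field.
    rewrite cos_PI2, cos_PI_minus; unfold poisson_lhs.
    replace (PI * (9 / s) * (INR k + 1 / (2 * (1 + 1 + 1))) ^ 2) with
      (PI * ((1 + 1 + 1) ^ 2 / s) * (INR k + (2 * 0 + 1) / (2 * (1 + 1 + 1))) ^ 2)
      by (field; lra).
    replace (PI * (9 / s) * (INR k + 1 - 1 / (2 * (1 + 1 + 1))) ^ 2) with
      (PI * ((1 + 1 + 1) ^ 2 / s) *
        (INR k + (2 * (1 + 1) + 1) / (2 * (1 + 1 + 1))) ^ 2)
      by (field; lra).
    ring.
- apply exp_neg_ratio, Rdiv_lt_0_compat; lra.
- intros n; now apply poisson_rhs_bound.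
Qed.

(** The same modulo 5: the middle class vanishes and the other four form two pairs, so that
    inversion mixes the two theta constants of level 5. *)
Lemma poisson_rhs_10 (s : R) (a : nat) : 0 < s -> Nat.Odd a ->
  rser (poisson_rhs s (INR a / 10)) =
  cos (INR a * PI / 10) * poisson_sum (25 / s) (1 / 10) +
  cos (3 * INR a * PI / 10) * poisson_sum (25 / s) (3 / 10).
Proof.
intros Hs Ha; assert (Hpi := PI_RGT_0).
rewrite (rser_blocks _ 5 1 (exp (- (PI / s)))); [|lia| |].
- rewrite <- poisson_sum_lin; try lra.
  2:{ apply Rdiv_lt_0_compat; lra. }
  apply rser_ext; intros k; cbn [rsum].
  replace (INR a / 10) with (INR a / (2 * INR 5)) by (simpl; field).
  rewrite !poisson_rhs_block by (auto; lia).
  assert (H5 : INR 5 = 5) by (simpl; ring); rewrite H5.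
  assert (H4 : INR 4 = 4) by (simpl; ring); rewrite H4.
  assert (H3 : INR 3 = 3) by (simpl; ring); rewrite H3.
  assert (H2 : INR 2 = 2) by (simpl; ring); rewrite H2.
  assert (H1 : INR 1 = 1) by (simpl; ring); rewrite H1.
  assert (H0 : INR 0 = 0) by reflexivity; rewrite H0.
  assert (Hodd : forall x, cos (INR a * PI - x) = - cos x).
  { intros x; replace (INR a * PI - x) with (- x + INR a * PI) by ring.
    rewrite cos_plus_nPI, cos_neg, <- (Nat.mul_1_l a), (pow_m1_odd 1 a Ha).
    simpl; ring. }
  replace ((2 * 0 + 1) * INR a * PI / (2 * 5)) with (INR a * PI / 10) by field.
  replace ((2 * 1 + 1) * INR a * PI / (2 * 5)) with (3 * INR a * PI / 10) by field.
  replace ((2 * 2 + 1) * INR a * PI / (2 * 5)) with (INR a * (PI / 2)) by field.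
  replace ((2 * 3 + 1) * INR a * PI / (2 * 5)) with
    (INR a * PI - 3 * INR a * PI / 10) by field.
  replace ((2 * 4 + 1) * INR a * PI / (2 * 5)) with
    (INR a * PI - INR a * PI / 10) by field.
  assert (Hmid : cos (INR a * (PI / 2)) = 0).
  { assert (H := Hodd (INR a * (PI / 2))).
    replace (INR a * PI - INR a * (PI / 2)) with (INR a * (PI / 2)) in H by field.
    lra. }
  rewrite Hmid, !Hodd; unfold poisson_lhs.
  replace (PI * (25 / s) * (INR k + 1 / 10) ^ 2) with
    (PI * (5 ^ 2 / s) * (INR k + (2 * 0 + 1) / (2 * 5)) ^ 2) by (field; lra).
  replace (PI * (25 / s) * (INR k + 1 - 1 / 10) ^ 2) with
    (PI * (5 ^ 2 / s) * (INR k + (2 * 4 + 1) / (2 * 5)) ^ 2) by (field; lra).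
  replace (PI * (25 / s) * (INR k + 3 / 10) ^ 2) with
    (PI * (5 ^ 2 / s) * (INR k + (2 * 1 + 1) / (2 * 5)) ^ 2) by (field; lra).
  replace (PI * (25 / s) * (INR k + 1 - 3 / 10) ^ 2) with
    (PI * (5 ^ 2 / s) * (INR k + (2 * 3 + 1) / (2 * 5)) ^ 2) by (field; lra).
  ring.
- apply exp_neg_ratio, Rdiv_lt_0_compat; lra.
- intros n; now apply poisson_rhs_bound.
Qed.

Lemma INR_tri_pred (n : nat) : INR (tri (pred n)) = INR n * (INR n - 1) / 2.
Proof.
destruct n as [|n]; [simpl; field|]; cbn [pred]; rewrite INR_tri, S_INR; field.
Qed.

(** Completing the square: [i n (n + 1) / 2 + j n (n - 1) / 2] equals [(i + j) / 2] times
    [(n + al)^2 - al^2]. *)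
Lemma poisson_sum_theta (i j : nat) (y : R) : (0 < i)%nat -> (0 < j)%nat -> 0 < y ->
  let q := exp (-2 * PI * y) in
  let al := (INR i - INR j) / (2 * (INR i + INR j)) in
  poisson_sum ((INR i + INR j) * y) al =
  exp (- (PI * (INR i + INR j) * y * al ^ 2)) * theta (q ^ i) (q ^ j).
Proof.
intros Hi Hj Hy q al; assert (Hpi := PI_RGT_0).
assert (Hi0 : 0 < INR i) by (apply lt_0_INR; auto).
assert (Hj0 : 0 < INR j) by (apply lt_0_INR; auto).
assert (Hq : 0 < q < 1) by (apply exp_neg_lt_1; auto).
apply rser_unique.
apply is_lim_seq_ext with (fun n => exp (- (PI * (INR i + INR j) * y * al ^ 2)) *
  rsum (theta_term (q ^ i) (q ^ j)) n).
- intros n; rewrite <- rsum_scal; apply rsum_ext; intros k _.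
  unfold theta_term, poisson_lhs; rewrite <- !pow_mult; unfold q.
  rewrite !exp_pow, !mult_INR, plus_INR, mult_INR, INR_tri, INR_tri_pred.
  rewrite !Rmult_minus_distr_l, Rmult_1_r.
  match goal with |- ?e * (?s * ?u * ?v) - ?e * (?s * ?u * ?v * ?w) = _ =>
    transitivity (s * (e * u * v) - s * (e * u * v * w)); [ring|] end.
  rewrite <- !exp_plus; simpl (INR 2); simpl (INR 1).
  f_equal; f_equal; f_equal; unfold al; field; lra.
- apply is_lim_seq_mult'; [apply is_lim_seq_const|].
  apply theta_lim; apply pow_lt_1'; auto.
Qed.

(** * Inversion of the level 5 theta constants *)

(* The Dedekind eta function and the two level 5 theta constants on the
   imaginary axis, normalised so as to transform with weight 1/2. *)
Definition reta (y : R) : R := exp (- (PI * y / 12)) * rphi (exp (-2 * PI * y)).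
Definition rt1 (y : R) : R :=
  exp (- (9 * PI * y / 20)) * theta (exp (-2 * PI * y) ^ 4) (exp (-2 * PI * y)).
Definition rt2 (y : R) : R :=
  exp (- (PI * y / 20)) * theta (exp (-2 * PI * y) ^ 3) (exp (-2 * PI * y) ^ 2).

Lemma reta_poisson (y : R) : 0 < y -> reta y = poisson_sum (3 * y) (1 / 6).
Proof.
intros Hy; assert (H := poisson_sum_theta 2 1 y ltac:(lia) ltac:(lia) Hy).
cbv zeta in H; simpl (INR 2) in H; simpl (INR 1) in H.
replace ((1 + 1 + 1) * y) with (3 * y) in H by ring.
replace ((1 + 1 - 1) / (2 * (1 + 1 + 1))) with (1 / 6) in H by field.
rewrite H, pow_1, pentagonal by (apply exp_neg_lt_1; auto).
unfold reta; f_equal; f_equal; field.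
Qed.

Lemma rt1_poisson (y : R) : 0 < y -> rt1 y = poisson_sum (5 * y) (3 / 10).
Proof.
intros Hy; assert (H := poisson_sum_theta 4 1 y ltac:(lia) ltac:(lia) Hy).
cbv zeta in H; simpl (INR 4) in H; simpl (INR 1) in H.
replace ((1 + 1 + 1 + 1 + 1) * y) with (5 * y) in H by ring.
replace ((1 + 1 + 1 + 1 - 1) / (2 * (1 + 1 + 1 + 1 + 1))) with (3 / 10) in H
  by field.
rewrite H, pow_1; unfold rt1; f_equal; f_equal; field.
Qed.

Lemma rt2_poisson (y : R) : 0 < y -> rt2 y = poisson_sum (5 * y) (1 / 10).
Proof.
intros Hy; assert (H := poisson_sum_theta 3 2 y ltac:(lia) ltac:(lia) Hy).
cbv zeta in H; simpl (INR 3) in H; simpl (INR 2) in H.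
replace ((1 + 1 + 1 + (1 + 1)) * y) with (5 * y) in H by ring.
replace ((1 + 1 + 1 - (1 + 1)) / (2 * (1 + 1 + 1 + (1 + 1)))) with (1 / 10) in H
  by field.
rewrite H; unfold rt2; f_equal; f_equal; field.
Qed.

Lemma reta_pos (y : R) : 0 < y -> 0 < reta y.
Proof.
intros Hy; apply Rmult_lt_0_compat; [apply exp_pos|].
apply rphi_pos, exp_neg_lt_1, Hy.
Qed.

(** The constant is found at [s = 3] and [al = 1/6], where the splitting modulo 3 returns the same
    sum. This sum is [reta 1], hence nonzero, and cancels, leaving
    [c / sqrt 3 * (sqrt 3 / 2) = 1]. *)
Lemma poisson_signed (s al : R) : 0 < s -> Rabs al <= 1 / 2 ->
  poisson_sum s al = 2 / sqrt s * rser (poisson_rhs s al).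
Proof.
intros Hs Hal; destruct poisson_up_to_constant as [c Hc].
assert (H3 := Hc 3 (1 / 6) ltac:(lra) ltac:(rewrite Rabs_pos_eq; lra)).
fold (poisson_sum 3 (1 / 6)) in H3.
rewrite poisson_rhs_6, cos_PI6 in H3 by lra.
replace (9 / 3) with 3 in H3 by field.
assert (Hp := reta_pos 1 Rlt_0_1); rewrite reta_poisson, Rmult_1_r in Hp by lra.
assert (Hs3 : 0 < sqrt 3) by (apply sqrt_lt_R0; lra).
assert (c = 2).
{ apply Rmult_eq_reg_r with (poisson_sum 3 (1 / 6) / 2); [|lra].
  replace (c * (poisson_sum 3 (1 / 6) / 2)) with
    (c / sqrt 3 * (sqrt 3 / 2 * poisson_sum 3 (1 / 6))) by (field; lra).
  rewrite <- H3; field. }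
subst c; now apply Hc.
Qed.

Lemma reta_inversion (y : R) : 0 < y -> reta y = reta (/ y) / sqrt y.
Proof.
intros Hy; assert (Hy' := Rinv_0_lt_compat y Hy).
rewrite !reta_poisson by auto.
rewrite poisson_signed, poisson_rhs_6, cos_PI6, sqrt_mult
  by (try (rewrite Rabs_pos_eq); lra).
replace (9 / (3 * y)) with (3 * / y) by (field; lra).
assert (0 < sqrt 3) by (apply sqrt_lt_R0; lra).
assert (0 < sqrt y) by (apply sqrt_lt_R0; lra).
field; lra.
Qed.

Lemma rt_inversion (y : R) : 0 < y ->
  rt2 y = 2 / sqrt (5 * y) *
    (cos (PI / 10) * rt2 (/ y) + cos (3 * (PI / 10)) * rt1 (/ y)) /\
  rt1 y = 2 / sqrt (5 * y) *
    (cos (3 * (PI / 10)) * rt2 (/ y) - cos (PI / 10) * rt1 (/ y)).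
Proof.
intros Hy; assert (Hy' := Rinv_0_lt_compat y Hy).
rewrite !rt1_poisson, !rt2_poisson by auto.
assert (H1 := poisson_rhs_10 (5 * y) 1 ltac:(lra) ltac:(now exists 0%nat)).
assert (H3 := poisson_rhs_10 (5 * y) 3 ltac:(lra) ltac:(now exists 1%nat)).
simpl (INR 1) in H1; simpl (INR 3) in H3.
replace (25 / (5 * y)) with (5 * / y) in H1, H3 by (field; lra).
replace ((1 + 1 + 1) / 10) with (3 / 10) in H3 by field.
split.
- rewrite (poisson_signed (5 * y)), H1 by (try rewrite Rabs_pos_eq; lra).
  replace (1 * PI / 10) with (PI / 10) by field.
  replace (3 * 1 * PI / 10) with (3 * (PI / 10)) by field; ring.
- rewrite (poisson_signed (5 * y)), H3 by (try rewrite Rabs_pos_eq; lra).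
  replace ((1 + 1 + 1) * PI / 10) with (3 * (PI / 10)) by field.
  replace (3 * (1 + 1 + 1) * PI / 10) with (PI - PI / 10) by field.
  rewrite cos_PI_minus; ring.
Qed.

(** As a form on the projective line, it vanishes at the 12 vertices of an icosahedron. *)
Definition klein (X Y : R) : R := X * Y * (X ^ 10 - 11 * X ^ 5 * Y ^ 5 - Y ^ 10).

(** Here [g] is the reciprocal of the golden ratio. It is used only through [g * g = 1 - g], modulo
    which [ring] normalises the identities below. *)
Lemma cos_PI_10 : exists g, g * g = 1 - g /\
  cos (3 * (PI / 10)) = cos (PI / 10) * g /\ cos (PI / 10) ^ 2 = (g + 3) / 4.
Proof.
assert (Hpi := PI_RGT_0).
set (x := PI / 10); set (c := cos x).
assert (Hc : 0 < c) by (apply cos_gt_0; unfold x; lra).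
assert (H2 : cos (2 * x) = 2 * c * c - 1) by apply cos_2a_cos.
assert (H3 : cos (3 * x) = 4 * c ^ 3 - 3 * c).
{ replace (3 * x) with (x + 2 * x) by ring.
  rewrite cos_plus, H2, sin_2a; fold c.
  assert (H := sin2_cos2 x); unfold Rsqr in H; fold c in H.
  replace (sin x * (2 * sin x * c)) with (2 * c * (sin x * sin x)) by ring.
  replace (sin x * sin x) with (1 - c * c) by lra; ring. }
(* [cos (2x) = sin (3x)] at [x = pi/10]; squaring gives a polynomial relation. *)
assert (H5 : cos (2 * x) ^ 2 = 1 - cos (3 * x) ^ 2).
{ assert (H := sin2_cos2 (3 * x)); unfold Rsqr in H.
  replace (cos (2 * x)) with (sin (3 * x)); [simpl; lra|].
  replace (2 * x) with (PI / 2 - 3 * x) by (unfold x; field).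
  now rewrite cos_shift. }
rewrite H2, H3 in H5.
exists (4 * c ^ 2 - 3); rewrite H3.
assert (Hq : c ^ 2 * (16 * c ^ 4 - 20 * c ^ 2 + 5) = 0).
{ replace (c ^ 2 * (16 * c ^ 4 - 20 * c ^ 2 + 5)) with
    ((2 * c * c - 1) ^ 2 - (1 - (4 * c ^ 3 - 3 * c) ^ 2)) by ring.
  rewrite H5; ring. }
apply Rmult_integral in Hq; destruct Hq as [Hq|Hq]; [nra|].
repeat split; [|ring|field].
replace (c ^ 4) with (c ^ 2 * c ^ 2) in Hq by ring; nra.
Qed.

Lemma pow5_golden (g X Y : R) : g * g = 1 - g ->
  (X + g * Y) ^ 5 =
  (X ^ 5 + 10 * X ^ 3 * Y ^ 2 - 10 * X ^ 2 * Y ^ 3 + 10 * X * Y ^ 4 - 3 * Y ^ 5) +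
  g * (5 * X ^ 4 * Y - 10 * X ^ 3 * Y ^ 2 + 20 * X ^ 2 * Y ^ 3 - 15 * X * Y ^ 4 +
       5 * Y ^ 5).
Proof. intros Hg; ring [Hg]. Qed.

(** The substitution squares to the scalar [1 + g^2]; up to scale it is a half-turn of the
    icosahedron, so the form is multiplied by [(1 + g^2)^6], and [(1 + g^2) (g + 3) = 5] gives the
    constants. Fifth powers are reduced modulo [g * g = 1 - g] before the expansion in degree 12. *)
Lemma klein_golden (g X Y : R) : g * g = 1 - g ->
  (g + 3) ^ 6 * klein (X + g * Y) (g * X - Y) = 5 ^ 6 * klein X Y.
Proof.
intros Hg; unfold klein.
assert (HA := pow5_golden g X Y Hg); assert (HB := pow5_golden g Y (- X) Hg).
replace ((X + g * Y) ^ 10) with ((X + g * Y) ^ 5 * (X + g * Y) ^ 5) by ring.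
replace ((g * X - Y) ^ 10) with ((g * X - Y) ^ 5 * (g * X - Y) ^ 5) by ring.
replace ((g * X - Y) ^ 5) with (- (Y + g * - X) ^ 5) by ring.
rewrite HA, HB; clear HA HB.
match goal with |- _ * (_ * ((?a + g * ?b) * _ - 11 * _ * - (?c + g * ?d) - _)) = _ =>
  set (A := a); set (B := b); set (C := c); set (D := d) end.
assert (Huv : (g + 3) ^ 6 * ((X + g * Y) * (g * X - Y)) =
  125 * (8 + 5 * g) * (X ^ 2 - X * Y - Y ^ 2)) by ring [Hg].
transitivity (125 * (8 + 5 * g) * (X ^ 2 - X * Y - Y ^ 2) *
  ((A + g * B) * (A + g * B) - 11 * (A + g * B) * - (C + g * D) -
   - (C + g * D) * - (C + g * D))).
{ rewrite <- Huv; ring. }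
set (p := A ^ 2 + B ^ 2 + 11 * (A * C + B * D) - C ^ 2 - D ^ 2).
set (r := 2 * A * B - B ^ 2 + 11 * (A * D + B * C - B * D) - 2 * C * D + D ^ 2).
assert (Hpr : (A + g * B) * (A + g * B) - 11 * (A + g * B) * - (C + g * D) -
   - (C + g * D) * - (C + g * D) = p + g * r).
{ unfold p, r; clearbody A B C D; ring [Hg]. }
rewrite Hpr.
assert (H1 : 5 * p + 3 * r = 0) by (unfold p, r, A, B, C, D; ring).
assert (H2 : (X ^ 2 - X * Y - Y ^ 2) * (8 * p + 5 * r) =
  125 * (X * Y * (X ^ 10 - 11 * X ^ 5 * Y ^ 5 - Y ^ 10)))
  by (unfold p, r, A, B, C, D; ring).
clearbody p r.
transitivity (125 * ((X ^ 2 - X * Y - Y ^ 2) * (8 * p + 5 * r) +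
  (X ^ 2 - X * Y - Y ^ 2) * g * (5 * p + 3 * r))).
- ring [Hg].
- rewrite H1, H2; ring.
Qed.

(** The Gaussian binomial coefficient of [j + r] over [r]. *)
Definition hw_coef (q : R) (j r : nat) : R :=
  rqpoch q (j + r) / (rqpoch q j * rqpoch q r).

(** * The continued fraction as a quotient of theta constants *)

(* Terms of the Rogers-Hardy-Wright functions [H_1 (a)] and [H_2 (a)] at
   [a = q^(j+1)]. *)
Definition hw1 (q : R) (j r : nat) : R :=
  (-1) ^ r * q ^ (2 * r * r + tri r + (2 * j + 1) * r) *
  (1 - q ^ (j + 1) * q ^ (2 * r)) * hw_coef q j r.

Definition hw2 (q : R) (j r : nat) : R :=
  (-1) ^ r * q ^ (2 * r * r + tri r + 2 * j * r) *
  (1 - (q ^ (j + 1) * q ^ (2 * r)) ^ 2) * hw_coef q j r.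

Lemma hw_coef_S (q : R) (j r : nat) : 0 < q < 1 ->
  (1 - q ^ S r) * hw_coef q j (S r) = (1 - q ^ (j + 1)) * hw_coef q (S j) r.
Proof.
intros Hq; unfold hw_coef.
assert (Hnz : forall k, rqpoch q k <> 0)
  by (intros k; apply Rgt_not_eq, rqpoch_pos, Hq).
assert (H1 := one_minus_pow_neq q r Hq); assert (H2 := one_minus_pow_neq q j Hq).
replace (j + S r)%nat with (S j + r)%nat by lia.
replace (j + 1)%nat with (S j) by lia.
cbn [rqpoch pow] in *; field; repeat split; auto.
Qed.

Lemma hw_coef_0 (q : R) (j r : nat) : 0 < q < 1 ->
  (1 - q ^ (j + 1) * q ^ r) * hw_coef q j r =
  (1 - q ^ (j + 1)) * hw_coef q (S j) r.
Proof.
intros Hq; unfold hw_coef.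
assert (Hnz : forall k, rqpoch q k <> 0)
  by (intros k; apply Rgt_not_eq, rqpoch_pos, Hq).
assert (H2 := one_minus_pow_neq q j Hq).
replace (S j + r)%nat with (S (j + r)) by lia.
rewrite <- pow_add; replace (j + 1 + r)%nat with (S (j + r)) by lia.
replace (j + 1)%nat with (S j) by lia.
cbn [rqpoch pow] in *; field; repeat split; auto.
Qed.

(** The functional equation on partial sums, with an explicit boundary term. It rests on [1 - a
    q^(2r) = (1 - q^r) + q^r (1 - a q^r)] for [a = q^(j+1)]: the first part lowers [r] by
    [hw_coef_S], the second keeps it by [hw_coef_0], and neighbouring terms regroup. *)
Lemma hw1_partial (q : R) (j N : nat) : 0 < q < 1 ->
  rsum (hw1 q j) (S N) = (1 - q ^ (j + 1)) * (rsum (hw2 q (S j)) N +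
    (-1) ^ N * q ^ (2 * N * N + tri N + (2 * j + 2) * N) * hw_coef q (S j) N).
Proof.
intros Hq; induction N as [|N IH].
- assert (H := hw_coef_0 q j 0 Hq).
  cbn [rsum]; unfold hw1; simpl (2 * 0)%nat; rewrite !Nat.mul_0_r.
  simpl tri; rewrite <- Rmult_1_r with (r := hw_coef q (S j) 0).
  simpl pow in *; lra.
- change (rsum (hw1 q j) (S (S N))) with (rsum (hw1 q j) (S N) + hw1 q j (S N)).
  rewrite IH; cbn [rsum].
  assert (HA := hw_coef_S q j N Hq); assert (HB := hw_coef_0 q j (S N) Hq).
  assert (E : hw1 q j (S N) =
    (-1) ^ S N * q ^ (2 * S N * S N + tri (S N) + (2 * j + 1) * S N) *
    ((1 - q ^ (j + 1)) * hw_coef q (S j) N +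
     q ^ S N * ((1 - q ^ (j + 1)) * hw_coef q (S j) (S N)))).
  { rewrite <- HA, <- HB; unfold hw1.
    replace (2 * S N)%nat with (S N + S N)%nat at 2 by lia.
    rewrite (pow_add q (S N) (S N)); ring. }
  rewrite E; unfold hw2.
  replace (2 * S N * S N + tri (S N) + (2 * j + 2) * S N)%nat with
    (2 * S N * S N + tri (S N) + (2 * j + 1) * S N + S N)%nat by lia.
  rewrite (pow_add q _ (S N)).
  replace (2 * S N * S N + tri (S N) + (2 * j + 1) * S N)%nat with
    ((2 * N * N + tri N + (2 * j + 2) * N) + (S j + 1 + 2 * N) * 2)%nat
    by (cbn [tri]; lia).
  replace (2 * S j * N)%nat with ((2 * j + 2) * N)%nat by lia.
  rewrite (pow_add q _ ((S j + 1 + 2 * N) * 2)), pow_mult, (pow_add q (S j + 1)).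
  cbn [pow]; ring.
Qed.

(** The difference of the terms of [hw2] and [hw1] carries [(1 - q^r) + a q^(3r) (1 - a q^r)], which
    is split in the same way. *)
Lemma hw2_partial (q : R) (j N : nat) : 0 < q < 1 ->
  rsum (hw2 q j) (S N) = rsum (hw1 q j) (S N) +
    (1 - q ^ (j + 1)) * q ^ (j + 1) * (rsum (hw1 q (S j)) N +
    (-1) ^ N * q ^ (2 * N * N + tri N + (2 * j + 3) * N) * hw_coef q (S j) N).
Proof.
intros Hq; induction N as [|N IH].
- assert (H := hw_coef_0 q j 0 Hq).
  cbn [rsum]; unfold hw1, hw2; simpl (2 * 0)%nat; rewrite !Nat.mul_0_r.
  simpl tri; simpl pow in *; rewrite !Rmult_1_r in *.
  replace ((1 - q ^ (j + 1)) * q ^ (j + 1) * (0 + 1 * hw_coef q (S j) 0)) with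
    (q ^ (j + 1) * ((1 - q ^ (j + 1)) * hw_coef q (S j) 0)) by ring.
  rewrite <- H; ring.
- change (rsum (hw2 q j) (S (S N))) with (rsum (hw2 q j) (S N) + hw2 q j (S N)).
  change (rsum (hw1 q j) (S (S N))) with (rsum (hw1 q j) (S N) + hw1 q j (S N)).
  rewrite IH; cbn [rsum].
  assert (HA := hw_coef_S q j N Hq); assert (HB := hw_coef_0 q j (S N) Hq).
  assert (E : hw2 q j (S N) - hw1 q j (S N) =
    (-1) ^ S N * q ^ (2 * S N * S N + tri (S N) + 2 * j * S N) *
    ((1 - q ^ (j + 1)) * hw_coef q (S j) N + q ^ (j + 1) * q ^ S N * q ^ S N *
     q ^ S N * ((1 - q ^ (j + 1)) * hw_coef q (S j) (S N)))).
  { rewrite <- HA, <- HB; unfold hw1, hw2.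
    replace (2 * S N * S N + tri (S N) + (2 * j + 1) * S N)%nat with
      (2 * S N * S N + tri (S N) + 2 * j * S N + S N)%nat by lia.
    rewrite (pow_add q _ (S N)).
    replace (q ^ (2 * S N)) with (q ^ S N * q ^ S N)
      by (rewrite <- pow_add; f_equal; lia).
    ring. }
  replace (hw2 q j (S N)) with (hw1 q j (S N) + (hw2 q j (S N) - hw1 q j (S N)))
    by ring.
  rewrite E.
  change (hw1 q (S j) N) with ((-1) ^ N *
    q ^ (2 * N * N + tri N + (2 * S j + 1) * N) *
    (1 - q ^ (S j + 1) * q ^ (2 * N)) * hw_coef q (S j) N).
  replace (2 * S N * S N + tri (S N) + (2 * j + 3) * S N)%nat with
    (2 * S N * S N + tri (S N) + 2 * j * S N + S N + S N + S N)%nat by lia.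
  rewrite !(pow_add q _ (S N)).
  replace (2 * S N * S N + tri (S N) + 2 * j * S N)%nat with
    ((2 * N * N + tri N + (2 * S j + 1) * N) + (j + 1) + (j + 2 + 2 * N))%nat
    by (cbn [tri]; lia).
  replace (2 * j + 3)%nat with (2 * S j + 1)%nat by lia.
  replace (S j + 1)%nat with (j + 2)%nat by lia.
  rewrite (pow_add q _ (j + 2 + 2 * N)), (pow_add q _ (j + 1)).
  rewrite (pow_add q (j + 2) (2 * N)).
  replace (q ^ (2 * N)) with (q ^ N * q ^ N)
    by (rewrite <- pow_add; f_equal; lia).
  rewrite !(pow_add q j); cbn [pow]; ring.
Qed.

Lemma hw_coef_bound (q : R) : 0 < q < 1 ->
  exists B, 0 <= B /\ forall j r, 0 <= hw_coef q j r <= B.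
Proof.
intros Hq; destruct (rqpoch_ge q Hq) as [m [Hm H]].
exists (/ (m * m)); split.
{ apply Rlt_le, Rinv_0_lt_compat; nra. }
intros j r; unfold hw_coef.
assert (H1 := H j); assert (H2 := H r).
assert (H3 := rqpoch_pos q (j + r) Hq); assert (H4 := rqpoch_le_1 q (j + r) Hq).
assert (H5 : 0 < / (rqpoch q j * rqpoch q r) <= / (m * m)).
{ split; [apply Rinv_0_lt_compat; nra|].
  apply Rinv_le_contravar; [nra|apply Rmult_le_compat; lra]. }
unfold Rdiv; nra.
Qed.

Lemma pow_le_pow (q : R) (m n : nat) : 0 < q < 1 -> (m <= n)%nat -> q ^ n <= q ^ m.
Proof.
intros Hq H; replace n with (m + (n - m))%nat by lia; rewrite pow_add.
assert (H1 := pow_le_1 q (n - m) ltac:(lra)).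
assert (H2 := pow_le_1 q m ltac:(lra)); nra.
Qed.

Lemma signed_bound (q x c B : R) (e k r : nat) : 0 < q < 1 ->
  (k * r <= e)%nat -> 0 <= x <= 1 -> 0 <= c <= B ->
  Rabs ((-1) ^ r * q ^ e * x * c) <= B * (q ^ k) ^ r.
Proof.
intros Hq He Hx Hc; rewrite !Rabs_mult, Rabs_pow_m1, Rmult_1_l.
assert (H1 := pow_le_1 q e ltac:(lra)).
rewrite !Rabs_pos_eq by lra.
rewrite <- pow_mult; assert (H2 := pow_le_pow q (k * r) e Hq He).
assert (0 <= q ^ e * x <= q ^ (k * r)) by nra.
rewrite (Rmult_comm B); apply Rmult_le_compat; lra.
Qed.

Lemma hw2_bound (q B : R) (j r : nat) : 0 < q < 1 ->
  (forall j r, 0 <= hw_coef q j r <= B) ->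
  Rabs (hw2 q j r) <= B * (q ^ (2 * j + 1)) ^ r.
Proof.
intros Hq HB; unfold hw2; apply signed_bound; auto.
- assert (H := tri_ge r); nia.
- rewrite <- pow_add; assert (H := pow_le_1 q (j + 1 + 2 * r) ltac:(lra)).
  revert H; generalize (q ^ (j + 1 + 2 * r)); intros y H; simpl; nra.
Qed.

Lemma hw1_bound (q B : R) (j r : nat) : 0 < q < 1 ->
  (forall j r, 0 <= hw_coef q j r <= B) -> Rabs (hw1 q j r) <= B * (q ^ 1) ^ r.
Proof.
intros Hq HB; unfold hw1; apply signed_bound; auto.
- assert (H := tri_ge r); nia.
- rewrite <- pow_add; assert (H := pow_le_1 q (j + 1 + 2 * r) ltac:(lra)); lra.
Qed.

Lemma hw_boundary_lim (q : R) (j k : nat) : 0 < q < 1 ->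
  is_lim_seq (fun N => (-1) ^ N * q ^ (2 * N * N + tri N + k * N) * hw_coef q j N) 0.
Proof.
intros Hq; destruct (hw_coef_bound q Hq) as [B [HB Hc]].
apply is_lim_seq_abs_0.
apply (is_lim_seq_le_le (fun _ => 0) _ (fun N => B * q ^ N)).
- intros N; split; [apply Rabs_pos|].
  assert (H := signed_bound q 1 (hw_coef q j N) B
    (2 * N * N + tri N + k * N) 1 N Hq ltac:(assert (H := tri_ge N); nia)
    ltac:(lra) (Hc j N)).
  rewrite Rmult_1_r, pow_1 in H; exact H.
- apply is_lim_seq_const.
- replace (Finite 0) with (Finite (B * 0)) by (f_equal; ring).
  apply is_lim_seq_mult'; [apply is_lim_seq_const|].
  apply is_lim_seq_geom; rewrite Rabs_pos_eq; lra.
Qed.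

Lemma hw2_lim (q : R) (j : nat) : 0 < q < 1 ->
  is_lim_seq (rsum (hw2 q j)) (rser (hw2 q j)).
Proof.
intros Hq; destruct (hw_coef_bound q Hq) as [B [HB Hc]].
apply (rser_lim _ B (q ^ (2 * j + 1))).
- assert (H := pow_lt_1' q (2 * j + 1) Hq ltac:(lia)); lra.
- intros r; now apply hw2_bound.
Qed.

Lemma hw1_lim (q : R) (j : nat) : 0 < q < 1 ->
  is_lim_seq (rsum (hw1 q j)) (rser (hw1 q j)).
Proof.
intros Hq; destruct (hw_coef_bound q Hq) as [B [HB Hc]].
apply (rser_lim _ B (q ^ 1)).
- simpl; lra.
- intros r; now apply hw1_bound.
Qed.

Lemma hw1_eq (q : R) (j : nat) : 0 < q < 1 ->
  rser (hw1 q j) = (1 - q ^ (j + 1)) * rser (hw2 q (S j)).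
Proof.
intros Hq.
apply (is_lim_seq_const_unique (fun N => rsum (hw1 q j) (S N))).
- apply (is_lim_seq_incr_1 (rsum (hw1 q j))), hw1_lim, Hq.
- eapply is_lim_seq_ext; [intros N; symmetry; apply hw1_partial, Hq|].
  apply is_lim_seq_mult'; [apply is_lim_seq_const|].
  rewrite <- (Rplus_0_r (rser _)).
  apply is_lim_seq_plus'; [now apply hw2_lim|now apply hw_boundary_lim].
Qed.

Lemma hw2_eq (q : R) (j : nat) : 0 < q < 1 ->
  rser (hw2 q j) = rser (hw1 q j) +
    (1 - q ^ (j + 1)) * q ^ (j + 1) * rser (hw1 q (S j)).
Proof.
intros Hq.
apply (is_lim_seq_const_unique (fun N => rsum (hw2 q j) (S N))).
- apply (is_lim_seq_incr_1 (rsum (hw2 q j))), hw2_lim, Hq.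
- eapply is_lim_seq_ext; [intros N; symmetry; apply hw2_partial, Hq|].
  apply is_lim_seq_plus'.
  + apply (is_lim_seq_incr_1 (rsum (hw1 q j))), hw1_lim, Hq.
  + apply is_lim_seq_mult'; [apply is_lim_seq_const|].
    rewrite <- (Rplus_0_r (rser _)).
    apply is_lim_seq_plus'; [now apply hw1_lim|now apply hw_boundary_lim].
Qed.

(* [rr_num q j] is, up to the factor [1/(q;q)_oo], the Rogers-Ramanujan series
   [sum_n q^(n^2+jn)/(q;q)_n]. *)
Definition rr_num (q : R) (j : nat) : R := rqpoch q j * rser (hw2 q j).

Lemma rr_num_rec (q : R) (j : nat) : 0 < q < 1 ->
  rr_num q j = rr_num q (S j) + q ^ (j + 1) * rr_num q (S (S j)).
Proof.
intros Hq; unfold rr_num; rewrite hw2_eq, !hw1_eq by auto.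
replace (S j + 1)%nat with (S (S j)) by lia.
replace (j + 1)%nat with (S j) by lia.
cbn [rqpoch]; ring.
Qed.

(** The term of index 0 is at least [1 - q], and the rest of the series is small because its ratio
    [q ^ (2 * j + 1)] tends to 0. *)
Lemma rr_num_pos_large (q : R) : 0 < q < 1 ->
  exists J, forall j, (J <= j)%nat -> 0 < rr_num q j.
Proof.
intros Hq; destruct (hw_coef_bound q Hq) as [B [HB Hc]].
assert (He : 0 < (1 - q) / 2 / (2 * (B + 1))) by (apply Rdiv_lt_0_compat; lra).
destruct (pow_lt_1_zero q ltac:(rewrite Rabs_pos_eq; lra) _ He) as [J HJ].
exists J; intros j Hj; unfold rr_num.
apply Rmult_lt_0_compat; [apply rqpoch_pos, Hq|].
set (rho := q ^ (2 * j + 1)).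
assert (Hrho : 0 < rho <= q).
{ unfold rho; split; [apply pow_lt; lra|].
  rewrite <- (pow_1 q) at 2; apply pow_le_pow; auto; lia. }
assert (Hsmall : rho < (1 - q) / 2 / (2 * (B + 1))).
{ specialize (HJ (2 * j + 1)%nat ltac:(lia)).
  rewrite Rabs_pos_eq in HJ by (apply pow_le; lra); exact HJ. }
assert (Hs : rho * (2 * (B + 1)) < (1 - q) / 2).
{ apply Rmult_lt_compat_r with (r := 2 * (B + 1)) in Hsmall; [|lra].
  replace ((1 - q) / 2 / (2 * (B + 1)) * (2 * (B + 1))) with ((1 - q) / 2)
    in Hsmall by (field; lra); exact Hsmall. }
assert (H0 : hw2 q j 0 >= 1 - q).
{ unfold hw2, hw_coef; rewrite !Nat.mul_0_r, !Nat.add_0_r; simpl tri.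
  simpl pow.
  assert (H1 := rqpoch_pos q j Hq).
  replace (rqpoch q j / (rqpoch q j * rqpoch q 0)) with 1 by (simpl; field; lra).
  assert (H2 : q ^ (j + 1) <= q).
  { rewrite <- (pow_1 q) at 2; apply pow_le_pow; auto; lia. }
  assert (H3 := pow_le_1 q (j + 1) ltac:(lra)).
  revert H2 H3; generalize (q ^ (j + 1)); intros y H2 H3.
  assert (y * y <= q) by nra; lra. }
assert (Hfrac : B * rho ^ 1 / (1 - rho) <= (1 - q) / 2).
{ apply Rmult_le_reg_r with (1 - rho); [lra|].
  unfold Rdiv at 1; rewrite Rmult_assoc, Rinv_l, pow_1 by lra.
  nra. }
assert (H1 : (1 - q) / 2 <= rser (hw2 q j)); [|lra].
apply (is_lim_seq_le (fun _ => (1 - q) / 2) (fun k => rsum (hw2 q j) (1 + k))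
  ((1 - q) / 2) (rser (hw2 q j))).
- intros k.
  assert (Ht := rsum_tail_bound (hw2 q j) B rho 1 k ltac:(lra)
    (fun r => hw2_bound q B j r Hq Hc)).
  apply Rabs_le_between in Ht.
  assert (rsum (hw2 q j) 1 = hw2 q j 0) by (simpl; ring); lra.
- apply is_lim_seq_const.
- apply (is_lim_seq_incr_1 (rsum (hw2 q j))), hw2_lim, Hq.
Qed.

(** Positivity descends from large [j] through the recurrence, whose coefficients are positive. *)
Lemma rr_num_pos (q : R) (j : nat) : 0 < q < 1 -> 0 < rr_num q j.
Proof.
intros Hq; destruct (rr_num_pos_large q Hq) as [J HJ].
assert (H : forall d i, (J <= i + d)%nat -> 0 < rr_num q i /\ 0 < rr_num q (S i)).
{ induction d as [|d IH]; intros i Hi.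
  - split; apply HJ; lia.
  - destruct (IH (S i)) as [H1 H2]; [lia|]; split; auto.
    rewrite rr_num_rec by auto.
    assert (0 < q ^ (i + 1)) by (apply pow_lt; lra); nra. }
apply (H J j); lia.
Qed.

(** The ratio obeys the recursion of [rr_tail] exactly, and both quantities are at least 1, so each
    level of the fraction contracts the error by [q ^ (j + 1) <= q]. *)
Lemma rr_tail_error (q : R) (j n : nat) : 0 < q < 1 ->
  Rabs (rr_num q j / rr_num q (S j) - rr_tail q (j + 1) n) <= q ^ n.
Proof.
intros Hq; revert j; induction n as [|n IH]; intros j.
- assert (H1 := rr_num_pos q (S j) Hq); assert (H2 := rr_num_pos q (S (S j)) Hq).
  assert (H3 := rr_num_pos q (S (S (S j))) Hq).
  assert (H4 := rr_num_rec q (S j) Hq).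
  assert (H5 := pow_le_1 q (j + 1) ltac:(lra)).
  assert (H6 := pow_le_1 q (S j + 1) ltac:(lra)).
  simpl; rewrite rr_num_rec by auto.
  replace ((rr_num q (S j) + q ^ (j + 1) * rr_num q (S (S j))) / rr_num q (S j) - 1)
    with (q ^ (j + 1) * (rr_num q (S (S j)) / rr_num q (S j))) by (field; lra).
  assert (H7 : 0 <= rr_num q (S (S j)) / rr_num q (S j) <= 1).
  { split; [apply Rdiv_le_0_compat; lra|].
    apply Rmult_le_reg_r with (rr_num q (S j)); auto.
    unfold Rdiv; rewrite Rmult_assoc, Rinv_l by lra; nra. }
  rewrite Rabs_pos_eq; nra.
- assert (H1 := rr_num_pos q (S j) Hq); assert (H2 := rr_num_pos q (S (S j)) Hq).
  specialize (IH (S j)); replace (S j + 1)%nat with (S (j + 1)) in IH by lia.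
  assert (H5 := pow_lt_1' q (j + 1) Hq ltac:(lia)).
  assert (H6 := pow_le_pow q 1 (j + 1) Hq ltac:(lia)); rewrite pow_1 in H6.
  assert (Hy := rr_tail_ge1 q (S (j + 1)) n (proj1 Hq)).
  assert (Hx : 1 <= rr_num q (S j) / rr_num q (S (S j))).
  { apply Rmult_le_reg_r with (rr_num q (S (S j))); auto.
    unfold Rdiv; rewrite Rmult_assoc, Rinv_l by lra.
    rewrite (rr_num_rec q (S j)) by auto.
    assert (H3 := rr_num_pos q (S (S (S j))) Hq).
    assert (0 < q ^ (S j + 1)) by (apply pow_lt; lra); nra. }
  cbn [rr_tail].
  replace (rr_num q j / rr_num q (S j)) with
    (1 + q ^ (j + 1) / (rr_num q (S j) / rr_num q (S (S j))))
    by (rewrite (rr_num_rec q j) by auto; field; lra).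
  revert IH Hx Hy; generalize (rr_num q (S j) / rr_num q (S (S j))).
  generalize (rr_tail q (S (j + 1)) n); intros y x IH Hx Hy.
  replace (1 + q ^ (j + 1) / x - (1 + q ^ (j + 1) / y)) with
    (- (q ^ (j + 1) * / (x * y)) * (x - y)) by (field; lra).
  assert (H7 : 0 < / (x * y) <= 1).
  { split; [apply Rinv_0_lt_compat; nra|].
    rewrite <- Rinv_1; apply Rinv_le_contravar; nra. }
  rewrite Rabs_mult, Rabs_Ropp, (Rabs_pos_eq (_ * _)) by nra.
  apply Rmult_le_compat; [nra|apply Rabs_pos|nra|exact IH].
Qed.

Lemma rr_tail_limit (q : R) : 0 < q < 1 ->
  is_lim_seq (rr_tail q 1) (rr_num q 0 / rr_num q 1).
Proof.
intros Hq.
apply is_lim_seq_ext with (fun n => rr_num q 0 / rr_num q 1 -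
  (rr_num q 0 / rr_num q 1 - rr_tail q 1 n)); [intros n; ring|].
replace (rr_num q 0 / rr_num q 1) with (rr_num q 0 / rr_num q 1 - 0) at 1 by ring.
apply is_lim_seq_minus'; [apply is_lim_seq_const|].
apply is_lim_seq_abs_0, (is_lim_seq_le_le (fun _ => 0) _ (fun n => q ^ n)).
- intros n; split; [apply Rabs_pos|apply (rr_tail_error q 0 n Hq)].
- apply is_lim_seq_const.
- apply is_lim_seq_geom; rewrite Rabs_pos_eq; lra.
Qed.

Lemma hw2_theta (q : R) : 0 < q < 1 -> rser (hw2 q 0) = theta (q ^ 3) (q ^ 2).
Proof.
intros Hq; apply rser_ext; intros r; unfold hw2, theta_term, hw_coef.
assert (H1 := rqpoch_pos q r Hq).
replace (rqpoch q (0 + r) / (rqpoch q 0 * rqpoch q r)) with 1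
  by (simpl; field; lra).
rewrite <- !pow_mult, <- pow_add, <- pow_mult.
replace (2 * r * r + tri r + 2 * 0 * r)%nat with (3 * tri r + 2 * tri (pred r))%nat.
- rewrite pow_add; replace ((0 + 1 + 2 * r) * 2)%nat with (2 * (2 * r + 1))%nat by lia.
  ring.
- destruct r as [|r]; [reflexivity|]; cbn [pred tri].
  assert (E : (2 * tri r = r * (r + 1))%nat)
    by (clear; induction r as [|r IH]; cbn [tri]; lia).
  nia.
Qed.

Lemma hw1_theta (q : R) : 0 < q < 1 -> rser (hw1 q 0) = theta (q ^ 4) q.
Proof.
intros Hq; apply rser_ext; intros r; unfold hw1, theta_term, hw_coef.
assert (H1 := rqpoch_pos q r Hq).
replace (rqpoch q (0 + r) / (rqpoch q 0 * rqpoch q r)) with 1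
  by (simpl; field; lra).
rewrite <- !pow_mult, <- pow_add.
replace (2 * r * r + tri r + (2 * 0 + 1) * r)%nat with
  (4 * tri r + tri (pred r))%nat.
- rewrite pow_add; replace (0 + 1 + 2 * r)%nat with (2 * r + 1)%nat by lia.
  ring.
- destruct r as [|r]; [reflexivity|]; cbn [pred tri].
  assert (E : (2 * tri r = r * (r + 1))%nat)
    by (clear; induction r as [|r IH]; cbn [tri]; lia).
  nia.
Qed.

Lemma theta_5_pos (q : R) : 0 < q < 1 ->
  0 < theta (q ^ 4) q /\ 0 < theta (q ^ 3) (q ^ 2).
Proof.
intros Hq; assert (H0 := rr_num_pos q 0 Hq); assert (H1 := rr_num_pos q 1 Hq).
unfold rr_num in H0, H1; rewrite hw2_theta in H0 by auto.
rewrite <- hw1_theta, hw1_eq by auto.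
simpl in *; lra.
Qed.

Lemma rogers_ramanujan_pow5 (q : R) : 0 < q < 1 ->
  rogers_ramanujan q ^ 5 = q * (theta (q ^ 4) q / theta (q ^ 3) (q ^ 2)) ^ 5.
Proof.
intros Hq; destruct (theta_5_pos q Hq) as [H1 H2].
assert (Hc : rr_num q 0 / rr_num q 1 = theta (q ^ 3) (q ^ 2) / theta (q ^ 4) q).
{ unfold rr_num; rewrite hw2_theta, <- hw1_theta, hw1_eq in * by auto.
  simpl in *; field; repeat split; try lra.
  intros E; rewrite E in H1; lra. }
assert (H : is_lim_seq (rr_convergent q)
  (Rpower q (1 / 5) / (rr_num q 0 / rr_num q 1))).
{ apply is_lim_seq_div'; [apply is_lim_seq_const|now apply rr_tail_limit|].
  rewrite Hc; apply Rgt_not_eq, Rdiv_lt_0_compat; auto. }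
unfold rogers_ramanujan; rewrite (is_lim_seq_unique _ _ H), Hc; cbn [real].
replace (Rpower q (1 / 5) / (theta (q ^ 3) (q ^ 2) / theta (q ^ 4) q)) with
  (Rpower q (1 / 5) * (theta (q ^ 4) q / theta (q ^ 3) (q ^ 2)))
  by (field; lra).
rewrite Rpow_mult_distr; f_equal.
rewrite <- Rpower_pow, Rpower_mult by apply exp_pos.
replace (1 / 5 * INR 5) with 1 by (simpl; field); apply Rpower_1; lra.
Qed.

(** * Klein's icosahedral form *)

Lemma nome_RtoC (y : R) : nome (RtoC y) = RtoC (exp (-2 * PI * y)).
Proof. unfold nome; now rewrite <- RtoC_mult, cexp_RtoC. Qed.

Lemma approx_comp_Cinv (g : C -> C) :
  (forall X r, 0 < r < X -> approx (RtoC X) r g) ->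
  forall X r, 0 < r < X -> approx (RtoC X) r (fun z => g (/ z)%C).
Proof.
intros Hg X r Hr; destruct (Cinv_disc X r Hr) as [Y [s [Hs Hin]]].
apply (approx_comp _ (RtoC Y) r s g Cinv); [lra| | |].
- now apply Hg.
- now apply approx_Cinv.
- exact Hin.
Qed.

Definition ctheta_term (i j : nat) (q : C) (k : nat) : C :=
  (RtoC ((-1) ^ k) * (q ^ i) ^ tri k * (q ^ j) ^ tri (pred k) *
    (1 - (q ^ j) ^ (2 * k + 1)))%C.

Definition ctheta (i j : nat) (q : C) : C :=
  climit (fun n => csum (ctheta_term i j q) n).

Lemma ctheta_term_bound (i j k : nat) (q : C) (r : R) :
  (0 < i)%nat -> 0 <= r < 1 -> Cmod q <= r ->
  Cmod (ctheta_term i j q k) <= 2 * r ^ k.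
Proof.
intros Hi Hr Hq; unfold ctheta_term; rewrite !Cmod_mult, Cmod_R, Rabs_pow_m1.
rewrite <- !Cpow_mult_r, !Cmod_pow, Rmult_1_l.
assert (H0 := Cmod_ge_0 q).
assert (H1 : Cmod q ^ (i * tri k) <= r ^ k).
{ apply Rle_trans with (Cmod q ^ k).
  - replace (i * tri k)%nat with (k + (i * tri k - k))%nat
      by (assert (H := tri_ge k); nia).
    rewrite pow_add.
    assert (H2 := pow_le_1 (Cmod q) (i * tri k - k) ltac:(lra)).
    assert (H3 : 0 <= Cmod q ^ k) by (apply pow_le; lra); nra.
  - apply pow_incr; lra. }
assert (H2 := pow_le_1 (Cmod q) (j * tri (pred k)) ltac:(lra)).
assert (H3 := pow_le_1 (Cmod q) (i * tri k) ltac:(lra)).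
assert (H4 : Cmod (1 - q ^ (j * (2 * k + 1))) <= 2).
{ eapply Rle_trans; [apply Cmod_triangle|].
  rewrite Cmod_opp, Cmod_1, Cmod_pow.
  assert (H4 := pow_le_1 (Cmod q) (j * (2 * k + 1)) ltac:(lra)); lra. }
rewrite (Rmult_comm 2).
apply Rmult_le_compat; auto using Cmod_ge_0; [nra|].
rewrite <- (Rmult_1_r (r ^ k)); apply Rmult_le_compat; lra.
Qed.

Lemma ctheta_increment (i j n : nat) (q : C) (r : R) :
  (0 < i)%nat -> 0 <= r < 1 -> Cmod q <= r ->
  Cmod (csum (ctheta_term i j q) (S n) - csum (ctheta_term i j q) n) <= 2 * r ^ n.
Proof.
intros Hi Hr Hq; cbn [csum].
match goal with |- Cmod ?e <= _ =>
  replace e with (ctheta_term i j q n) by ring end.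
now apply ctheta_term_bound.
Qed.

Lemma approx_ctheta (i j : nat) (r : R) : (0 < i)%nat -> 0 <= r < 1 ->
  approx 0 r (ctheta i j).
Proof.
intros Hi Hr; apply (approx_climit 0 r 2 r (fun n q => csum (ctheta_term i j q) n));
  auto.
- intros n; induction n as [|n IH]; cbn [csum]; [apply approx_const|].
  apply approx_plus; auto; unfold ctheta_term.
  repeat apply approx_mult; try lra; try apply approx_const;
    repeat (apply approx_pow; [lra|]); try apply approx_id.
  apply approx_minus; [lra|apply approx_const|].
  repeat (apply approx_pow; [lra|]); apply approx_id.
- intros q n Hq; rewrite Cminus_0_r in Hq; now apply ctheta_increment.
Qed.

Lemma ctheta_RtoC (i j : nat) (q : R) :
  ctheta i j (RtoC q) = RtoC (theta (q ^ i) (q ^ j)).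
Proof.
unfold ctheta, theta, rser; rewrite <- climit_RtoC; apply climit_ext; intros n.
induction n as [|n IH]; [reflexivity|]; cbn [csum rsum].
rewrite IH, RtoC_plus; f_equal; unfold ctheta_term, theta_term.
now rewrite !RtoC_mult, RtoC_minus, !RtoC_pow.
Qed.

Lemma ctheta_0 (i j : nat) : (0 < i)%nat -> (0 < j)%nat -> ctheta i j 0 = 1%C.
Proof.
intros Hi Hj.
assert (Hz : forall m, (0 < m)%nat -> (RtoC 0 ^ m)%C = 0%C).
{ intros [|m] Hm; [lia|]; rewrite Cpow_S; ring. }
apply geom_lim_unique with (fun n => csum (ctheta_term i j 0) n).
- apply geom_lim_climit with 2 0; [lra|].
  intros n; apply ctheta_increment; auto; [lra|rewrite Cmod_0; lra].
- exists 1, 0; split; [lra|]; intros n.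
  destruct n as [|n]; [cbn [csum pow]; rewrite Cminus_0_r, Cmod_1; lra|].
  assert (H : csum (ctheta_term i j 0) (S n) = 1%C).
  { induction n as [|n IH].
    - cbn [csum]; unfold ctheta_term; simpl tri; simpl (2 * 0 + 1)%nat.
      rewrite (Hz j) by auto; simpl; ring.
    - change (csum (ctheta_term i j 0) (S (S n))) with
        (csum (ctheta_term i j 0) (S n) + ctheta_term i j 0 (S n))%C.
      rewrite IH; unfold ctheta_term.
      rewrite (Hz i), (Hz (tri (S n))) by (auto; assert (H := tri_ge (S n)); lia).
      ring. }
  rewrite H; unfold Cminus; rewrite Cplus_opp_r, Cmod_0; simpl; lra.
Qed.

Lemma phi_0 : phi 0 = 1%C.
Proof. rewrite phi_expand by (rewrite Cmod_0; lra); simpl; ring. Qed.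

(* Klein's icosahedral form in the Rogers-Ramanujan functions, divided by
   [eta^12]. *)
Definition cklein (q : C) : C :=
  (ctheta 3 2 q * ctheta 4 1 q *
   (ctheta 3 2 q ^ 10 - 11 * q * ctheta 3 2 q ^ 5 * ctheta 4 1 q ^ 5 -
    q ^ 2 * ctheta 4 1 q ^ 10) * (/ phi q) ^ 12)%C.

Lemma approx_cklein (r : R) : 0 <= r < 1 -> approx 0 r cklein.
Proof.
intros Hr; unfold cklein.
assert (H1 := approx_ctheta 3 2 r ltac:(lia) Hr).
assert (H2 := approx_ctheta 4 1 r ltac:(lia) Hr).
assert (H3 := approx_phi_inv r Hr).
assert (Hid := approx_id 0 r).
repeat first [ apply approx_mult; [lra| |] | apply approx_minus; [lra| |]
  | apply approx_pow; [lra|] | assumption | apply approx_const ].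
Qed.

Lemma cklein_RtoC (y : R) : 0 < y ->
  cklein (RtoC (exp (-2 * PI * y))) = RtoC (klein (rt2 y) (rt1 y) / reta y ^ 12).
Proof.
intros Hy; assert (Hpi := PI_RGT_0).
assert (Hq := exp_neg_lt_1 y Hy).
set (q := exp (-2 * PI * y)) in *.
(* This is [q^(1/40)]. All fractional powers of [q] in the normalised functions are powers of [E],
   and the form and [eta^12] share the factor [E^20]. *)
set (E := exp (- (PI * y / 20))).
assert (HE : E <> 0) by (apply Rgt_not_eq, exp_pos).
assert (H1 : rt1 y = E ^ 9 * theta (q ^ 4) (q ^ 1)).
{ unfold rt1, E; fold q; rewrite exp_pow, pow_1; f_equal; f_equal; simpl; field. }
assert (H2 : rt2 y = E * theta (q ^ 3) (q ^ 2)) by reflexivity.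
assert (H3 : reta y ^ 12 = E ^ 20 * rphi q ^ 12).
{ unfold reta, E; fold q; rewrite Rpow_mult_distr, !exp_pow; f_equal; f_equal.
  simpl; field. }
assert (H4 : q = E ^ 40).
{ unfold q, E; rewrite exp_pow; f_equal; simpl; field. }
assert (Hp := rphi_pos q Hq).
unfold cklein; rewrite !ctheta_RtoC, phi_RtoC, <- RtoC_inv by lra.
rewrite <- !RtoC_pow, <- !RtoC_mult, <- !RtoC_minus, <- !RtoC_mult.
rewrite H1, H2, H3; f_equal; unfold klein.
generalize dependent (theta (q ^ 4) (q ^ 1)); intros T1 _.
generalize dependent (theta (q ^ 3) (q ^ 2)); intros T2 _.
generalize dependent (rphi q); intros P _ Hp.
rewrite H4; field; split; auto; lra.
Qed.

(** Numerator and denominator have the same weight: [K ^ 12 = (g + 3)^6 / (5 y)^6] meets the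
    constants of [klein_golden] and the [y^6] from the inversion of [eta^12]. *)
Lemma real_klein_inversion (y : R) : 0 < y ->
  klein (rt2 y) (rt1 y) / reta y ^ 12 =
  klein (rt2 (/ y)) (rt1 (/ y)) / reta (/ y) ^ 12.
Proof.
intros Hy; assert (Hy' := Rinv_0_lt_compat y Hy).
destruct (rt_inversion y Hy) as [H2 H1].
destruct cos_PI_10 as [g [Hg [Hc3 Hc2]]].
rewrite Hc3 in H1, H2.
set (C := cos (PI / 10)) in *.
set (K := 2 / sqrt (5 * y) * C).
set (X := rt2 (/ y)) in *; set (Y := rt1 (/ y)) in *.
assert (E2 : rt2 y = K * (X + g * Y)) by (rewrite H2; unfold K; ring).
assert (E1 : rt1 y = K * (g * X - Y)) by (rewrite H1; unfold K; ring).
assert (HK : K ^ 12 * (5 * y) ^ 6 = (g + 3) ^ 6).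
{ assert (HS : forall S, S ^ 2 = 5 * y -> 0 < S ->
    (2 / S * C) ^ 12 * (5 * y) ^ 6 = (g + 3) ^ 6).
  { intros S HS HS0; rewrite <- HS.
    transitivity ((4 * C ^ 2) ^ 6); [field; lra|rewrite Hc2; field]. }
  apply HS; [apply pow2_sqrt; lra|apply sqrt_lt_R0; lra]. }
assert (He : reta y ^ 12 * y ^ 6 = reta (/ y) ^ 12).
{ assert (HS : forall S, S ^ 2 = y -> 0 < S ->
    (reta (/ y) / S) ^ 12 * y ^ 6 = reta (/ y) ^ 12).
  { intros S HS HS0; rewrite <- HS at 2; field; lra. }
  rewrite (reta_inversion y Hy).
  apply HS; [apply pow2_sqrt; lra|apply sqrt_lt_R0; lra]. }
assert (Hk := klein_golden g X Y Hg).
assert (Hhom : klein (K * (X + g * Y)) (K * (g * X - Y)) =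
  K ^ 12 * klein (X + g * Y) (g * X - Y)) by (unfold klein; ring).
assert (Hp := reta_pos y Hy); assert (Hp' := reta_pos (/ y) Hy').
rewrite E1, E2, Hhom.
apply Rmult_eq_reg_r with (reta (/ y) ^ 12 * 5 ^ 6).
2:{ apply Rmult_integral_contrapositive; split; apply pow_nonzero; lra. }
replace (klein X Y / reta (/ y) ^ 12 * (reta (/ y) ^ 12 * 5 ^ 6)) with
  (5 ^ 6 * klein X Y) by (field; lra).
rewrite <- Hk, <- HK, <- He; field; lra.
Qed.

Lemma cklein_inversion (z : C) : 0 < fst z ->
  cklein (nome z) = cklein (nome (/ z)).
Proof.
intros Hz.
assert (H : (cklein (nome z) - cklein (nome (/ z)))%C = 0%C).
{ apply (right_half_identity (fun z => cklein (nome z) - cklein (nome (/ z)))%C); auto.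
  - intros X r Hr; apply approx_minus; [lra| |].
    + apply approx_comp_nome; auto; apply approx_cklein.
    + apply (approx_comp_Cinv (fun z => cklein (nome z))); auto.
      intros Y s Hs; apply approx_comp_nome; auto; apply approx_cklein.
  - intros x Hx; assert (Hx' := Rinv_0_lt_compat x Hx).
    rewrite <- RtoC_inv, !nome_RtoC, !cklein_RtoC, real_klein_inversion
      by (auto; lra).
    apply Cplus_opp_r. }
replace (cklein (nome z)) with
  (cklein (nome z) - cklein (nome (/ z)) + cklein (nome (/ z)))%C by ring.
rewrite H; ring.
Qed.

Lemma snd_neg_inv (t : C) : 0 < snd t ->
  snd (- / t)%C = snd t / (fst t ^ 2 + snd t ^ 2).
Proof.
intros Ht; destruct t as [x y]; simpl in *; field; nra.
Qed.

Lemma upper_neq_0 (t : C) : 0 < snd t -> t <> 0%C.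
Proof. intros H E; rewrite E in H; simpl in H; lra. Qed.

Lemma Ci_mult_Ci : (Ci * Ci)%C = (- (1))%C.
Proof. unfold Ci, Cmult, Copp, RtoC; simpl; f_equal; ring. Qed.

Lemma rotate_neg_inv (t : C) : t <> 0%C -> (- (Ci * - / t))%C = (/ - (Ci * t))%C.
Proof.
intros Ht.
assert (HCi : Ci <> 0%C) by (intros H; injection H; lra).
transitivity ((Ci * Ci) * / (Ci * t))%C; [field; auto|].
rewrite Ci_mult_Ci; field; auto.
Qed.

Lemma klein_constant (t : C) : 0 < snd t -> cklein (qq t) = 1%C.
Proof.
intros Ht.
assert (H : (cklein (qq t) - 1)%C = 0%C).
(* With real part at most [1/2] in absolute value and imaginary part below [1/2], the squared
   modulus is at most [1/2], so inversion at least doubles the imaginary part. *)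
{ apply (vanish_of_reduction (fun q => cklein q - 1)%C (- (1 / 2)) (1 / 2) 2); auto;
    try lra.
  - intros r Hr; apply approx_minus; [lra|now apply approx_cklein|].
    apply approx_const.
  - unfold cklein; rewrite !ctheta_0, phi_0 by lia; field.
  - intros s Hs Hre; exists (- / s)%C; split.
    + unfold qq; rewrite rotate_neg_inv by (apply upper_neq_0; lra).
      rewrite cklein_inversion; auto; simpl; lra.
    + rewrite snd_neg_inv by lra.
      assert (Hn : 0 < fst s ^ 2 + snd s ^ 2 <= 1 / 2) by nra.
      apply Rmult_le_reg_r with (fst s ^ 2 + snd s ^ 2); [lra|].
      unfold Rdiv; rewrite Rmult_assoc, (Rmult_assoc (snd s)), Rinv_l by lra.
      nra. }
replace (cklein (qq t)) with (cklein (qq t) - 1 + 1)%C by ring.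
rewrite H; ring.
Qed.

Lemma klein_real (y : R) : 0 < y -> klein (rt2 y) (rt1 y) = reta y ^ 12.
Proof.
intros Hy; assert (H := klein_constant (0, y) Hy).
assert (E : qq (0, y) = RtoC (exp (-2 * PI * y))).
{ rewrite <- nome_RtoC; unfold qq; f_equal.
  unfold Ci, Cmult, Copp, RtoC; simpl; f_equal; ring. }
rewrite E, cklein_RtoC in H by auto; apply RtoC_inj in H.
assert (Hp := reta_pos y Hy).
rewrite <- (Rmult_1_l (reta y ^ 12)), <- H; field; lra.
Qed.

(** For [X = rt2 y], [Y = rt1 y] and [r = (Y / X)^5], the quotient [klein X Y / (X Y)^6] is
    [/ r - 11 - r]. Here [klein X Y] is [eta(tau)^12], and [X Y = eta(tau) eta(5 tau)] by
    [theta5_mult]. *)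
Lemma rogers_ramanujan_eta (y : R) : 0 < y ->
  let r := rogers_ramanujan (exp (-2 * PI * y)) ^ 5 in
  0 < r /\ / r - 11 - r = (reta y / reta (5 * y)) ^ 6.
Proof.
intros Hy r; assert (Hq := exp_neg_lt_1 y Hy).
destruct (theta_5_pos _ Hq) as [Ht1 Ht2].
assert (Hmul := theta5_mult _ Hq).
assert (Hpi := PI_RGT_0).
set (q := exp (-2 * PI * y)) in *.
assert (H1 : 0 < rt1 y) by (apply Rmult_lt_0_compat; [apply exp_pos|auto]).
assert (H2 : 0 < rt2 y) by (apply Rmult_lt_0_compat; [apply exp_pos|auto]).
assert (H12 : rt1 y * rt2 y = reta y * reta (5 * y)).
{ unfold rt1, rt2, reta; fold q.
  replace (exp (-2 * PI * (5 * y))) with (q ^ 5)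
    by (unfold q; rewrite exp_pow; f_equal; simpl; ring).
  replace (exp (- (9 * PI * y / 20)) * theta (q ^ 4) q *
    (exp (- (PI * y / 20)) * theta (q ^ 3) (q ^ 2))) with
    (exp (- (9 * PI * y / 20)) * exp (- (PI * y / 20)) *
      (theta (q ^ 4) q * theta (q ^ 3) (q ^ 2))) by ring.
  rewrite Hmul.
  replace (exp (- (PI * y / 12)) * rphi q * (exp (- (PI * (5 * y) / 12)) * rphi (q ^ 5)))
    with (exp (- (PI * y / 12)) * exp (- (PI * (5 * y) / 12)) *
      (rphi q * rphi (q ^ 5))) by ring.
  rewrite <- !exp_plus; f_equal; f_equal; field. }
assert (Hr : r = (rt1 y / rt2 y) ^ 5).
{ unfold r; rewrite rogers_ramanujan_pow5 by auto.
  unfold rt1, rt2; fold q.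
  replace (exp (- (9 * PI * y / 20)) * theta (q ^ 4) q /
    (exp (- (PI * y / 20)) * theta (q ^ 3) (q ^ 2))) with
    (exp (- (2 * PI * y / 5)) * (theta (q ^ 4) q / theta (q ^ 3) (q ^ 2))).
  - rewrite Rpow_mult_distr, exp_pow; f_equal; unfold q; f_equal.
    simpl; field.
  - replace (- (9 * PI * y / 20)) with (- (2 * PI * y / 5) + - (PI * y / 20))
      by field.
    rewrite exp_plus; assert (He := exp_pos (- (PI * y / 20))).
    field; lra. }
assert (Hr0 : 0 < r).
{ rewrite Hr; apply pow_lt, Rdiv_lt_0_compat; auto. }
split; auto.
assert (Hk := klein_real y Hy); unfold klein in Hk.
assert (He1 := reta_pos y Hy); assert (He5 := reta_pos (5 * y) ltac:(lra)).
replace (reta y / reta (5 * y)) with (reta y ^ 2 / (rt1 y * rt2 y))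
  by (rewrite H12; field; lra).
replace ((reta y ^ 2 / (rt1 y * rt2 y)) ^ 6) with
  (reta y ^ 12 / (rt1 y * rt2 y) ^ 6) by (field; lra).
rewrite <- Hk, Hr; field; lra.
Qed.

(** * The transformation law of eta *)

(** The square of eta has weight 1, so its inversion has the factor [z] and no branch of a square
    root is to be chosen. *)
Definition eta2_half (z : C) : C := (cexp (RtoC (- PI / 6) * z) * phi (nome z) ^ 2)%C.

(* [eta2 tau] is the square of the Dedekind eta function. *)
Definition eta2 (t : C) : C := eta2_half (- (Ci * t)).

Lemma approx_scaled_cexp (k X r : R) : 0 < r < X ->
  approx (RtoC X) r (fun z => cexp (RtoC k * z)).
Proof.
intros Hr.
destruct (approx_bounded (RtoC X) r (fun z => RtoC k * z)%C)
  as [B [HB HBz]]; [lra| |].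
- apply approx_mult; [lra|apply approx_const|apply approx_id].
- apply (approx_comp _ 0 r B cexp (fun z => RtoC k * z)%C); [lra| | |].
  + apply approx_cexp; lra.
  + apply approx_mult; [lra|apply approx_const|apply approx_id].
  + intros z Hz; rewrite Cminus_0_r; auto.
Qed.

Lemma approx_eta2_half (X r : R) : 0 < r < X -> approx (RtoC X) r eta2_half.
Proof.
intros Hr; unfold eta2_half; apply approx_mult; [lra|now apply approx_scaled_cexp|].
apply approx_pow; [lra|]; apply approx_comp_nome; auto; apply approx_phi.
Qed.

Lemma eta2_half_RtoC (y : R) : 0 < y -> eta2_half (RtoC y) = RtoC (reta y ^ 2).
Proof.
intros Hy; unfold eta2_half, reta.
rewrite nome_RtoC, phi_RtoC, <- RtoC_mult, cexp_RtoC, <- RtoC_pow, <- RtoC_mult.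
rewrite Rpow_mult_distr, exp_pow; do 3 f_equal; simpl; field.
Qed.

Lemma reta_inversion_sqr (y : R) : 0 < y -> reta (/ y) ^ 2 = y * reta y ^ 2.
Proof.
intros Hy; rewrite (reta_inversion y Hy).
assert (HS : forall S, S ^ 2 = y -> 0 < S ->
  reta (/ y) ^ 2 = y * (reta (/ y) / S) ^ 2).
{ intros S HS HS0; rewrite <- HS at 2; field; lra. }
apply HS; [apply pow2_sqrt; lra|apply sqrt_lt_R0; lra].
Qed.

Lemma eta2_half_inversion (z : C) : 0 < fst z ->
  eta2_half (/ z) = (z * eta2_half z)%C.
Proof.
intros Hz.
assert (H : (eta2_half (/ z) - z * eta2_half z)%C = 0%C).
{ apply (right_half_identity (fun z => eta2_half (/ z) - z * eta2_half z)%C); auto.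
  - intros X r Hr; apply approx_minus; [lra| |].
    + apply (approx_comp_Cinv eta2_half); auto; apply approx_eta2_half.
    + apply approx_mult; [lra|apply approx_id|now apply approx_eta2_half].
  - intros x Hx; assert (Hx' := Rinv_0_lt_compat x Hx).
    rewrite <- RtoC_inv, !eta2_half_RtoC, reta_inversion_sqr, RtoC_mult
      by (auto; lra).
    apply Cplus_opp_r. }
replace (eta2_half (/ z)) with
  (eta2_half (/ z) - z * eta2_half z + z * eta2_half z)%C by ring.
rewrite H; ring.
Qed.

(** The multiplier of [eta^2] under [tau -> tau + 1]; the inversion contributes [- i], its ninth
    power. *)
Definition zeta12 : C := cis (PI / 6).

Lemma zeta12_12 : (zeta12 ^ 12)%C = 1%C.
Proof.
unfold zeta12; rewrite cis_pow, <- (cis_2kPI 1); f_equal; simpl; field.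
Qed.

Lemma zeta12_mod (k : nat) : (zeta12 ^ (k mod 12))%C = (zeta12 ^ k)%C.
Proof.
rewrite (Nat.div_mod_eq k 12) at 2.
rewrite Cpow_add_r, Cpow_mult_r, zeta12_12, Cpow_1_l; ring.
Qed.

Lemma zeta12_9 : (zeta12 ^ 9)%C = (- Ci)%C.
Proof.
unfold zeta12; rewrite cis_pow.
replace (INR 9 * (PI / 6)) with (3 * (PI / 2)) by (simpl; field).
unfold cis; rewrite cos_3PI2, sin_3PI2.
unfold Ci, Copp; simpl; f_equal; ring.
Qed.

Lemma zeta12_Z (n : Z) : (zeta12 ^ Z.to_nat (n mod 12))%C = cis (IZR n * (PI / 6)).
Proof.
unfold zeta12; rewrite cis_pow, INR_IZR_INZ, Z2Nat.id
  by (apply Z.mod_pos_bound; lia).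
rewrite (Z.div_mod n 12) at 2 by lia.
rewrite plus_IZR, mult_IZR.
replace ((12 * IZR (n / 12) + IZR (n mod 12)) * (PI / 6)) with
  (IZR (n / 12) * (2 * PI) + IZR (n mod 12) * (PI / 6)) by field.
rewrite cis_plus, cis_2nPI; ring.
Qed.

Lemma eta2_shift (t : C) (n : Z) :
  eta2 (t + RtoC (IZR n)) = (zeta12 ^ Z.to_nat (n mod 12) * eta2 t)%C.
Proof.
rewrite zeta12_Z; unfold eta2, eta2_half.
change (nome (- (Ci * (t + RtoC (IZR n))))) with (qq (t + RtoC (IZR n))).
rewrite qq_shift; unfold qq.
replace (cexp (RtoC (- PI / 6) * - (Ci * (t + RtoC (IZR n))))) with
  (cexp (RtoC (- PI / 6) * - (Ci * t)) * cis (IZR n * (PI / 6)))%C; [ring|].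
rewrite Cmult_plus_distr_l, Copp_plus_distr, Cmult_plus_distr_l, cexp_plus.
f_equal; unfold cexp; simpl.
match goal with |- _ = (RtoC (exp ?a) * cis ?b)%C =>
  replace a with 0 by ring; replace b with (IZR n * (PI / 6)) by field end.
rewrite exp_0; ring.
Qed.

Lemma eta2_inversion (t : C) : 0 < snd t ->
  eta2 (- / t) = (zeta12 ^ 9 * t * eta2 t)%C.
Proof.
intros Ht; unfold eta2.
rewrite rotate_neg_inv by now apply upper_neq_0.
rewrite eta2_half_inversion by (simpl; lra).
rewrite zeta12_9; ring.
Qed.

(** * The transformation law along words in the modular group *)

Definition ZtoC (n : Z) : C := RtoC (IZR n).

Lemma ZtoC_plus (m n : Z) : ZtoC (m + n) = (ZtoC m + ZtoC n)%C.
Proof. unfold ZtoC; now rewrite plus_IZR, RtoC_plus. Qed.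

Lemma ZtoC_mult (m n : Z) : ZtoC (m * n) = (ZtoC m * ZtoC n)%C.
Proof. unfold ZtoC; now rewrite mult_IZR, RtoC_mult. Qed.

Lemma ZtoC_opp (m : Z) : ZtoC (- m) = (- ZtoC m)%C.
Proof. unfold ZtoC; now rewrite opp_IZR, RtoC_opp. Qed.

Lemma linear_neq_0 (c d : R) (t : C) :
  0 < snd t -> c <> 0 \/ d <> 0 -> (RtoC c * t + RtoC d)%C <> 0%C.
Proof.
intros Ht Hcd E; destruct t as [x y]; unfold Cmult, Cplus, RtoC in E; simpl in *.
injection E; intros E2 E1.
assert (Hc : c = 0) by (apply Rmult_eq_reg_r with y; lra).
subst c; destruct Hcd; lra.
Qed.

Lemma snd_mobius (a b c d : R) (t : C) : 0 < snd t -> c <> 0 \/ d <> 0 ->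
  snd ((RtoC a * t + RtoC b) / (RtoC c * t + RtoC d))%C =
  (a * d - b * c) * snd t / ((c * fst t + d) ^ 2 + (c * snd t) ^ 2).
Proof.
intros Ht Hcd; destruct t as [x y]; simpl in *.
assert (0 < (c * x + d) ^ 2 + (c * y) ^ 2).
{ destruct (Req_dec c 0) as [->|Hc].
  - destruct Hcd; [lra|]; nra.
  - assert (0 < (c * y) ^ 2) by (apply pow2_gt_0, Rmult_integral_contrapositive; lra).
    assert (0 <= (c * x + d) ^ 2) by apply pow2_ge_0; lra. }
field; nra.
Qed.

Definition eta2_law (a b c d : Z) (k : nat) : Prop :=
  (a * d - b * c = 1)%Z /\ forall t, 0 < snd t ->
  eta2 ((ZtoC a * t + ZtoC b) / (ZtoC c * t + ZtoC d)) =
  (zeta12 ^ k * (ZtoC c * t + ZtoC d) * eta2 t)%C.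

Lemma det1_neq (a b c d : Z) : (a * d - b * c = 1)%Z -> IZR c <> 0 \/ IZR d <> 0.
Proof.
intros H; destruct (Z.eq_dec c 0) as [->|Hc].
- right; intros E; apply (eq_IZR _ 0) in E; subst d; lia.
- left; intros E; apply Hc; now apply (eq_IZR _ 0).
Qed.

Lemma eta2_law_T (m : Z) : eta2_law 1 m 0 1 (Z.to_nat (m mod 12)).
Proof.
split; [lia|]; intros t Ht; unfold ZtoC.
replace ((1 * t + RtoC (IZR m)) / (0 * t + 1))%C with (t + RtoC (IZR m))%C by field.
rewrite eta2_shift; ring.
Qed.

Lemma eta2_law_ST (n a b c d : Z) (k : nat) : eta2_law a b c d k ->
  eta2_law (n * a - c) (n * b - d) a b ((Z.to_nat (n mod 12) + 9 + k) mod 12).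
Proof.
intros [Hdet H]; split; [lia|]; intros t Ht.
assert (Hcd := linear_neq_0 (IZR c) (IZR d) t Ht (det1_neq a b c d Hdet)).
assert (Hab : (ZtoC a * t + ZtoC b)%C <> 0%C)
  by (apply linear_neq_0; auto; apply (det1_neq (- c) (- d)); lia).
fold (ZtoC c) (ZtoC d) in Hcd.
set (s := ((ZtoC a * t + ZtoC b) / (ZtoC c * t + ZtoC d))%C).
assert (Hs : 0 < snd s).
{ unfold s, ZtoC; rewrite snd_mobius by (auto; now apply (det1_neq a b)).
  assert (E : IZR a * IZR d - IZR b * IZR c = 1)
    by (rewrite <- !mult_IZR, <- minus_IZR; f_equal; lia).
  rewrite E; apply Rdiv_lt_0_compat; [lra|].
  assert (Hz := det1_neq a b c d Hdet).
  destruct (Req_dec (IZR c) 0) as [E0|Hc].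
  - rewrite E0 in *; destruct Hz; [lra|].
    assert (0 < IZR d ^ 2) by (apply pow2_gt_0; auto); nra.
  - assert (0 < (IZR c * snd t) ^ 2)
      by (apply pow2_gt_0, Rmult_integral_contrapositive; lra).
    assert (0 <= (IZR c * fst t + IZR d) ^ 2) by apply pow2_ge_0; lra. }
replace ((ZtoC (n * a - c) * t + ZtoC (n * b - d)) / (ZtoC a * t + ZtoC b))%C with
  (- / s + RtoC (IZR n))%C.
2:{ unfold Z.sub; rewrite !ZtoC_plus, !ZtoC_mult, !ZtoC_opp.
    change (RtoC (IZR n)) with (ZtoC n); unfold s; field; auto. }
rewrite eta2_shift, eta2_inversion by auto.
unfold s at 2; rewrite H by auto.
rewrite zeta12_mod, !Cpow_add_r; unfold s; field; auto.
Qed.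

(* [word_law w m] is the matrix [T^n1 S T^n2 S ... T^m] for [w = [n1; n2; ...]],
   followed by its exponent in the transformation law of [eta2]. *)
Fixpoint word_law (w : list Z) (m : Z) : Z * Z * Z * Z * nat :=
  match w with
  | nil => (1, m, 0, 1, Z.to_nat (m mod 12))%Z
  | n :: w =>
    let '(a, b, c, d, k) := word_law w m in
    ((n * a - c)%Z, (n * b - d)%Z, a, b, ((Z.to_nat (n mod 12) + 9 + k) mod 12)%nat)
  end.

Lemma eta2_word (w : list Z) (m : Z) :
  let '(a, b, c, d, k) := word_law w m in eta2_law a b c d k.
Proof.
induction w as [|n w IH]; simpl; [apply eta2_law_T|].
destruct (word_law w m) as [[[[a b] c] d] k]; now apply eta2_law_ST.
Qed.

Lemma eta2_at (a b c d : Z) (k : nat) (t s : C) : eta2_law a b c d k ->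
  0 < snd t -> s = ((ZtoC a * t + ZtoC b) / (ZtoC c * t + ZtoC d))%C ->
  eta2 s = (zeta12 ^ k * (ZtoC c * t + ZtoC d) * eta2 t)%C.
Proof. intros [_ H] Ht ->; auto. Qed.

(** Divided by [(abcd)^(3/2)], the equation [G1 p e = 0] reads [x + p/x = y^3 + 1/y^3 - e (y + 1/y)]
    with [x^2 = ab/(cd)] and [y^2 = ad/(bc)]. It is used at level 10 with [p = 5], [e = 0] and at
    level 26 with [p = 13], [e = 4]. *)
Definition G1 (p e a b c d : C) : C :=
  (a ^ 2 * b ^ 2 * c * d + p * a * b * c ^ 2 * d ^ 2 - b ^ 3 * c ^ 3 -
   a ^ 3 * d ^ 3 + e * (a * b ^ 2 * c ^ 2 * d + a ^ 2 * b * c * d ^ 2))%C.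

(** Divided by [(abcd)^3], this relates the same [y] to the third quotient [bd/(ac)]. *)
Definition G2 (a b c d : C) : C :=
  (b ^ 6 * c ^ 6 + a ^ 6 * d ^ 6 - 10 * (a * b * c * d) ^ 3 -
   a ^ 5 * c ^ 5 * b * d - 16 * b ^ 5 * d ^ 5 * a * c)%C.

(* The Atkin-Lehner involution [tau -> -1/(2p tau)] reverses the four values. *)
Lemma fricke_laws (p : R) (t : C) : 0 < p -> 0 < snd t ->
  let t' := (- / (RtoC (2 * p) * t))%C in
  eta2 t' = (zeta12 ^ 9 * (2 * p * t) * eta2 (RtoC (2 * p) * t))%C /\
  eta2 (2 * t') = (zeta12 ^ 9 * (p * t) * eta2 (RtoC p * t))%C /\
  eta2 (RtoC p * t') = (zeta12 ^ 9 * (2 * t) * eta2 (2 * t))%C /\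
  eta2 (RtoC (2 * p) * t') = (zeta12 ^ 9 * t * eta2 t)%C.
Proof.
intros Hp Ht t'.
assert (Ht0 := upper_neq_0 t Ht).
assert (HpC : RtoC p <> 0%C) by (intros H; apply RtoC_inj in H; lra).
assert (Hs : forall x : R, 0 < x -> 0 < snd (RtoC x * t)%C)
  by (intros x Hx; simpl; nra).
unfold t'; rewrite RtoC_mult; repeat split.
- rewrite eta2_inversion; [ring|].
  rewrite <- RtoC_mult; apply Hs; lra.
- replace (2 * - / (2 * p * t))%C with (- / (p * t))%C by (field; auto).
  rewrite eta2_inversion; [ring|now apply Hs].
- replace (p * - / (2 * p * t))%C with (- / (2 * t))%C by (field; auto).
  rewrite eta2_inversion; [ring|apply Hs; lra].
- replace (2 * p * - / (2 * p * t))%C with (- / t)%C by (field; auto).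
  rewrite eta2_inversion; auto.
Qed.

Lemma scaled_upper (x : R) (t : C) : 0 < x -> 0 < snd t -> 0 < snd (RtoC x * t)%C.
Proof. intros Hx Ht; simpl; nra. Qed.

Ltac eta2_by_word w m s :=
  let H := fresh in
  assert (H := eta2_word w m);
  let l := eval vm_compute in (word_law w m) in
  change (word_law w m) with l in H; cbv beta iota in H;
  rewrite (eta2_at _ _ _ _ _ s _ H);
  [ clear H; unfold ZtoC; cbv beta
  | first [assumption | apply scaled_upper; [lra|assumption]]
  | clear H; unfold ZtoC; cbv beta ].

Lemma RtoC_neq_0 (x : R) : x <> 0 -> RtoC x <> 0%C.
Proof. intros H E; apply H, RtoC_inj, E. Qed.

Ltac multiple_neq_0 HJ J :=
  cbv beta; match goal with |- ?e <> _ =>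
    first [ exact HJ
      | apply RtoC_neq_0; lra
      | replace e with (2 * J)%C by ring; apply Cmult_neq_0;
        [apply RtoC_neq_0; lra|exact HJ]
      | replace e with (5 * J)%C by ring; apply Cmult_neq_0;
        [apply RtoC_neq_0; lra|exact HJ]
      | replace e with (13 * J)%C by ring; apply Cmult_neq_0;
        [apply RtoC_neq_0; lra|exact HJ]
      | replace e with J by ring; exact HJ ] end.

(** The Atkin-Lehner involution [W_5] of level 10. The multiples of [t'] by 1, 2, 5, 10 are images
    of [5 t], [10 t], [t], [2 t] under integral matrices of determinant 1, whose multipliers are
    read off words in the generators. *)
Lemma w5_laws (t : C) : 0 < snd t ->
  let t' := ((5 * t + (-3)) / (10 * t + (-5)))%C in
  eta2 t' = (zeta12 ^ 7 * (5 * (2 * t + (-1))) * eta2 (5 * t))%C /\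
  eta2 (2 * t') = (zeta12 ^ 5 * (5 * (2 * t + (-1))) * eta2 (10 * t))%C /\
  eta2 (5 * t') = (zeta12 ^ 11 * ((2 * t + (-1))) * eta2 t)%C /\
  eta2 (10 * t') = (zeta12 ^ 1 * ((2 * t + (-1))) * eta2 (2 * t))%C.
Proof.
intros Ht t'.
assert (HJ : (2 * t + (-1))%C <> 0%C) by (apply linear_neq_0; auto; lra).
split; [|split; [|split]].
(* Two leading zeros of a word stand for [S^2 = - 1] and fix the sign of the matrix. *)
- eta2_by_word (0 :: 0 :: 0 :: (-2) :: nil)%Z ((-3))%Z (5 * t)%C; [ring|unfold t'; field;
  repeat split; multiple_neq_0 HJ (2 * t + (-1))%C].
- eta2_by_word (1 :: nil)%Z ((-5))%Z (10 * t)%C; [ring|unfold t'; field;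
  repeat split; multiple_neq_0 HJ (2 * t + (-1))%C].
- eta2_by_word (0 :: 0 :: 2 :: (-2) :: nil)%Z ((-1))%Z t; [ring|unfold t'; field;
  repeat split; multiple_neq_0 HJ (2 * t + (-1))%C].
- eta2_by_word (5 :: nil)%Z ((-1))%Z (2 * t)%C; [ring|unfold t'; field;
  repeat split; multiple_neq_0 HJ (2 * t + (-1))%C].
Qed.

(** The involution [W_13] of level 26, with isometric circle around [1/2]. *)
Lemma w13_laws (t : C) : 0 < snd t ->
  let t' := ((13 * t + (-7)) / (26 * t + (-13)))%C in
  eta2 t' = (zeta12 ^ 3 * (13 * (2 * t + (-1))) * eta2 (13 * t))%C /\
  eta2 (2 * t') = (zeta12 ^ 9 * (13 * (2 * t + (-1))) * eta2 (26 * t))%C /\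
  eta2 (13 * t') = (zeta12 ^ 3 * ((2 * t + (-1))) * eta2 t)%C /\
  eta2 (26 * t') = (zeta12 ^ 9 * ((2 * t + (-1))) * eta2 (2 * t))%C.
Proof.
intros Ht t'.
assert (HJ : (2 * t + (-1))%C <> 0%C) by (apply linear_neq_0; auto; lra).
split; [|split; [|split]].
- eta2_by_word (0 :: 0 :: 0 :: (-2) :: nil)%Z ((-7))%Z (13 * t)%C; [ring|unfold t'; field;
  repeat split; multiple_neq_0 HJ (2 * t + (-1))%C].
- eta2_by_word (1 :: nil)%Z ((-13))%Z (26 * t)%C; [ring|unfold t'; field;
  repeat split; multiple_neq_0 HJ (2 * t + (-1))%C].
- eta2_by_word (0 :: 0 :: 6 :: (-2) :: nil)%Z ((-1))%Z t; [ring|unfold t'; field;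
  repeat split; multiple_neq_0 HJ (2 * t + (-1))%C].
- eta2_by_word (13 :: nil)%Z ((-1))%Z (2 * t)%C; [ring|unfold t'; field;
  repeat split; multiple_neq_0 HJ (2 * t + (-1))%C].
Qed.

(** A matrix of determinant 2 for [W_2] of level 26, with pole at [3/13]; the three after it have
    their poles at [-3/13], [4/13] and [-4/13]. Their circles fill the gaps between those of the
    Fricke involution and of [W_13]. *)
Lemma w2_3_laws (t : C) : 0 < snd t ->
  let t' := ((4 * t + (-1)) / (26 * t + (-6)))%C in
  eta2 t' = (zeta12 ^ 5 * (2 * (13 * t + (-3))) * eta2 (2 * t))%C /\
  eta2 (2 * t') = (zeta12 ^ 10 * ((13 * t + (-3))) * eta2 t)%C /\
  eta2 (13 * t') = (zeta12 ^ 5 * (2 * (13 * t + (-3))) * eta2 (26 * t))%C /\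
  eta2 (26 * t') = (zeta12 ^ 10 * ((13 * t + (-3))) * eta2 (13 * t))%C.
Proof.
intros Ht t'.
assert (HJ : (13 * t + (-3))%C <> 0%C) by (apply linear_neq_0; auto; lra).
split; [|split; [|split]].
- eta2_by_word (0 :: 0 :: 0 :: (-6) :: 2 :: nil)%Z (0)%Z (2 * t)%C; [ring|unfold t'; field;
  repeat split; multiple_neq_0 HJ (13 * t + (-3))%C].
- eta2_by_word (0 :: 0 :: 0 :: (-3) :: 4 :: nil)%Z (0)%Z t; [ring|unfold t'; field;
  repeat split; multiple_neq_0 HJ (13 * t + (-3))%C].
- eta2_by_word (2 :: nil)%Z ((-6))%Z (26 * t)%C; [ring|unfold t'; field;
  repeat split; multiple_neq_0 HJ (13 * t + (-3))%C].
- eta2_by_word (4 :: nil)%Z ((-3))%Z (13 * t)%C; [ring|unfold t'; field;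
  repeat split; multiple_neq_0 HJ (13 * t + (-3))%C].
Qed.

Lemma w2_m3_laws (t : C) : 0 < snd t ->
  let t' := (((-4) * t + (-1)) / (26 * t + 6))%C in
  eta2 t' = (zeta12 ^ 1 * (2 * (13 * t + 3)) * eta2 (2 * t))%C /\
  eta2 (2 * t') = (zeta12 ^ 8 * ((13 * t + 3)) * eta2 t)%C /\
  eta2 (13 * t') = (zeta12 ^ 1 * (2 * (13 * t + 3)) * eta2 (26 * t))%C /\
  eta2 (26 * t') = (zeta12 ^ 8 * ((13 * t + 3)) * eta2 (13 * t))%C.
Proof.
intros Ht t'.
assert (HJ : (13 * t + 3)%C <> 0%C) by (apply linear_neq_0; auto; lra).
split; [|split; [|split]].
- eta2_by_word (0 :: 0 :: 0 :: 6 :: (-2) :: nil)%Z (0)%Z (2 * t)%C; [ring|unfold t'; field;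
  repeat split; multiple_neq_0 HJ (13 * t + 3)%C].
- eta2_by_word (0 :: 0 :: 0 :: 3 :: (-4) :: nil)%Z (0)%Z t; [ring|unfold t'; field;
  repeat split; multiple_neq_0 HJ (13 * t + 3)%C].
- eta2_by_word ((-2) :: nil)%Z (6)%Z (26 * t)%C; [ring|unfold t'; field;
  repeat split; multiple_neq_0 HJ (13 * t + 3)%C].
- eta2_by_word ((-4) :: nil)%Z (3)%Z (13 * t)%C; [ring|unfold t'; field;
  repeat split; multiple_neq_0 HJ (13 * t + 3)%C].
Qed.

Lemma w2_4_laws (t : C) : 0 < snd t ->
  let t' := ((16 * t + (-5)) / (26 * t + (-8)))%C in
  eta2 t' = (zeta12 ^ 9 * (2 * (13 * t + (-4))) * eta2 (2 * t))%C /\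
  eta2 (2 * t') = (zeta12 ^ 9 * ((13 * t + (-4))) * eta2 t)%C /\
  eta2 (13 * t') = (zeta12 ^ 9 * (2 * (13 * t + (-4))) * eta2 (26 * t))%C /\
  eta2 (26 * t') = (zeta12 ^ 9 * ((13 * t + (-4))) * eta2 (13 * t))%C.
Proof.
intros Ht t'.
assert (HJ : (13 * t + (-4))%C <> 0%C) by (apply linear_neq_0; auto; lra).
split; [|split; [|split]].
- eta2_by_word (0 :: 0 :: 1 :: 3 :: 2 :: (-2) :: nil)%Z ((-1))%Z (2 * t)%C; [ring|unfold t'; field;
  repeat split; multiple_neq_0 HJ (13 * t + (-4))%C].
- eta2_by_word (0 :: 0 :: 1 :: (-4) :: 3 :: nil)%Z (0)%Z t; [ring|unfold t'; field;
  repeat split; multiple_neq_0 HJ (13 * t + (-4))%C].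
- eta2_by_word (8 :: nil)%Z ((-8))%Z (26 * t)%C; [ring|unfold t'; field;
  repeat split; multiple_neq_0 HJ (13 * t + (-4))%C].
- eta2_by_word (16 :: nil)%Z ((-4))%Z (13 * t)%C; [ring|unfold t'; field;
  repeat split; multiple_neq_0 HJ (13 * t + (-4))%C].
Qed.

Lemma w2_m4_laws (t : C) : 0 < snd t ->
  let t' := (((-16) * t + (-5)) / (26 * t + 8))%C in
  eta2 t' = (zeta12 ^ 9 * (2 * (13 * t + 4)) * eta2 (2 * t))%C /\
  eta2 (2 * t') = (zeta12 ^ 9 * ((13 * t + 4)) * eta2 t)%C /\
  eta2 (13 * t') = (zeta12 ^ 9 * (2 * (13 * t + 4)) * eta2 (26 * t))%C /\
  eta2 (26 * t') = (zeta12 ^ 9 * ((13 * t + 4)) * eta2 (13 * t))%C.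
Proof.
intros Ht t'.
assert (HJ : (13 * t + 4)%C <> 0%C) by (apply linear_neq_0; auto; lra).
split; [|split; [|split]].
- eta2_by_word ((-1) :: (-3) :: (-2) :: 2 :: nil)%Z (1)%Z (2 * t)%C; [ring|unfold t'; field;
  repeat split; multiple_neq_0 HJ (13 * t + 4)%C].
- eta2_by_word (0 :: 0 :: (-1) :: 4 :: (-3) :: nil)%Z (0)%Z t; [ring|unfold t'; field;
  repeat split; multiple_neq_0 HJ (13 * t + 4)%C].
- eta2_by_word ((-8) :: nil)%Z (8)%Z (26 * t)%C; [ring|unfold t'; field;
  repeat split; multiple_neq_0 HJ (13 * t + 4)%C].
- eta2_by_word ((-16) :: nil)%Z (4)%Z (13 * t)%C; [ring|unfold t'; field;
  repeat split; multiple_neq_0 HJ (13 * t + 4)%C].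
Qed.

(** * Expansions at the cusp *)

Definition on_disc (f : C -> C) : Prop := forall r, 0 <= r < 1 -> approx 0 r f.

(** An expansion to first order whose remainder [h] is itself a uniform limit of polynomials, so
    that a function with vanishing coefficients can be divided by a power of [q]. *)
Definition jet (f : C -> C) (c0 c1 : C) : Prop :=
  exists h, on_disc h /\
  forall q, Cmod q < 1 -> f q = (c0 + c1 * q + q ^ 2 * h q)%C.

Lemma jet_const (a : C) : jet (fun _ => a) a 0.
Proof.
exists (fun _ => RtoC 0); split; [intros r _; apply approx_const|].
intros q _; ring.
Qed.

Lemma jet_id : jet (fun q => q) 0 1.
Proof.
exists (fun _ => RtoC 0); split; [intros r _; apply approx_const|].
intros q _; ring.
Qed.

Lemma jet_plus (f g : C -> C) (a0 a1 b0 b1 : C) : jet f a0 a1 -> jet g b0 b1 ->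
  jet (fun q => f q + g q)%C (a0 + b0) (a1 + b1).
Proof.
intros [h [Hh Hf]] [k [Hk Hg]]; exists (fun q => h q + k q)%C; split.
- intros r Hr; apply approx_plus; auto.
- intros q Hq; rewrite Hf, Hg by auto; ring.
Qed.

Lemma jet_minus (f g : C -> C) (a0 a1 b0 b1 : C) : jet f a0 a1 -> jet g b0 b1 ->
  jet (fun q => f q - g q)%C (a0 - b0) (a1 - b1).
Proof.
intros [h [Hh Hf]] [k [Hk Hg]]; exists (fun q => h q - k q)%C; split.
- intros r Hr; apply approx_minus; auto; lra.
- intros q Hq; rewrite Hf, Hg by auto; ring.
Qed.

Lemma jet_mult (f g : C -> C) (a0 a1 b0 b1 : C) : jet f a0 a1 -> jet g b0 b1 ->
  jet (fun q => f q * g q)%C (a0 * b0) (a0 * b1 + a1 * b0).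
Proof.
intros [h [Hh Hf]] [k [Hk Hg]].
exists (fun q => a1 * b1 + (a0 + a1 * q) * k q + (b0 + b1 * q) * h q +
  q ^ 2 * (h q * k q))%C; split.
- intros r Hr; assert (Hh' := Hh r Hr); assert (Hk' := Hk r Hr).
  assert (Hid := approx_id 0 r).
  repeat first [ assumption | apply approx_const | apply approx_plus
    | apply approx_mult; [lra| |] | apply approx_pow; [lra|] ].
- intros q Hq; rewrite Hf, Hg by auto; ring.
Qed.

Lemma jet_pow (f : C -> C) (a1 : C) (n : nat) : jet f 1 a1 ->
  jet (fun q => f q ^ n)%C 1 (INR n * a1).
Proof.
intros Hf; induction n as [|n IH].
- destruct (jet_const 1) as [h Hh]; exists h.
  split; [apply Hh|]; intros q Hq.
  etransitivity; [exact (proj2 Hh q Hq)|simpl INR; ring].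
- destruct (jet_mult _ _ _ _ _ _ Hf IH) as [h [Hh Hq]]; exists h; split; auto.
  intros q Hq1; rewrite Cpow_S, Hq, S_INR, RtoC_plus by auto; ring.
Qed.

Lemma jet_eq (f : C -> C) (a0 a1 b0 b1 : C) :
  a0 = b0 -> a1 = b1 -> jet f a0 a1 -> jet f b0 b1.
Proof. now intros -> ->. Qed.

Lemma jet_phi : jet phi 1 (- (1)).
Proof.
exists phi_tail; split; [intros r Hr; now apply approx_phi_tail|].
intros q Hq; rewrite phi_expand by auto; ring.
Qed.

Lemma Cmod_pow_le (q : C) (n : nat) (r : R) :
  (0 < n)%nat -> 0 <= r < 1 -> Cmod q <= r -> Cmod (q ^ n) <= r.
Proof.
intros Hn Hr Hq; rewrite Cmod_pow; destruct n as [|n]; [lia|]; simpl.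
assert (H := Cmod_ge_0 q); assert (H1 := pow_le_1 (Cmod q) n ltac:(lra)); nra.
Qed.

Lemma on_disc_comp_pow (f : C -> C) (n : nat) : (0 < n)%nat -> on_disc f ->
  on_disc (fun q => f (q ^ n)%C).
Proof.
intros Hn Hf r Hr; apply (approx_comp 0 0 r r f (fun q => q ^ n)%C); [lra|auto| |].
- apply approx_pow; [lra|apply approx_id].
- intros q Hq; rewrite Cminus_0_r in *; now apply Cmod_pow_le.
Qed.

Lemma Cmod_pow_lt_1 (q : C) (n : nat) : (0 < n)%nat -> Cmod q < 1 -> Cmod (q ^ n) < 1.
Proof.
intros Hn Hq; assert (H0 := Cmod_ge_0 q).
assert (H := Cmod_pow_le q n (Cmod q) Hn ltac:(lra) ltac:(lra)); lra.
Qed.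

Lemma jet_phi_pow (n : nat) : jet (fun q => phi (q ^ S (S n))%C) 1 0.
Proof.
exists (fun q => - q ^ n + q ^ (n + S (S n)) * phi_tail (q ^ S (S n)))%C; split.
- intros r Hr; assert (Hid := approx_id 0 r).
  apply approx_plus; [apply approx_opp; [lra|]; apply approx_pow; auto; lra|].
  apply approx_mult; [lra|apply approx_pow; auto; lra|].
  apply (on_disc_comp_pow phi_tail); auto; [lia|].
  intros s Hs; now apply approx_phi_tail.
- intros q Hq; rewrite phi_expand by (apply Cmod_pow_lt_1; auto; lia).
  rewrite Cpow_add_r, !Cpow_S; ring.
Qed.

Lemma on_disc_phi_inv_pow (n k : nat) : (0 < n)%nat ->
  on_disc (fun q => (/ phi (q ^ n)) ^ k)%C.
Proof.
intros Hn r Hr; apply approx_pow; [lra|].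
apply (on_disc_comp_pow (fun q => / phi q)%C); auto.
intros s Hs; now apply approx_phi_inv.
Qed.

(** A twelfth root of [qq t]. It depends on [t] and not on [q] alone, so its powers have to combine
    into powers of [q] before Schwarz's lemma applies. *)
Definition eta_nome (t : C) : C := cexp (RtoC (- PI / 6) * - (Ci * t)).

Lemma eta_nome_12 (t : C) : (eta_nome t ^ 12)%C = qq t.
Proof.
unfold eta_nome, qq, nome; rewrite cexp_pow; f_equal.
rewrite Cmult_assoc, <- RtoC_mult; do 2 f_equal; simpl; field.
Qed.

Lemma eta2_multiple (t : C) (n : nat) :
  eta2 (RtoC (INR n) * t) = (eta_nome t ^ n * phi (qq t ^ n) ^ 2)%C.
Proof.
unfold eta2, eta2_half, eta_nome, qq, nome; rewrite !cexp_pow.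
replace (RtoC (- PI / 6) * - (Ci * (INR n * t)))%C with
  (INR n * (RtoC (- PI / 6) * - (Ci * t)))%C by ring.
replace (RtoC (-2 * PI) * - (Ci * (INR n * t)))%C with
  (INR n * (RtoC (-2 * PI) * - (Ci * t)))%C by ring.
reflexivity.
Qed.

Lemma eta2_multiple_1 (t : C) : eta2 t = (eta_nome t * phi (qq t) ^ 2)%C.
Proof.
assert (H := eta2_multiple t 1); simpl INR in H.
rewrite Cmult_1_l, !Cpow_1_r in H; exact H.
Qed.

Lemma eta2_multiple_INR (t : C) (n : nat) (x : R) : INR n = x ->
  eta2 (RtoC x * t) = (eta_nome t ^ n * phi (qq t ^ n) ^ 2)%C.
Proof. intros <-; apply eta2_multiple. Qed.

Lemma eta2_neq_0 (t : C) : 0 < snd t -> eta2 t <> 0%C.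
Proof.
intros Ht; rewrite eta2_multiple_1; apply Cmult_neq_0; [apply cexp_neq_0|].
apply Cpow_nz, phi_neq_0, Cmod_qq_lt_1, Ht.
Qed.

Definition eta2_prod (p : R) (t : C) : C :=
  (eta2 t * eta2 (2 * t) * eta2 (RtoC p * t) * eta2 (RtoC (2 * p) * t))%C.

(* [F^2/(abcd)^w] for a form [F] of degree [w] in the four values, in terms of
   [q]; it suffices to bound this quotient in order to prove [F = 0]. *)
Definition eta_form (F : C -> C -> C -> C -> C) (p : R) (t : C) : C :=
  F (eta2 t) (eta2 (2 * t)) (eta2 (RtoC p * t)) (eta2 (RtoC (2 * p) * t)).

(** The modulus of [f (qq t)] is invariant because numerator and denominator are multiplied by the
    same [m]. The exponent [S n] serves forms of degree 6, whose squares have the degree of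
    [eta2_prod p t ^ 3]. *)
Lemma eta_form_vanish (F : C -> C -> C -> C -> C) (p : R) (f : C -> C)
    (n w : nat) (x0 c lam : R) : 0 < p ->
  on_disc f -> f 0%C = 0%C -> 0 < c -> 1 < lam ->
  (forall t : C, 0 < snd t ->
    (f (qq t) * eta2_prod p t ^ w)%C = (eta_form F p t ^ S n)%C) ->
  (forall t : C, 0 < snd t < c -> x0 <= fst t <= x0 + 1 -> exists (t' : C) m,
    0 < m /\ 0 < snd t' /\ lam * snd t <= snd t' /\
    Cmod (eta_form F p t' ^ S n) = m * Cmod (eta_form F p t ^ S n) /\
    Cmod (eta2_prod p t' ^ w) = m * Cmod (eta2_prod p t ^ w)) ->
  forall t : C, 0 < snd t -> eta_form F p t = 0%C.
Proof.
intros Hp Hf Hf0 Hc Hlam Hfq Hred.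
assert (HP : forall t, 0 < snd t -> 0 < Cmod (eta2_prod p t ^ w)).
{ intros t Ht; apply Cmod_gt_0, Cpow_nz; unfold eta2_prod.
  apply Cmult_neq_0; [apply Cmult_neq_0; [apply Cmult_neq_0|]|];
    apply eta2_neq_0; auto; apply scaled_upper; auto; lra. }
assert (H : forall t, 0 < snd t -> f (qq t) = 0%C).
{ apply (vanish_of_reduction f x0 c lam); auto.
  intros t Ht Hre; destruct (Hred t Ht Hre) as [t' [m [Hm [Ht' [Hl [HF HPm]]]]]].
  exists t'; split; auto.
  assert (E := Hfq t ltac:(lra)); assert (E' := Hfq t' Ht').
  apply (f_equal Cmod) in E; apply (f_equal Cmod) in E'.
  rewrite Cmod_mult in E, E'; rewrite HF, HPm, <- E in E'.
  specialize (HP t ltac:(lra)).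
  apply Rmult_eq_reg_r with (m * Cmod (eta2_prod p t ^ w)); [|nra].
  rewrite E'; ring. }
intros t Ht; assert (E := Hfq t Ht); rewrite (H t Ht), Cmult_0_l in E.
destruct (Ceq_dec (eta_form F p t) 0) as [|Hn]; auto.
exfalso; exact (Cpow_nz _ (S n) Hn (eq_sym E)).
Qed.

Lemma Cmod_zeta12_pow (k : nat) : Cmod (zeta12 ^ k) = 1.
Proof. unfold zeta12; rewrite Cmod_pow, Cmod_cis; apply pow1. Qed.

Lemma Cmod_scaled (k n e : nat) (x : R) (J y : C) : 0 < x ->
  Cmod (zeta12 ^ k * (RtoC x ^ e * J ^ n) * y) = x ^ e * Cmod J ^ n * Cmod y.
Proof.
intros Hx; rewrite !Cmod_mult, Cmod_zeta12_pow, !Cmod_pow, Cmod_R, Rabs_pos_eq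
  by lra; ring.
Qed.

(** With [s * i = 2 * w], the form of degree [2 * i] to the power [s] and the product of degree 4 to
    the power [w] have equal weight; roots of unity are invisible to [Cmod]. *)
Lemma quotient_invariance (x : R) (J u u' v v' : C) (k l s w i : nat) :
  0 < x -> J <> 0%C -> (s * i = 2 * w)%nat ->
  u' = (zeta12 ^ k * (RtoC x ^ i * J ^ (2 * i)) * u)%C ->
  v' = (zeta12 ^ l * (RtoC x ^ 2 * J ^ 4) * v)%C ->
  exists m, 0 < m /\ Cmod (u' ^ s) = m * Cmod (u ^ s) /\
    Cmod (v' ^ w) = m * Cmod (v ^ w).
Proof.
intros Hx HJ Hsw -> ->; apply Cmod_gt_0 in HJ.
exists ((x * Cmod J ^ 2) ^ (2 * w)); split; [apply pow_lt, Rmult_lt_0_compat; auto; nra|].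
rewrite !Cmod_pow, !Cmod_scaled by auto; split.
- rewrite <- Hsw, (Nat.mul_comm s), !Rpow_mult_distr, <- !pow_mult.
  f_equal; f_equal; f_equal; lia.
- rewrite !Rpow_mult_distr, <- !pow_mult; f_equal; f_equal; f_equal; lia.
Qed.

Ltac build_jet :=
  repeat first [ eapply jet_minus | eapply jet_plus | eapply jet_mult
    | eapply jet_pow | exact jet_phi | eapply jet_phi_pow | exact jet_id
    | eapply jet_const ].

Ltac solve_jet :=
  eapply jet_eq; [ | | build_jet]; rewrite ?INR_IZR_INZ; simpl Z.of_nat; ring.

Lemma on_disc_id : on_disc (fun q => q).
Proof. intros r _; apply approx_id. Qed.

Lemma on_disc_mult (f g : C -> C) :
  on_disc f -> on_disc g -> on_disc (fun q => f q * g q)%C.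
Proof. intros Hf Hg r Hr; apply approx_mult; auto; lra. Qed.

Lemma on_disc_pow (f : C -> C) (n : nat) : on_disc f -> on_disc (fun q => f q ^ n)%C.
Proof. intros Hf r Hr; apply approx_pow; auto; lra. Qed.

Definition phi4_inv (p : nat) (q : C) : C :=
  ((/ phi (q ^ 1)) ^ 6 * (/ phi (q ^ 2)) ^ 6 * (/ phi (q ^ p)) ^ 6 *
   (/ phi (q ^ (2 * p))) ^ 6)%C.

Lemma on_disc_phi4_inv (p : nat) : (0 < p)%nat -> on_disc (phi4_inv p).
Proof.
intros Hp; unfold phi4_inv.
apply on_disc_mult; [apply on_disc_mult; [apply on_disc_mult|]|];
  apply on_disc_phi_inv_pow; lia.
Qed.

Lemma eta2_prod_phi4 (n : nat) (p : R) (t : C) : (0 < n)%nat -> INR n = p ->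
  0 < snd t ->
  (phi4_inv n (qq t) * eta2_prod p t ^ 3 = eta_nome t ^ (9 * (n + 1)))%C.
Proof.
intros Hn Hp Ht.
assert (H2 : INR (2 * n) = 2 * p) by (rewrite mult_INR, Hp; simpl; ring).
assert (Hq := Cmod_qq_lt_1 t Ht).
assert (Hphi : forall m, (0 < m)%nat -> phi (qq t ^ m) <> 0%C)
  by (intros m Hm; apply phi_neq_0, Cmod_pow_lt_1; auto).
unfold phi4_inv, eta2_prod.
rewrite eta2_multiple_1, (eta2_multiple_INR t 2 2), (eta2_multiple_INR t n p),
  (eta2_multiple_INR t (2 * n) (2 * p)) by (auto; simpl; ring).
replace (eta_nome t ^ (9 * (n + 1)))%C with
  (eta_nome t ^ 9 * (eta_nome t ^ n) ^ 9)%C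
  by (rewrite <- Cpow_mult_r, <- Cpow_add_r; f_equal; lia).
replace (eta_nome t ^ (2 * n))%C with (eta_nome t ^ n * eta_nome t ^ n)%C
  by (rewrite <- Cpow_add_r; f_equal; lia).
assert (H1 := Hphi 1%nat ltac:(lia)); rewrite Cpow_1_r in *.
assert (H2' := Hphi 2%nat ltac:(lia)); assert (H3 := Hphi n Hn).
assert (H4 := Hphi (2 * n)%nat ltac:(lia)).
field; auto.
Qed.

Lemma eta_form_5 (F : C -> C -> C -> C -> C) (t : C) : eta_form F 5 t =
  F (eta2 t) (eta2 (2 * t)) (eta2 (5 * t)) (eta2 (10 * t)).
Proof. unfold eta_form; now replace (2 * 5) with 10 by ring. Qed.

Lemma eta_form_13 (F : C -> C -> C -> C -> C) (t : C) : eta_form F 13 t =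
  F (eta2 t) (eta2 (2 * t)) (eta2 (13 * t)) (eta2 (26 * t)).
Proof. unfold eta_form; now replace (2 * 13) with 26 by ring. Qed.

Definition prod4 (a b c d : C) : C := (a * b * c * d)%C.

Lemma eta2_prod_form (p : R) (t : C) : eta2_prod p t = eta_form prod4 p t.
Proof. reflexivity. Qed.

Ltac generalize_laws H1 H2 H3 H4 :=
  rewrite H1, H2, H3, H4; clear H1 H2 H3 H4;
  repeat match goal with |- context [eta2 ?s] => generalize (eta2 s); intro end;
  generalize zeta12_12; generalize zeta12; intros ?z ?Hz.

Lemma fricke_step (p lam : R) (t : C) : 0 < p -> 0 < snd t ->
  lam * (2 * p * (fst t ^ 2 + snd t ^ 2)) <= 1 ->
  let t' := (- / (RtoC (2 * p) * t))%C in 0 < snd t' /\ lam * snd t <= snd t'.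
Proof.
intros Hp Ht Hl t'.
assert (Hx : 0 < snd (RtoC (2 * p) * t)%C) by (apply scaled_upper; auto; lra).
assert (Hn : 0 < fst t ^ 2 + snd t ^ 2) by nra.
set (D := 2 * p * (fst t ^ 2 + snd t ^ 2)) in *.
assert (Hd : 0 < D) by (unfold D; nra).
assert (E : snd t' = snd t / D).
{ unfold t'; rewrite snd_neg_inv by auto.
  replace (fst (RtoC (2 * p) * t)%C) with (2 * p * fst t) by (simpl; ring).
  replace (snd (RtoC (2 * p) * t)%C) with (2 * p * snd t) by (simpl; ring).
  replace ((2 * p * fst t) ^ 2 + (2 * p * snd t) ^ 2) with (2 * p * D)
    by (unfold D; ring).
  clearbody D; field; lra. }
split; [rewrite E; now apply Rdiv_lt_0_compat|].
rewrite E; apply Rmult_le_reg_r with D; auto.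
replace (snd t / D * D) with (snd t) by (field; lra); nra.
Qed.

Lemma mobius_step (a b c d lam : R) (t : C) : 0 < snd t -> c <> 0 -> 0 < lam ->
  lam * ((c * fst t + d) ^ 2 + (c * snd t) ^ 2) <= a * d - b * c ->
  let t' := ((RtoC a * t + RtoC b) / (RtoC c * t + RtoC d))%C in
  0 < snd t' /\ lam * snd t <= snd t'.
Proof.
intros Ht Hc Hlam Hl t'.
assert (E : snd t' = (a * d - b * c) * snd t /
  ((c * fst t + d) ^ 2 + (c * snd t) ^ 2)) by (apply snd_mobius; auto).
assert (Hd : 0 < (c * fst t + d) ^ 2 + (c * snd t) ^ 2).
{ assert (0 < (c * snd t) ^ 2)
    by (apply pow2_gt_0, Rmult_integral_contrapositive; lra).
  assert (0 <= (c * fst t + d) ^ 2) by apply pow2_ge_0; lra. }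
assert (lam * snd t <= snd t'); [|split; [nra|auto]].
rewrite E; clear E; set (D := (c * fst t + d) ^ 2 + (c * snd t) ^ 2) in *.
apply Rmult_le_reg_r with D; auto.
replace ((a * d - b * c) * snd t / D * D) with ((a * d - b * c) * snd t)
  by (field; lra); nra.
Qed.

Lemma fricke_forms (e : C) (p : R) (t : C) : 0 < p -> 0 < snd t ->
  let t' := (- / (RtoC (2 * p) * t))%C in
  eta_form (G1 p e) p t' =
    (zeta12 ^ 6 * (RtoC (2 * p) ^ 3 * t ^ 6) * eta_form (G1 p e) p t)%C /\
  eta_form G2 p t' =
    (zeta12 ^ 0 * (RtoC (2 * p) ^ 6 * t ^ 12) * eta_form G2 p t)%C /\
  eta2_prod p t' = (zeta12 ^ 0 * (RtoC (2 * p) ^ 2 * t ^ 4) * eta2_prod p t)%C.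
Proof.
intros Hp Ht t'.
destruct (fricke_laws p t Hp Ht) as [H1 [H2 [H3 H4]]]; fold t' in H1, H2, H3, H4.
unfold eta2_prod, eta_form; generalize_laws H1 H2 H3 H4.
rewrite RtoC_mult; unfold G1, G2.
split; [|split]; ring [Hz].
Qed.

Lemma w13_forms (t : C) : 0 < snd t ->
  let t' := ((13 * t + (-7)) / (26 * t + (-13)))%C in
  eta_form (G1 13 4) 13 t' = (zeta12 ^ 0 * (13 ^ 3 * (2 * t + (-1)) ^ 6) *
    eta_form (G1 13 4) 13 t)%C /\
  eta2_prod 13 t' = (zeta12 ^ 0 * (13 ^ 2 * (2 * t + (-1)) ^ 4) * eta2_prod 13 t)%C.
Proof.
intros Ht t'; destruct (w13_laws t Ht) as [H1 [H2 [H3 H4]]].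
rewrite (eta2_prod_form _ t), (eta2_prod_form _ t'), !eta_form_13; fold t' in H1, H2, H3, H4.
generalize_laws H1 H2 H3 H4; unfold G1, prod4; split; ring [Hz].
Qed.

Lemma w2_3_forms (t : C) : 0 < snd t ->
  let t' := ((4 * t + (-1)) / (26 * t + (-6)))%C in
  eta_form (G1 13 4) 13 t' = (zeta12 ^ 9 * (2 ^ 3 * (13 * t + (-3)) ^ 6) *
    eta_form (G1 13 4) 13 t)%C /\
  eta2_prod 13 t' = (zeta12 ^ 6 * (2 ^ 2 * (13 * t + (-3)) ^ 4) * eta2_prod 13 t)%C.
Proof.
intros Ht t'; destruct (w2_3_laws t Ht) as [H1 [H2 [H3 H4]]].
rewrite (eta2_prod_form _ t), (eta2_prod_form _ t'), !eta_form_13; fold t' in H1, H2, H3, H4.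
generalize_laws H1 H2 H3 H4; unfold G1, prod4; split; ring [Hz].
Qed.

Lemma w2_m3_forms (t : C) : 0 < snd t ->
  let t' := (((-4) * t + (-1)) / (26 * t + 6))%C in
  eta_form (G1 13 4) 13 t' = (zeta12 ^ 3 * (2 ^ 3 * (13 * t + 3) ^ 6) *
    eta_form (G1 13 4) 13 t)%C /\
  eta2_prod 13 t' = (zeta12 ^ 6 * (2 ^ 2 * (13 * t + 3) ^ 4) * eta2_prod 13 t)%C.
Proof.
intros Ht t'; destruct (w2_m3_laws t Ht) as [H1 [H2 [H3 H4]]].
rewrite (eta2_prod_form _ t), (eta2_prod_form _ t'), !eta_form_13; fold t' in H1, H2, H3, H4.
generalize_laws H1 H2 H3 H4; unfold G1, prod4; split; ring [Hz].
Qed.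

Lemma w2_4_forms (t : C) : 0 < snd t ->
  let t' := ((16 * t + (-5)) / (26 * t + (-8)))%C in
  eta_form (G1 13 4) 13 t' = (zeta12 ^ 6 * (2 ^ 3 * (13 * t + (-4)) ^ 6) *
    eta_form (G1 13 4) 13 t)%C /\
  eta2_prod 13 t' = (zeta12 ^ 0 * (2 ^ 2 * (13 * t + (-4)) ^ 4) * eta2_prod 13 t)%C.
Proof.
intros Ht t'; destruct (w2_4_laws t Ht) as [H1 [H2 [H3 H4]]].
rewrite (eta2_prod_form _ t), (eta2_prod_form _ t'), !eta_form_13; fold t' in H1, H2, H3, H4.
generalize_laws H1 H2 H3 H4; unfold G1, prod4; split; ring [Hz].
Qed.

Lemma w2_m4_forms (t : C) : 0 < snd t ->
  let t' := (((-16) * t + (-5)) / (26 * t + 8))%C in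
  eta_form (G1 13 4) 13 t' = (zeta12 ^ 6 * (2 ^ 3 * (13 * t + 4) ^ 6) *
    eta_form (G1 13 4) 13 t)%C /\
  eta2_prod 13 t' = (zeta12 ^ 0 * (2 ^ 2 * (13 * t + 4) ^ 4) * eta2_prod 13 t)%C.
Proof.
intros Ht t'; destruct (w2_m4_laws t Ht) as [H1 [H2 [H3 H4]]].
rewrite (eta2_prod_form _ t), (eta2_prod_form _ t'), !eta_form_13; fold t' in H1, H2, H3, H4.
generalize_laws H1 H2 H3 H4; unfold G1, prod4; split; ring [Hz].
Qed.

Lemma w5_forms (t : C) : 0 < snd t ->
  let t' := ((5 * t + (-3)) / (10 * t + (-5)))%C in
  eta_form (G1 5 0) 5 t' = (zeta12 ^ 0 * (5 ^ 3 * (2 * t + (-1)) ^ 6) *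
    eta_form (G1 5 0) 5 t)%C /\
  eta_form G2 5 t' = (zeta12 ^ 0 * (5 ^ 6 * (2 * t + (-1)) ^ 12) *
    eta_form G2 5 t)%C /\
  eta2_prod 5 t' = (zeta12 ^ 0 * (5 ^ 2 * (2 * t + (-1)) ^ 4) * eta2_prod 5 t)%C.
Proof.
intros Ht t'; destruct (w5_laws t Ht) as [H1 [H2 [H3 H4]]].
rewrite (eta2_prod_form _ t), (eta2_prod_form _ t'), !eta_form_5; fold t' in H1, H2, H3, H4.
generalize_laws H1 H2 H3 H4; unfold G1, G2, prod4.
split; [|split]; ring [Hz].
Qed.

(** * Modular relations of levels 10 and 26 *)

(** The level 10 form stripped of its power of [eta_nome]. Powers of [q] are written as nested
    products because [jet_pow] is stated for constant term 1. *)
Definition g10_1 (q : C) : C :=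
  (phi q ^ 4 * phi (q ^ 2) ^ 4 * phi (q ^ 5) ^ 2 * phi (q ^ 10) ^ 2 +
   q * (5 * (phi q ^ 2 * phi (q ^ 2) ^ 2 * phi (q ^ 5) ^ 4 * phi (q ^ 10) ^ 4)) -
   phi (q ^ 2) ^ 6 * phi (q ^ 5) ^ 6 - q * (phi q ^ 6 * phi (q ^ 10) ^ 6))%C.

Definition g10_2 (q : C) : C :=
  (phi (q ^ 2) ^ 12 * phi (q ^ 5) ^ 12 +
   q * (q * (phi q ^ 12 * phi (q ^ 10) ^ 12)) -
   q * (10 * (phi q ^ 6 * phi (q ^ 2) ^ 6 * phi (q ^ 5) ^ 6 * phi (q ^ 10) ^ 6)) -
   phi q ^ 10 * phi (q ^ 5) ^ 10 * phi (q ^ 2) ^ 2 * phi (q ^ 10) ^ 2 -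
   q * (q * (16 * (phi (q ^ 2) ^ 10 * phi (q ^ 10) ^ 10 * phi q ^ 2 *
     phi (q ^ 5) ^ 2))))%C.

Definition g26 (q : C) : C :=
  (phi q ^ 4 * phi (q ^ 2) ^ 4 * phi (q ^ 13) ^ 2 * phi (q ^ 26) ^ 2 +
   q * (q * (q * (13 * (phi q ^ 2 * phi (q ^ 2) ^ 2 * phi (q ^ 13) ^ 4 *
     phi (q ^ 26) ^ 4)))) -
   phi (q ^ 2) ^ 6 * phi (q ^ 13) ^ 6 -
   q * (q * (q * (phi q ^ 6 * phi (q ^ 26) ^ 6))) +
   q * (4 * (phi q ^ 2 * phi (q ^ 2) ^ 4 * phi (q ^ 13) ^ 4 * phi (q ^ 26) ^ 2)) +
   q * (q * (4 * (phi q ^ 4 * phi (q ^ 2) ^ 2 * phi (q ^ 13) ^ 2 *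
     phi (q ^ 26) ^ 4))))%C.

(** For this form a simple zero is enough, so the coefficient [c1] is left to unification. *)
Lemma jet_g10_1 : exists c1, jet g10_1 0 c1.
Proof.
eexists; unfold g10_1; eapply jet_eq; [ | reflexivity | build_jet]; ring.
Qed.

Lemma jet_g10_2 : jet g10_2 0 0.
Proof. unfold g10_2; solve_jet. Qed.

Lemma jet_g26 : jet g26 0 0.
Proof. unfold g26; solve_jet. Qed.

Lemma eta_form_g10_1 (t : C) :
  eta_form (G1 5 0) 5 t = (eta_nome t ^ 21 * g10_1 (qq t))%C.
Proof.
rewrite eta_form_5; unfold G1, g10_1.
rewrite (eta2_multiple_1 t), (eta2_multiple_INR t 2 2), (eta2_multiple_INR t 5 5),
  (eta2_multiple_INR t 10 10) by (simpl; ring).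
generalize (phi (qq t)) (phi (qq t ^ 2)) (phi (qq t ^ 5)) (phi (qq t ^ 10)).
intros; rewrite <- eta_nome_12; ring.
Qed.

Lemma eta_form_g10_2 (t : C) :
  eta_form G2 5 t = (eta_nome t ^ 42 * g10_2 (qq t))%C.
Proof.
rewrite eta_form_5; unfold G2, g10_2.
rewrite (eta2_multiple_1 t), (eta2_multiple_INR t 2 2), (eta2_multiple_INR t 5 5),
  (eta2_multiple_INR t 10 10) by (simpl; ring).
generalize (phi (qq t)) (phi (qq t ^ 2)) (phi (qq t ^ 5)) (phi (qq t ^ 10)).
intros; rewrite <- eta_nome_12; ring.
Qed.

Lemma eta_form_g26 (t : C) :
  eta_form (G1 13 4) 13 t = (eta_nome t ^ 45 * g26 (qq t))%C.
Proof.
rewrite eta_form_13; unfold G1, g26.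
rewrite (eta2_multiple_1 t), (eta2_multiple_INR t 2 2), (eta2_multiple_INR t 13 13),
  (eta2_multiple_INR t 26 26) by (simpl; ring).
generalize (phi (qq t)) (phi (qq t ^ 2)) (phi (qq t ^ 13)) (phi (qq t ^ 26)).
intros; rewrite <- eta_nome_12; ring.
Qed.

Lemma on_disc_quotient (h : C -> C) (p s : nat) : (0 < p)%nat -> on_disc h ->
  on_disc (fun q => q * (h q ^ s * phi4_inv p q))%C.
Proof.
intros Hp Hh; apply on_disc_mult; [exact on_disc_id|].
apply on_disc_mult; [now apply on_disc_pow|now apply on_disc_phi4_inv].
Qed.

(* The isometric circles of the Fricke and Atkin-Lehner involutions used below
   cover a strip of width 1 near the real axis. *)
Lemma level10_step (t : C) : 0 < snd t < 1 / 20 -> - (3 / 10) <= fst t <= - (3 / 10) + 1 ->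
  exists (t' : C) m m', 0 < m /\ 0 < m' /\ 0 < snd t' /\ 21 / 20 * snd t <= snd t' /\
 (Cmod (eta_form (G1 5 0) 5 t' ^ 2) = m * Cmod (eta_form (G1 5 0) 5 t ^ 2) /\
  Cmod (eta2_prod 5 t' ^ 3) = m * Cmod (eta2_prod 5 t ^ 3)) /\
 (Cmod (eta_form G2 5 t' ^ 1) = m' * Cmod (eta_form G2 5 t ^ 1) /\
  Cmod (eta2_prod 5 t' ^ 3) = m' * Cmod (eta2_prod 5 t ^ 3)).
Proof.
(* Up to [3/10] the Fricke involution works, since [10 |t|^2] is at most [37/40]; the rest of the
   strip lies within [1/5] of [1/2], the centre of the circle of [W_5]. *)
intros Ht Hre; destruct (Rle_lt_dec (fst t) (3 / 10)) as [Hx|Hx].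
- destruct (fricke_step 5 (21 / 20) t ltac:(lra) (proj1 Ht)) as [H1 H2]; [nra|].
  destruct (fricke_forms 0 5 t ltac:(lra) (proj1 Ht)) as [F1 [F2 F3]].
  assert (Ht0 := upper_neq_0 t (proj1 Ht)).
  destruct (quotient_invariance (2 * 5) t _ _ _ _ 6 0 2 3 3 ltac:(lra) Ht0 eq_refl F1 F3)
    as [m [Hm Hm2]].
  destruct (quotient_invariance (2 * 5) t _ _ _ _ 0 0 1 3 6 ltac:(lra) Ht0 eq_refl F2 F3)
    as [m' [Hm' Hm2']].
  eexists; exists m, m'; repeat split; try apply Hm2; try apply Hm2'; auto.
- destruct (mobius_step 5 (-3) 10 (-5) (21 / 20) t (proj1 Ht) ltac:(lra) ltac:(lra))
    as [H1 H2]; [nra|].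
  destruct (w5_forms t (proj1 Ht)) as [F1 [F2 F3]].
  assert (HJ : (2 * t + (-1))%C <> 0%C) by (apply linear_neq_0; [apply Ht|lra]).
  destruct (quotient_invariance 5 _ _ _ _ _ 0 0 2 3 3 ltac:(lra) HJ eq_refl F1 F3)
    as [m [Hm Hm2]].
  destruct (quotient_invariance 5 _ _ _ _ _ 0 0 1 3 6 ltac:(lra) HJ eq_refl F2 F3)
    as [m' [Hm' Hm2']].
  eexists; exists m, m'; repeat split; try apply Hm2; try apply Hm2'; auto.
Qed.

Lemma level10_1 (t : C) : 0 < snd t -> eta_form (G1 5 0) 5 t = 0%C.
Proof.
destruct jet_g10_1 as [c1 [h [Hh Hg]]].
(* Orders at the cusp in units of [q^(1/12)]: the squared form has at least [2 * 21 + 24 = 66] and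
   the cubed product has 54, which leaves one factor [q]. *)
apply (eta_form_vanish (G1 5 0) 5
  (fun q => q * ((c1 + q * h q) ^ 2 * phi4_inv 5 q))%C 1 3 (- (3 / 10)) (1 / 20) (21 / 20));
  try lra.
- apply (on_disc_quotient (fun q => c1 + q * h q)%C); [lia|].
  intros r Hr; apply approx_plus; [apply approx_const|].
  apply approx_mult; [lra|apply approx_id|auto].
- ring.
- intros s Hs; assert (E := eta2_prod_phi4 5 5 s ltac:(lia) ltac:(simpl; ring) Hs).
  rewrite eta_form_g10_1, Hg by now apply Cmod_qq_lt_1.
  transitivity (qq s * (c1 + qq s * h (qq s)) ^ 2 *
    (phi4_inv 5 (qq s) * eta2_prod 5 s ^ 3))%C; [ring|].
  rewrite E; generalize (h (qq s)); intros y; rewrite <- eta_nome_12.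
  simpl (9 * (5 + 1))%nat; ring.
- intros s Hs Hre; destruct (level10_step s Hs Hre)
    as [s' [m [m' [Hm [Hm' [H1 [H2 [[H3 H4] _]]]]]]]].
  exists s', m; auto.
Qed.

Lemma level10_2 (t : C) : 0 < snd t -> eta_form G2 5 t = 0%C.
Proof.
destruct jet_g10_2 as [h [Hh Hg]].
(* Here the double zero of [g10_2] gives order [42 + 24 = 66] against 54. *)
apply (eta_form_vanish G2 5
  (fun q => q * (h q ^ 1 * phi4_inv 5 q))%C 0 3 (- (3 / 10)) (1 / 20) (21 / 20));
  try lra.
- apply on_disc_quotient; [lia|auto].
- ring.
- intros s Hs; assert (E := eta2_prod_phi4 5 5 s ltac:(lia) ltac:(simpl; ring) Hs).
  rewrite eta_form_g10_2, Hg by now apply Cmod_qq_lt_1.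
  transitivity (qq s * h (qq s) * (phi4_inv 5 (qq s) * eta2_prod 5 s ^ 3))%C; [ring|].
  rewrite E; generalize (h (qq s)); intros y; rewrite <- eta_nome_12.
  simpl (9 * (5 + 1))%nat; ring.
- intros s Hs Hre; destruct (level10_step s Hs Hre)
    as [s' [m [m' [Hm [Hm' [H1 [H2 [_ [H3 H4]]]]]]]]].
  exists s', m'; auto.
Qed.

(** The circles barely overlap: that of [W_13] around [1/2] begins at [1/2 - sqrt 13 / 26], about
    [0.3613], and that of [W_2] around [4/13] ends at about [0.3621]. Hence the cut at [0.3617], the
    small height and a factor so close to 1. *)
Lemma level26_step (t : C) : 0 < snd t < 1 / 200 ->
  - (3617 / 10000) <= fst t <= - (3617 / 10000) + 1 ->
  exists (t' : C) m, 0 < m /\ 0 < snd t' /\ 1003 / 1000 * snd t <= snd t' /\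
 Cmod (eta_form (G1 13 4) 13 t' ^ 2) = m * Cmod (eta_form (G1 13 4) 13 t ^ 2) /\
 Cmod (eta2_prod 13 t' ^ 3) = m * Cmod (eta2_prod 13 t ^ 3).
Proof.
intros Ht Hre.
assert (Hmob : forall a b c d x u v k l,
  (1003 / 1000) * ((c * fst t + d) ^ 2 + (c * snd t) ^ 2) <= a * d - b * c ->
  c <> 0 -> 0 < x -> (RtoC u * t + RtoC v)%C <> 0%C ->
  let t' := ((RtoC a * t + RtoC b) / (RtoC c * t + RtoC d))%C in
  eta_form (G1 13 4) 13 t' = (zeta12 ^ k * (RtoC x ^ 3 * (RtoC u * t + RtoC v) ^ 6) *
    eta_form (G1 13 4) 13 t)%C /\
 eta2_prod 13 t' = (zeta12 ^ l * (RtoC x ^ 2 * (RtoC u * t + RtoC v) ^ 4) *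
    eta2_prod 13 t)%C ->
  exists (t' : C) m, 0 < m /\ 0 < snd t' /\ 1003 / 1000 * snd t <= snd t' /\
 Cmod (eta_form (G1 13 4) 13 t' ^ 2) = m * Cmod (eta_form (G1 13 4) 13 t ^ 2) /\
 Cmod (eta2_prod 13 t' ^ 3) = m * Cmod (eta2_prod 13 t ^ 3)).
{ intros a b c d x u v k l Hineq Hc Hx HJ t' [F1 F2].
  destruct (mobius_step a b c d (1003 / 1000) t (proj1 Ht) Hc ltac:(lra) Hineq)
    as [H1 H2].
  destruct (quotient_invariance x _ _ _ _ _ k l 2 3 3 Hx HJ eq_refl F1 F2)
    as [m [Hm Hm2]].
  exists t', m; auto. }
destruct (Rle_lt_dec (fst t) (3617 / 10000)) as [Hx1|Hx1].
2:{ apply (Hmob 13 (-7) 26 (-13) 13 2 (-1) 0%nat 0%nat); try lra; [nra| |].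
    - apply linear_neq_0; [apply Ht|lra].
    - exact (w13_forms t (proj1 Ht)). }
destruct (Rle_lt_dec (fst t) (27 / 100)) as [Hx2|Hx2].
2:{ apply (Hmob 16 (-5) 26 (-8) 2 13 (-4) 6%nat 0%nat); try lra; [nra| |].
    - apply linear_neq_0; [apply Ht|lra].
    - exact (w2_4_forms t (proj1 Ht)). }
destruct (Rle_lt_dec (fst t) (19 / 100)) as [Hx3|Hx3].
2:{ apply (Hmob 4 (-1) 26 (-6) 2 13 (-3) 9%nat 6%nat); try lra; [nra| |].
    - apply linear_neq_0; [apply Ht|lra].
    - exact (w2_3_forms t (proj1 Ht)). }
destruct (Rle_lt_dec (fst t) (- (27 / 100))) as [Hx4|Hx4].
{ apply (Hmob (-16) (-5) 26 8 2 13 4 6%nat 0%nat); try lra; [nra| |].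
  - apply linear_neq_0; [apply Ht|lra].
  - exact (w2_m4_forms t (proj1 Ht)). }
destruct (Rle_lt_dec (fst t) (- (19 / 100))) as [Hx5|Hx5].
{ apply (Hmob (-4) (-1) 26 6 2 13 3 3%nat 6%nat); try lra; [nra| |].
  - apply linear_neq_0; [apply Ht|lra].
  - exact (w2_m3_forms t (proj1 Ht)). }
destruct (fricke_step 13 (1003 / 1000) t ltac:(lra) (proj1 Ht)) as [H1 H2]; [nra|].
destruct (fricke_forms 4 13 t ltac:(lra) (proj1 Ht)) as [F1 [_ F3]].
assert (Ht0 := upper_neq_0 t (proj1 Ht)).
destruct (quotient_invariance (2 * 13) t _ _ _ _ 6 0 2 3 3 ltac:(lra) Ht0 eq_refl F1 F3)
  as [m [Hm Hm2]].
eexists; exists m; split; [exact Hm|]; split; [exact H1|]; split; [exact H2|].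
exact Hm2.
Qed.

Lemma level26 (t : C) : 0 < snd t -> eta_form (G1 13 4) 13 t = 0%C.
Proof.
destruct jet_g26 as [h [Hh Hg]].
(* The orders are [2 * 45 + 48 = 138] against [9 * 14 = 126], and again one factor [q] is left. *)
apply (eta_form_vanish (G1 13 4) 13
  (fun q => q * (h q ^ 2 * phi4_inv 13 q))%C 1 3 (- (3617 / 10000)) (1 / 200)
  (1003 / 1000)); try lra.
- apply on_disc_quotient; [lia|auto].
- ring.
- intros s Hs; assert (E := eta2_prod_phi4 13 13 s ltac:(lia) ltac:(simpl; ring) Hs).
  rewrite eta_form_g26, Hg by now apply Cmod_qq_lt_1.
  transitivity (qq s * h (qq s) ^ 2 * (phi4_inv 13 (qq s) * eta2_prod 13 s ^ 3))%C;
    [ring|].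
  rewrite E; generalize (h (qq s)); intros y; rewrite <- eta_nome_12.
  simpl (9 * (13 + 1))%nat; ring.
- exact level26_step.
Qed.

(** * Evaluation *)

Lemma eta2_imag (x y : R) : 0 < x * y -> eta2 (RtoC x * (0, y)) = RtoC (reta (x * y) ^ 2).
Proof.
intros Hy; rewrite <- eta2_half_RtoC by auto; unfold eta2; f_equal.
unfold Ci, Cmult, Copp, RtoC; simpl; f_equal; ring.
Qed.

Lemma eta2_imag_1 (y : R) : 0 < y -> eta2 (0, y) = RtoC (reta y ^ 2).
Proof.
intros Hy; assert (H := eta2_imag 1 y ltac:(lra)).
rewrite Rmult_1_l in H; rewrite <- H; f_equal; symmetry; exact (Cmult_1_l (0, y)).
Qed.

Lemma level10_1_real (y : R) : 0 < y ->
  let a := reta y ^ 2 in let b := reta (2 * y) ^ 2 in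
  let c := reta (5 * y) ^ 2 in let d := reta (10 * y) ^ 2 in
  a ^ 2 * b ^ 2 * c * d + 5 * a * b * c ^ 2 * d ^ 2 - b ^ 3 * c ^ 3 -
  a ^ 3 * d ^ 3 = 0.
Proof.
intros Hy a b c d; assert (H := level10_1 (0, y) Hy).
rewrite eta_form_5, eta2_imag_1, !eta2_imag in H by lra.
fold a b c d in H; unfold G1 in H; apply RtoC_inj.
rewrite <- H, !RtoC_minus, RtoC_plus, !RtoC_mult, !RtoC_pow; ring.
Qed.

Lemma level10_2_real (y : R) : 0 < y ->
  let a := reta y ^ 2 in let b := reta (2 * y) ^ 2 in
  let c := reta (5 * y) ^ 2 in let d := reta (10 * y) ^ 2 in
  b ^ 6 * c ^ 6 + a ^ 6 * d ^ 6 - 10 * (a * b * c * d) ^ 3 -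
  a ^ 5 * c ^ 5 * b * d - 16 * b ^ 5 * d ^ 5 * a * c = 0.
Proof.
intros Hy a b c d; assert (H := level10_2 (0, y) Hy).
rewrite eta_form_5, eta2_imag_1, !eta2_imag in H by lra.
fold a b c d in H; unfold G2 in H; apply RtoC_inj.
rewrite <- H, !RtoC_minus, RtoC_plus, !RtoC_mult, !RtoC_pow, !RtoC_mult; ring.
Qed.

Lemma level26_real (y : R) : 0 < y ->
  let a := reta y ^ 2 in let b := reta (2 * y) ^ 2 in
  let c := reta (13 * y) ^ 2 in let d := reta (26 * y) ^ 2 in
  a ^ 2 * b ^ 2 * c * d + 13 * a * b * c ^ 2 * d ^ 2 - b ^ 3 * c ^ 3 -
  a ^ 3 * d ^ 3 + 4 * (a * b ^ 2 * c ^ 2 * d + a ^ 2 * b * c * d ^ 2) = 0.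
Proof.
intros Hy a b c d; assert (H := level26 (0, y) Hy).
rewrite eta_form_13, eta2_imag_1, !eta2_imag in H by lra.
fold a b c d in H; unfold G1 in H; apply RtoC_inj.
rewrite <- H, !RtoC_plus, !RtoC_minus, !RtoC_mult, !RtoC_plus, !RtoC_mult, !RtoC_pow;
  ring.
Qed.

Lemma rphi_le_1 (q : R) : 0 < q < 1 -> rphi q <= 1.
Proof.
intros Hq; apply (is_lim_seq_le (rqpoch q) (fun _ => 1) (rphi q) 1).
- intros n; now apply rqpoch_le_1.
- now apply rphi_lim.
- apply is_lim_seq_const.
Qed.

Lemma rphi_ge (q : R) : 0 < q <= 1 / 2 -> 1 - 2 * q <= rphi q.
Proof.
intros Hq.
apply (is_lim_seq_le (fun _ => 1 - 2 * q) (rqpoch q) (1 - 2 * q) (rphi q)).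
- assert (H : forall n, 1 - 2 * q * (1 - q ^ n) <= rqpoch q n).
  { induction n as [|n IH]; [simpl; lra|].
    cbn [rqpoch]; assert (H1 := rqpoch_le_1 q n ltac:(lra)).
    assert (H2 := pow_lt q n ltac:(lra)); simpl pow.
    assert (0 < q * q ^ n) by nra.
    assert (rqpoch q n * (q * q ^ n) <= q * q ^ n) by nra.
    assert (2 * q * (q * q ^ n) <= q * q ^ n) by nra.
    lra. }
  intros n; specialize (H n); assert (H2 := pow_lt q n ltac:(lra)); nra.
- apply is_lim_seq_const.
- apply rphi_lim; lra.
Qed.

Lemma reta_multiple (n : nat) (y : R) :
  reta (INR n * y) = exp (- (PI * y / 12)) ^ n * rphi (exp (-2 * PI * y) ^ n).
Proof.
unfold reta; rewrite !exp_pow; f_equal; f_equal; [field|f_equal; ring].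
Qed.

(** Crude bounds that single out one of the conjugate solutions: for the quotients introduced below
    they say [x > 1] and [y < 1]. *)
Lemma eta_ratio_bounds (y : R) : 1 <= y ->
  reta (5 * y) * reta (10 * y) < reta y * reta (2 * y) /\
  reta y * reta (10 * y) < reta (2 * y) * reta (5 * y).
Proof.
intros Hy.
assert (E1 := reta_multiple 1 y); assert (E2 := reta_multiple 2 y).
assert (E5 := reta_multiple 5 y); assert (E10 := reta_multiple 10 y).
replace (INR 1) with 1 in E1 by (simpl; ring).
replace (INR 2) with 2 in E2 by (simpl; ring).
replace (INR 5) with 5 in E5 by (simpl; ring).
replace (INR 10) with 10 in E10 by (simpl; ring).
rewrite Rmult_1_l in E1.
set (u := exp (- (PI * y / 12))) in *; set (q := exp (-2 * PI * y)) in *.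
assert (Hu : 0 < u) by apply exp_pos.
assert (Hq0 : 0 < q) by apply exp_pos.
assert (Huq : u ^ 24 = q) by (unfold u, q; rewrite exp_pow; f_equal; simpl; field).
(* From [PI > 3] and [exp 1 >= 2]. It follows that [u^4 = q^(1/6) <= 1/2], while every value of
   [rphi] involved is at least [31/32]. *)
assert (Hq64 : q <= 1 / 64).
{ assert (Hpi : 3 < PI) by (assert (H := PI2_3_2); lra).
  apply Rle_trans with (exp (- (1)) ^ 6).
  - rewrite exp_pow; apply exp_le; simpl; nra.
  - replace (1 / 64) with ((1 / 2) ^ 6) by field; apply pow_incr.
    split; [apply Rlt_le, exp_pos|].
    rewrite exp_Ropp; replace (1 / 2) with (/ 2) by field.
    apply Rinv_le_contravar; [lra|]; assert (H := exp_ineq1_le 1); lra. }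
assert (Hpow : forall n, 0 < q ^ S n <= q).
{ intros n; split; [now apply pow_lt|].
  rewrite <- (pow_1 q) at 2; apply pow_le_pow; [lra|lia]. }
assert (Hphi : forall n, 31 / 32 <= rphi (q ^ S n) <= 1).
{ intros n; specialize (Hpow n); split.
  - assert (H := rphi_ge (q ^ S n) ltac:(lra)); lra.
  - apply rphi_le_1; lra. }
assert (P1 := Hphi 0%nat); assert (P2 := Hphi 1%nat).
assert (P5 := Hphi 4%nat); assert (P10 := Hphi 9%nat).
assert (Hu4 : u ^ 4 <= 1 / 2).
{ destruct (Rle_lt_dec (u ^ 4) (1 / 2)) as [|H]; auto; exfalso.
  replace (u ^ 24) with ((u ^ 4) ^ 6) in Huq by ring.
  assert (H2 : 1 / 4 < (u ^ 4) * (u ^ 4)) by nra.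
  assert (H3 : 1 / 8 < (u ^ 4) ^ 3).
  { replace ((u ^ 4) ^ 3) with (u ^ 4 * (u ^ 4 * u ^ 4)) by ring; nra. }
  replace ((u ^ 4) ^ 6) with ((u ^ 4) ^ 3 * (u ^ 4) ^ 3) in Huq by ring; nra. }
assert (Hu4' : 0 < u ^ 4) by now apply pow_lt.
rewrite E1, E2, E5, E10; split.
- replace (u ^ 5 * rphi (q ^ 5) * (u ^ 10 * rphi (q ^ 10))) with
    (u ^ 3 * (u ^ 4 * (u ^ 4 * (u ^ 4 * (rphi (q ^ 5) * rphi (q ^ 10)))))) by ring.
  replace (u ^ 1 * rphi (q ^ 1) * (u ^ 2 * rphi (q ^ 2))) with
    (u ^ 3 * (rphi (q ^ 1) * rphi (q ^ 2))) by ring.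
  apply Rmult_lt_compat_l; [now apply pow_lt|].
  assert (A1 : rphi (q ^ 5) * rphi (q ^ 10) <= 1) by nra.
  assert (A2 : 1 / 2 < rphi (q ^ 1) * rphi (q ^ 2)) by nra.
  assert (A0 : 0 < rphi (q ^ 5) * rphi (q ^ 10)) by nra.
  assert (A3 : u ^ 4 * (rphi (q ^ 5) * rphi (q ^ 10)) <= 1 / 2) by nra.
  assert (A4 : 0 < u ^ 4 * (rphi (q ^ 5) * rphi (q ^ 10))) by nra.
  assert (A5 : u ^ 4 * (u ^ 4 * (rphi (q ^ 5) * rphi (q ^ 10))) <= 1 / 2) by nra.
  nra.
- replace (u ^ 1 * rphi (q ^ 1) * (u ^ 10 * rphi (q ^ 10))) with
    (u ^ 7 * (u ^ 4 * (rphi (q ^ 1) * rphi (q ^ 10)))) by ring.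
  replace (u ^ 2 * rphi (q ^ 2) * (u ^ 5 * rphi (q ^ 5))) with
    (u ^ 7 * (rphi (q ^ 2) * rphi (q ^ 5))) by ring.
  apply Rmult_lt_compat_l; [now apply pow_lt|].
  assert (A1 : rphi (q ^ 1) * rphi (q ^ 10) <= 1) by nra.
  assert (A2 : 1 / 2 < rphi (q ^ 2) * rphi (q ^ 5)) by nra.
  nra.
Qed.

(** From here on [a], [b], [c], [d] are values of eta and not of its square, so the square roots in
    [x] and [y] disappear. *)
Lemma relation_10_1 (a b c d x y : R) : 0 < a -> 0 < b -> 0 < c -> 0 < d ->
  x = a * b / (c * d) -> y = a * d / (b * c) ->
  (a ^ 2) ^ 2 * (b ^ 2) ^ 2 * c ^ 2 * d ^ 2 +
  5 * a ^ 2 * b ^ 2 * (c ^ 2) ^ 2 * (d ^ 2) ^ 2 - (b ^ 2) ^ 3 * (c ^ 2) ^ 3 -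
  (a ^ 2) ^ 3 * (d ^ 2) ^ 3 = 0 -> x + 5 / x = y ^ 3 + / y ^ 3.
Proof.
intros Ha Hb Hc Hd -> -> H.
apply Rminus_diag_uniq.
match goal with |- ?e = 0 => replace e with
  (((a ^ 2) ^ 2 * (b ^ 2) ^ 2 * c ^ 2 * d ^ 2 +
    5 * a ^ 2 * b ^ 2 * (c ^ 2) ^ 2 * (d ^ 2) ^ 2 - (b ^ 2) ^ 3 * (c ^ 2) ^ 3 -
    (a ^ 2) ^ 3 * (d ^ 2) ^ 3) / (a * b * c * d) ^ 3) by (field; lra) end.
rewrite H; unfold Rdiv; ring.
Qed.

Lemma relation_10_2 (a b c d y z r2 : R) : 0 < a -> 0 < b -> 0 < c -> 0 < d ->
  r2 ^ 2 = 2 -> y = a * d / (b * c) -> z = r2 * (b * d) / (c * a) ->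
  (b ^ 2) ^ 6 * (c ^ 2) ^ 6 + (a ^ 2) ^ 6 * (d ^ 2) ^ 6 -
  10 * (a ^ 2 * b ^ 2 * c ^ 2 * d ^ 2) ^ 3 -
  (a ^ 2) ^ 5 * (c ^ 2) ^ 5 * b ^ 2 * d ^ 2 -
  16 * (b ^ 2) ^ 5 * (d ^ 2) ^ 5 * a ^ 2 * c ^ 2 = 0 ->
  y ^ 6 + / y ^ 6 - 10 = 4 * (z ^ 4 + / z ^ 4).
Proof.
intros Ha Hb Hc Hd Hr -> -> H.
assert (Hr4 : r2 ^ 4 = 4) by (replace (r2 ^ 4) with ((r2 ^ 2) ^ 2) by ring; rewrite Hr; ring).
replace ((r2 * (b * d) / (c * a)) ^ 4) with (4 * (b * d / (c * a)) ^ 4)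
  by (rewrite <- Hr4; field; lra).
apply Rminus_diag_uniq.
match goal with |- ?e = 0 => replace e with
  (((b ^ 2) ^ 6 * (c ^ 2) ^ 6 + (a ^ 2) ^ 6 * (d ^ 2) ^ 6 -
    10 * (a ^ 2 * b ^ 2 * c ^ 2 * d ^ 2) ^ 3 -
    (a ^ 2) ^ 5 * (c ^ 2) ^ 5 * b ^ 2 * d ^ 2 -
    16 * (b ^ 2) ^ 5 * (d ^ 2) ^ 5 * a ^ 2 * c ^ 2) / (a * b * c * d) ^ 6)
  by (field; lra) end.
rewrite H; unfold Rdiv; ring.
Qed.

(** By inversion [a'] and [b'] are the values of [eta^2] at [tau'] and [2 tau']. At level 26 the
    role of [x] is then played by [r2 * y0 * x] and that of [y] by [z], which explains the factor
    [r2] in [z]. *)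
Lemma relation_26 (a b c d x z r2 y0 : R) : 0 < a -> 0 < b -> 0 < c -> 0 < d ->
  0 < r2 -> 0 < y0 -> r2 ^ 2 = 2 ->
  x = a * b / (c * d) -> z = r2 * (b * d) / (c * a) ->
  let a' := 2 * y0 * b ^ 2 in let b' := y0 * a ^ 2 in
  a' ^ 2 * b' ^ 2 * c ^ 2 * d ^ 2 + 13 * a' * b' * (c ^ 2) ^ 2 * (d ^ 2) ^ 2 -
  b' ^ 3 * (c ^ 2) ^ 3 - a' ^ 3 * (d ^ 2) ^ 3 +
  4 * (a' * b' ^ 2 * (c ^ 2) ^ 2 * d ^ 2 + a' ^ 2 * b' * c ^ 2 * (d ^ 2) ^ 2) = 0 ->
  r2 * y0 * x + 13 / (r2 * y0 * x) = z ^ 3 + / z ^ 3 - 4 * (z + / z).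
Proof.
intros Ha Hb Hc Hd Hr2 Hy0 Hr -> -> a' b' H.
assert (Ea : a' = r2 ^ 2 * y0 * b ^ 2) by (unfold a'; rewrite Hr; ring).
rewrite Ea in H; unfold b' in H; clear Ea a' b'.
apply Rminus_diag_uniq.
match type of H with ?g = 0 =>
  match goal with |- ?e = 0 =>
    replace e with (g / (r2 * y0 * a * b * c * d) ^ 3) by (field; lra) end end.
rewrite H; unfold Rdiv; ring.
Qed.

(* The three relations eliminate to [(W - 20) (5 W^2 - 22 W + 13) = 0] for
   [W = (z + 1/z)^2], and [W >= 4] excludes the quadratic factor. *)
Lemma solve_relations (x y z k : R) : 1 < x -> 0 < y < 1 -> 0 < z -> 0 < k ->
  k ^ 2 = 13 / 5 -> x + 5 / x = y ^ 3 + / y ^ 3 ->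
  y ^ 6 + / y ^ 6 - 10 = 4 * (z ^ 4 + / z ^ 4) ->
  k * x + 13 / (k * x) = z ^ 3 + / z ^ 3 - 4 * (z + / z) ->
  x = 5 * sqrt 13 + 8 * sqrt 5 /\ y ^ 3 = 5 * sqrt 13 - 18.
Proof.
intros Hx Hy Hz Hk Hk2 E1 E2 E3.
set (S := x + 5 / x) in *; set (Z := z + / z).
assert (Hz' : 0 < / z) by now apply Rinv_0_lt_compat.
assert (HS : 0 < S).
{ unfold S; assert (0 < 5 / x) by (apply Rdiv_lt_0_compat; lra); lra. }
assert (HW4 : 4 <= Z ^ 2).
{ unfold Z; replace ((z + / z) ^ 2) with (4 + (z - / z) ^ 2) by (field; lra).
  assert (H := pow2_ge_0 (z - / z)); lra. }
assert (HS2 : S ^ 2 = 4 + 4 * (Z ^ 2 - 2) ^ 2).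
{ assert (E : y ^ 6 + / y ^ 6 = S ^ 2 - 2) by (rewrite E1; field; lra).
  assert (E' : z ^ 4 + / z ^ 4 = (Z ^ 2 - 2) ^ 2 - 2) by (unfold Z; field; lra).
  lra. }
(* As [13 = 5 k^2], the left side [k x + 13 / (k x)] is [k (x + 5/x)], so the first and the third
   relation share the unknown [S]. *)
assert (HkS : k * S = Z ^ 3 - 7 * Z).
{ transitivity (z ^ 3 + / z ^ 3 - 4 * (z + / z)).
  - rewrite <- E3; unfold S.
    replace 13 with (5 * k ^ 2) by (rewrite Hk2; field); field; lra.
  - unfold Z; field; lra. }
set (W := Z ^ 2) in *.
assert (HkS2 : 13 / 5 * S ^ 2 = W * (W - 7) ^ 2).
{ rewrite <- Hk2; replace (k ^ 2 * S ^ 2) with ((k * S) ^ 2) by ring.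
  rewrite HkS; unfold W; ring. }
assert (HW : W = 20).
{ assert (Hf : (W - 20) * (5 * W ^ 2 - 22 * W + 13) = 0).
  { rewrite HS2 in HkS2; lra. }
  apply Rmult_integral in Hf; destruct Hf as [Hf|Hf]; [lra|nra]. }
assert (HS1300 : S ^ 2 = 1300) by (rewrite HS2, HW; ring).
assert (H13 : sqrt 13 ^ 2 = 13) by (apply pow2_sqrt; lra).
assert (H5 : sqrt 5 ^ 2 = 5) by (apply pow2_sqrt; lra).
assert (P13 : 3 < sqrt 13).
{ replace 3 with (sqrt (3 ^ 2)) by (apply sqrt_pow2; lra).
  apply sqrt_lt_1; lra. }
assert (P5 : 0 < sqrt 5) by (apply sqrt_lt_R0; lra).
assert (HS10 : S = 10 * sqrt 13).
{ assert (Hf : (S - 10 * sqrt 13) * (S + 10 * sqrt 13) = 0).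
  { replace ((S - 10 * sqrt 13) * (S + 10 * sqrt 13)) with
      (S ^ 2 - 100 * sqrt 13 ^ 2) by ring; rewrite H13, HS1300; ring. }
  apply Rmult_integral in Hf; destruct Hf; lra. }
split.
- assert (Hq : x ^ 2 - 10 * sqrt 13 * x + 5 = 0).
  { rewrite <- HS10; unfold S; field; lra. }
  assert (Hf : (x - (5 * sqrt 13 + 8 * sqrt 5)) * (x - (5 * sqrt 13 - 8 * sqrt 5)) = 0).
  { replace ((x - (5 * sqrt 13 + 8 * sqrt 5)) * (x - (5 * sqrt 13 - 8 * sqrt 5)))
      with (x ^ 2 - 10 * sqrt 13 * x + (25 * sqrt 13 ^ 2 - 64 * sqrt 5 ^ 2)) by ring.
    rewrite H13, H5; lra. }
  (* The two roots have product 5 and the larger one exceeds 15, so the smaller one contradicts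
     [1 < x]. *)
  apply Rmult_integral in Hf; destruct Hf as [Hf|Hf]; [lra|exfalso].
  assert (Hc : 5 * sqrt 13 - 8 * sqrt 5 < 1); [|lra].
  assert (Hprod : (5 * sqrt 13 - 8 * sqrt 5) * (5 * sqrt 13 + 8 * sqrt 5) = 5).
  { replace ((5 * sqrt 13 - 8 * sqrt 5) * (5 * sqrt 13 + 8 * sqrt 5)) with
      (25 * sqrt 13 ^ 2 - 64 * sqrt 5 ^ 2) by ring; rewrite H13, H5; ring. }
  nra.
- assert (Hy3 : 0 < y ^ 3 < 1) by (apply pow_lt_1'; [lra|lia]).
  assert (Hq : (y ^ 3) ^ 2 - 10 * sqrt 13 * y ^ 3 + 1 = 0).
  { rewrite <- HS10, E1; field; lra. }
  assert (Hf : (y ^ 3 - (5 * sqrt 13 + 18)) * (y ^ 3 - (5 * sqrt 13 - 18)) = 0).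
  { replace ((y ^ 3 - (5 * sqrt 13 + 18)) * (y ^ 3 - (5 * sqrt 13 - 18)))
      with ((y ^ 3) ^ 2 - 10 * sqrt 13 * y ^ 3 + (25 * sqrt 13 ^ 2 - 324)) by ring.
    rewrite H13; lra. }
  apply Rmult_integral in Hf; destruct Hf as [Hf|Hf]; lra.
Qed.

Lemma eta_quotient_value :
  let y0 := sqrt (26 / 5) / 2 in
  (reta y0 / reta (5 * y0)) ^ 6 =
    (5 * sqrt 13 + 8 * sqrt 5) ^ 3 * (5 * sqrt 13 - 18).
Proof.
intros y0.
assert (Hy2 : y0 ^ 2 = 13 / 10).
{ unfold y0; replace ((sqrt (26 / 5) / 2) ^ 2) with (sqrt (26 / 5) ^ 2 / 4) by field.
  rewrite pow2_sqrt by lra; field. }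
assert (Hy0 : 0 < y0).
{ unfold y0; assert (0 < sqrt (26 / 5)) by (apply sqrt_lt_R0; lra); lra. }
assert (Hy1 : 1 <= y0) by nra.
destruct (eta_ratio_bounds y0 Hy1) as [B1 B2].
assert (R1 := level10_1_real y0 Hy0); assert (R2 := level10_2_real y0 Hy0).
assert (R3 := level26_real (/ (2 * y0)) ltac:(apply Rinv_0_lt_compat; lra)).
cbv zeta in R1, R2, R3.
assert (I1 := reta_inversion_sqr y0 Hy0).
assert (I2 := reta_inversion_sqr (2 * y0) ltac:(lra)).
replace (2 * / (2 * y0)) with (/ y0) in R3 by (field; lra).
replace (13 * / (2 * y0)) with (5 * y0) in R3.
2:{ apply Rmult_eq_reg_r with (2 * y0); [|lra].
    replace (13 * / (2 * y0) * (2 * y0)) with 13 by (field; lra).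
    replace (5 * y0 * (2 * y0)) with (10 * y0 ^ 2) by ring; rewrite Hy2; field. }
replace (26 * / (2 * y0)) with (10 * y0) in R3.
2:{ apply Rmult_eq_reg_r with (2 * y0); [|lra].
    replace (26 * / (2 * y0) * (2 * y0)) with 26 by (field; lra).
    replace (10 * y0 * (2 * y0)) with (20 * y0 ^ 2) by ring; rewrite Hy2; field. }
rewrite I1, I2 in R3.
assert (Pa := reta_pos y0 Hy0); assert (Pb := reta_pos (2 * y0) ltac:(lra)).
assert (Pc := reta_pos (5 * y0) ltac:(lra)); assert (Pd := reta_pos (10 * y0) ltac:(lra)).
set (a := reta y0) in *; set (b := reta (2 * y0)) in *.
set (c := reta (5 * y0)) in *; set (d := reta (10 * y0)) in *.
assert (Hr2 : 0 < sqrt 2) by (apply sqrt_lt_R0; lra).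
assert (Hr22 : sqrt 2 ^ 2 = 2) by (apply pow2_sqrt; lra).
set (x := a * b / (c * d)); set (y := a * d / (b * c)).
set (z := sqrt 2 * (b * d) / (c * a)).
assert (E1 := relation_10_1 a b c d x y Pa Pb Pc Pd eq_refl eq_refl R1).
assert (E2 := relation_10_2 a b c d y z (sqrt 2) Pa Pb Pc Pd Hr22 eq_refl eq_refl R2).
assert (E3 := relation_26 a b c d x z (sqrt 2) y0 Pa Pb Pc Pd Hr2 Hy0 Hr22
  eq_refl eq_refl R3).
assert (Pab : 0 < a * b) by nra; assert (Pcd : 0 < c * d) by nra.
assert (Pad : 0 < a * d) by nra; assert (Pbc : 0 < b * c) by nra.
destruct (solve_relations x y z (sqrt 2 * y0)) as [Vx Vy]; auto.
- unfold x; apply Rmult_lt_reg_r with (c * d); auto.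
  replace (a * b / (c * d) * (c * d)) with (a * b) by (field; lra); lra.
- split; [now apply Rdiv_lt_0_compat|].
  unfold y; apply Rmult_lt_reg_r with (b * c); auto.
  replace (a * d / (b * c) * (b * c)) with (a * d) by (field; lra); lra.
- unfold z; apply Rdiv_lt_0_compat; [|nra].
  apply Rmult_lt_0_compat; nra.
- nra.
- replace ((sqrt 2 * y0) ^ 2) with (sqrt 2 ^ 2 * y0 ^ 2) by ring.
  rewrite Hr22, Hy2; field.
(* Indeed [x * y = (a / c)^2], whose cube is the quotient to be evaluated. *)
- rewrite <- Vx, <- Vy; unfold x, y; field; lra.
Qed.

Theorem theorem2 :
  let a := 208818 - 93240 * sqrt 5 - 57825 * sqrt 13 + 25900 * sqrt 65 in
  rogers_ramanujan (exp (- PI * sqrt (26 / 5))) ^ 5 = sqrt (a ^ 2 + 1) - a.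
Proof.
intros a.
set (y0 := sqrt (26 / 5) / 2).
assert (Hy0 : 0 < y0).
{ unfold y0; assert (0 < sqrt (26 / 5)) by (apply sqrt_lt_R0; lra); lra. }
replace (- PI * sqrt (26 / 5)) with (-2 * PI * y0) by (unfold y0; field).
destruct (rogers_ramanujan_eta y0 Hy0) as [Hr Hrel]; cbv zeta in Hrel.
assert (Hv := eta_quotient_value); cbv zeta in Hv; fold y0 in Hv.
rewrite Hv in Hrel; clear Hv.
set (r := rogers_ramanujan (exp (-2 * PI * y0)) ^ 5) in *.
(* The number [2 a] is 11 plus the value of the eta quotient, so [r] is the positive root of
   [r^2 + 2 a r - 1 = 0]. *)
assert (Ha : / r - r = 2 * a).
{ replace (/ r - r) with ((/ r - 11 - r) + 11) by ring; rewrite Hrel; unfold a.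
  assert (H13 : sqrt 13 * sqrt 13 = 13) by (apply sqrt_sqrt; lra).
  assert (H5 : sqrt 5 * sqrt 5 = 5) by (apply sqrt_sqrt; lra).
  replace (sqrt 65) with (sqrt 5 * sqrt 13) by
    (rewrite <- sqrt_mult by lra; f_equal; ring).
  ring [H13 H5]. }
assert (Hs : sqrt (a ^ 2 + 1) = r + a).
{ replace a with ((/ r - r) / 2) by lra.
  replace (((/ r - r) / 2) ^ 2 + 1) with (((/ r + r) / 2) ^ 2) by (field; lra).
  assert (0 < / r) by now apply Rinv_0_lt_compat.
  rewrite sqrt_pow2 by lra; field; lra. }
rewrite Hs; ring.
Qed.
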